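(* Let $B$ be a body and let $P$ be a $G_{1A}$-structure on $B$, i.e. the structure given by a one-dimensional distribution $L$, a two-dimensional distribution $D$ with $L\subset D$, and a volume form $\Omega$ on $B$. Then $P$ is integrable if and only if $D$ is involutive.
   Context: A body is a $3$-dimensional smooth manifold which can be covered with one chart. $G_{1A}\subset GL(3,\mathbb{R})$ is the isotropy group of the subspaces $\langle e_3\rangle\subset\langle e_2,e_3\rangle$ of $\mathbb{R}^3$ and of the tensor $e^1\wedge e^2\wedge e^3$, where $(e_i)$ is the canonical basis and $(e^i)$ its dual basis. The corresponding $G_{1A}$-structure $P$ is the set of linear frames $(v_1,v_2,v_3)$ at points $x\in B$ such that $v_3$ spans $L_x$, $v_2,v_3$ span $D_x$, and $\Omega(v_1,v_2,v_3)=1$. A $G$-structure $P$ is integrable if around each point there are local coordinates $(x^1,x^2,x^3)$ whose coordinate frame $(\partial/\partial x^1,\partial/\partial x^2,\partial/\partial x^3)$ is a section of $P$. *)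

(* Defs.v *)
From HB Require Import structures.
From mathcomp Require Import all_boot all_order all_algebra.
From mathcomp Require Import all_classical all_reals all_analysis.

Set Implicit Arguments.
Unset Strict Implicit.
Unset Printing Implicit Defensive.

Import Order.TTheory GRing.Theory Num.Theory.
Import numFieldNormedType.Exports.

Local Open Scope classical_set_scope.
Local Open Scope ring_scope.

(* Functions are total; for open U, only the values of f on U matter. *)
Fixpoint Ck_on (R : realType) (V W : normedModType R) (k : nat)
    (U : set V) (f : V -> W) : Prop :=
  if k is k'.+1 then
    (forall x, U x -> differentiable f x) /\
    (forall v : V, Ck_on k' U ('D_v f))
  else forall x, U x -> {for x, continuous f}.

Definition smooth_on (R : realType) (V W : normedModType R)
    (U : set V) (f : V -> W) : Prop :=
  forall k, Ck_on k U f.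

(* A manifold with a global chart: the chart is a homeomorphism onto an open
   subset of R^3 and determines the smooth structure.  The values of chart_inv
   outside the image of the chart are irrelevant. *)
Record body (R : realType) := Body {
  body_space :> topologicalType;
  chart : body_space -> 'rV[R]_3;
  chart_inv : 'rV[R]_3 -> body_space;
  chartK : cancel chart chart_inv;
  chart_continuous : continuous chart;
  chart_open : forall V : set body_space, open V -> open (chart @` V)
}.

Section Body.
Context (R : realType) (B : body R).

(* Tangent vectors at any point of B are given by their components in the frame
   of the global chart, so that every tangent space is 'rV[R]_3. *)
Notation tangent := 'rV[R]_3.
Notation chart := (@chart R B).
Notation chart_inv := (@chart_inv R B).

Definition smooth_in (W : normedModType R) (V : set B) (f : B -> W) : Prop :=
  smooth_on (chart @` V) (f \o chart_inv).

Definition deriv_along (W : normedModType R) (f : B -> W) (x : B)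
    (v : tangent) : W :=
  'D_v (f \o chart_inv) (chart x).

Definition lie_bracket (X Y : B -> tangent) (x : B) : tangent :=
  deriv_along Y x (X x) - deriv_along X x (Y x).

Record tangent_distribution (k : nat) := TangentDistribution {
  distr_space :> B -> {vspace tangent};
  distr_dim : forall x, \dim (distr_space x) = k;
  distr_smooth : forall x, exists (V : set B) (X : 'I_k -> B -> tangent),
    [/\ open V, V x, forall i, smooth_in V (X i) &
        forall p, V p -> distr_space p = (\sum_(i < k) <[X i p]>)%VS]
}.

Definition involutive_distribution (k : nat)
    (D : tangent_distribution k) : Prop :=
  forall (V : set B) (X Y : B -> tangent),
    open V -> smooth_in V X -> smooth_in V Y ->
    (forall p, V p -> X p \in D p) -> (forall p, V p -> Y p \in D p) ->
    forall p, V p -> lie_bracket X Y p \in D p.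

Record volume_form := VolumeForm {
  vol :> B -> tangent -> tangent -> tangent -> R;
  vol_linear1 : forall x v w, linear (fun u => vol x u v w : R^o);
  vol_linear2 : forall x u w, linear (fun v => vol x u v w : R^o);
  vol_linear3 : forall x u v, linear (fun w => vol x u v w : R^o);
  vol_alt12 : forall x u w, vol x u u w = 0;
  vol_alt13 : forall x u v, vol x u v u = 0;
  vol_alt23 : forall x u v, vol x u v v = 0;
  vol_neq0 : forall x, exists u v w, vol x u v w != 0;
  vol_smooth : forall u v w,
    smooth_in setT (fun x => vol x u v w : R^o)
}.

(* The fibre at x consists of triples (v1, v2, v3) of tangent vectors at x. *)
Definition frame_set := B -> set (tangent * tangent * tangent).

Definition G1A_structure (L : tangent_distribution 1)
    (D : tangent_distribution 2) (Omega : volume_form) : frame_set :=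
  fun x => [set v | let: (v1, v2, v3) := v in
    [/\ free [:: v1; v2; v3], <[v3]>%VS = L x,
        <<[:: v2; v3]>>%VS = D x & Omega x v1 v2 v3 = 1]].

(* Smooth local coordinates y on V, with inverse z : y(V) -> V. *)
Definition local_coordinates (V : set B) (y : B -> 'rV[R]_3)
    (z : 'rV[R]_3 -> B) : Prop :=
  [/\ open V, open (y @` V), forall p, V p -> z (y p) = p,
      smooth_in V y & smooth_on (y @` V) (chart \o z)].

Definition coordinate_vector (y : B -> 'rV[R]_3) (z : 'rV[R]_3 -> B)
    (i : 'I_3) (p : B) : tangent :=
  'D_(delta_mx 0 i) (chart \o z) (y p).

Definition coordinate_frame (y : B -> 'rV[R]_3) (z : 'rV[R]_3 -> B) (p : B) :
    tangent * tangent * tangent :=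
  (coordinate_vector y z 0 p, coordinate_vector y z 1 p,
   coordinate_vector y z 2 p).

Definition integrable_structure (P : frame_set) : Prop :=
  forall x, exists (V : set B) (y : B -> 'rV[R]_3) (z : 'rV[R]_3 -> B),
    [/\ local_coordinates V y z, V x &
        forall p, V p -> P p (coordinate_frame y z p)].

End Body.

(* Main.v *)
(* If [P] is integrable, D is locally the kernel of the differential of the first
   adapted coordinate [h], and for fields X, Y in D the symmetry of the second
   derivatives of [h] gives [X, Y] h = 0.

   Conversely, after a permutation of the coordinates, D is spanned by
   m = d_2 + P d_1 and n = d_3 + Q d_1, and L by l = n + b m; then D is involutive iff
   d_2 Q + P d_1 Q = d_3 P + Q d_1 P.  This is the compatibility condition for
   d_2 u = P(u, x2, x3), d_3 u = Q(u, x2, x3), u solved for first along the second axis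
   and then along the third; the shear x1 |-> u straightens D.  A second shear
   x2 |-> u3 with d_3 u3 = b straightens L, and a third one x3 |-> u5 only rescales the
   third axis, by a solution of d_3 u5 = 1 / rho(u5) chosen so that the volume becomes 1.
   All three are flows of ordinary differential equations in one coordinate with the
   others as parameters, so one only needs smooth dependence on parameters and the
   inverse function theorem for maps changing a single coordinate. *)
Require Import Defs.
From HB Require Import structures.
From mathcomp Require Import all_boot all_order all_algebra.
From mathcomp Require Import all_classical all_reals all_analysis.
From mathcomp Require Import ring lra.

Set Implicit Arguments.
Unset Strict Implicit.
Unset Printing Implicit Defensive.

Import Order.TTheory GRing.Theory Num.Theory.
Import numFieldNormedType.Exports.

Local Open Scope classical_set_scope.
Local Open Scope ring_scope.

(** * Functions of class C^k *)

(** The compatibility condition arises because [[m, n]] has a component along the first axis only,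
    while D, a graph over the other two axes, meets that axis in zero: the bracket lies in D exactly
    when it vanishes. The shears are composed so that none undoes an earlier one. The coordinate
    vectors of the composite are combinations of [d_1, m, l] with a matrix that is triangular for
    the flag; the third shear only rescales [l] and adds multiples of [l] to the other two vectors.
    The volume is then the product of the diagonal entries and [om], so one scalar equation along
    the third axis can normalise it. The analytic obstacle is smoothness in the parameters. It is
    obtained by a bootstrap: a parameter derivative solves the linear variational equation, whose
    coefficients are as regular as the solution, so that class C^k improves to class C^(k+1). The
    inverse of a shear is treated in the same way, its partial derivatives being expressions in the
    inverse itself. *)

Lemma differentiable_approxP (R : realType) (V W : normedModType R)
    (f : V -> W) (x : V) (L : {linear V -> W}) : continuous L ->
  (forall e : R, 0 < e ->
     \forall h \near (0 : V), `|f (h + x) - f x - L h| <= e * `|h|) ->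
  differentiable f x /\ forall v, 'D_v f x = L v.
Proof.
move=> Lc H.
have E : f \o shift x = cst (f x) + L +o_ 0 id.
  apply/eqaddoP => e e0; have := H e e0; apply: filterS => h.
  by rewrite -![(_ - _ : _ -> _) _]/(_ - _) /= opprD addrA.
have dE := diff_unique Lc E.
have df : differentiable f x.
  by apply/diff_locallyP; rewrite dE.
by split=> // v; rewrite deriveE// dE.
Qed.

Lemma differentiable_approx (R : realType) (V W : normedModType R)
    (f : V -> W) (x : V) : differentiable f x ->
  forall e : R, 0 < e ->
     \forall h \near (0 : V), `|f (h + x) - f x - 'D_h f x| <= e * `|h|.
Proof.
move=> df e e0; have /diff_locallyP[_ /eqaddoP /(_ e e0)] := df.
apply: filterS => h.
by rewrite -![(_ - _ : _ -> _) _]/(_ - _) /= opprD addrA deriveE.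
Qed.

Lemma near_eq_differentiable (R : realType) (V W : normedModType R)
    (f g : V -> W) (x : V) :
  (\near x, f x = g x) -> differentiable f x -> differentiable g x.
Proof.
move=> fg df.
have dc : continuous ('d f x) by exact: diff_continuous.
have [] // := @differentiable_approxP _ _ _ g x ('d f x) dc.
move=> e e0; have fgx := nbhs_singleton fg.
have fg0 : \forall h \near (0 : V), f (h + x) = g (h + x).
  by move: fg; rewrite (near_shift 0) /= ; apply: filterS => h; rewrite subr0.
have := differentiable_approx df e0; apply: filterS2 fg0 => h fgh.
by rewrite -fgh -fgx deriveE.
Qed.

Lemma near_open (T : topologicalType) (U : set T) (P : T -> Prop) x :
  open U -> U x -> (forall y, U y -> P y) -> \forall y \near x, P y.
Proof. by move=> oU Ux UP; apply: filterS (open_nbhs_nbhs (conj oU Ux)). Qed.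

Lemma near_normP (R : realType) (V : normedModType R) (P : V -> Prop) (x : V) :
  (\forall y \near x, P y) <->
  exists2 d : R, 0 < d & forall y, `|y - x| < d -> P y.
Proof.
split=> [/nbhs_ballP[d /= d0 dP]|[d d0 dP]].
  by exists d => // y yd; apply: dP; rewrite -ball_normE /= distrC.
apply/nbhs_ballP; exists d => // y; rewrite -ball_normE /= distrC.
exact: dP.
Qed.

(** Real-valued functions need [R^o], the line as a normed module over itself, as codomain. *)
Notation Ck_fun k U f := (Ck_on (W := _^o) k U f).

Section Ck.
Context {R : realType}.
Implicit Types V W : normedModType R.

(** Since [U] is open, equality on [U] is equality of germs and passes to derivatives. The closure
    properties below therefore need to identify a derivative on [U] only. *)
Lemma Ck_on_eq V W k (U : set V) (f g : V -> W) : open U ->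
  (forall x, U x -> f x = g x) -> Ck_on k U f -> Ck_on k U g.
Proof.
move=> oU; elim: k f g => [|k IH] f g fg /=.
  move=> fc x Ux; have fgx : \forall y \near x, f y = g y by exact: near_open fg.
  rewrite /prop_for /continuous_at -fg//.
  by apply: cvg_trans (fc x Ux); apply: near_eq_cvg.
move=> [df Df]; split=> [x Ux|v].
  by apply: near_eq_differentiable (df x Ux); exact: near_open fg.
apply: IH (Df v) => x Ux.
by apply: near_eq_derive; exact: near_open fg.
Qed.

Lemma Ck_on_sub V W k (U U' : set V) (f : V -> W) : U' `<=` U ->
  Ck_on k U f -> Ck_on k U' f.
Proof.
move=> UU'; elim: k f => [|k IH] f /=; first by move=> fc x /UU'; exact: fc.
by move=> [df Df]; split=> [x /UU' /df//|v]; exact: IH.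
Qed.

Lemma Ck_on_differentiable V W k (U : set V) (f : V -> W) x :
  Ck_on k.+1 U f -> U x -> differentiable f x.
Proof. by move=> [H _]; exact: H. Qed.

Lemma Ck_fun_derive V k (U : set V) (f : V -> R) v :
  Ck_fun k.+1 U f -> Ck_fun k U ('D_v f).
Proof. by move=> [_ +]; apply. Qed.

Lemma Ck_onS V W k (U : set V) (f : V -> W) : Ck_on k.+1 U f -> Ck_on k U f.
Proof.
elim: k f => [|k IH] f /=.
  by move=> [df _] x Ux; exact/differentiable_continuous/df.
by move=> [df Df]; split=> // v; apply: IH; exact: Df.
Qed.

Lemma Ck_on_le V W k l (U : set V) (f : V -> W) : (l <= k)%N ->
  Ck_on k U f -> Ck_on l U f.
Proof.
move=> lk; rewrite -(subnK lk); elim: (k - l)%N => // m IH.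
by move=> H; apply: IH; exact: Ck_onS H.
Qed.

Lemma Ck_on0 V W k (U : set V) (f : V -> W) : Ck_on k U f ->
  forall x, U x -> {for x, continuous f}.
Proof. exact: (@Ck_on_le _ _ k 0). Qed.

Lemma Ck_on_cst V W k (U : set V) (c : W) : Ck_on k U (fun _ => c).
Proof.
elim: k c => [|k IH] c /=; first by move=> x _; exact: cvg_cst.
split=> [x _|v]; first exact: differentiable_cst.
by rewrite (_ : 'D_v _ = fun _ => 0)//; apply/funext => x; exact: derive_cst.
Qed.

Lemma Ck_on_linear V W k (U : set V) (f : {linear V -> W}) : continuous f ->
  Ck_on k U f.
Proof.
move=> fc; case: k => [|k] /=; first by move=> x _; exact: fc.
split=> [x _|v]; first exact: linear_differentiable.
rewrite (_ : 'D_v f = fun _ => f v); first exact: Ck_on_cst.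
apply/funext => x; rewrite deriveE ?diff_lin//; exact: linear_differentiable.
Qed.

Lemma Ck_onD V W k (U : set V) (f g : V -> W) : open U ->
  Ck_on k U f -> Ck_on k U g -> Ck_on k U (fun x => f x + g x).
Proof.
move=> oU; elim: k f g => [|k IH] f g /=.
  by move=> fc gc x Ux; apply: cvgD; [exact: fc|exact: gc].
move=> [df Df] [dg Dg]; split=> [x Ux|v].
  by apply: differentiableD; [exact: df|exact: dg].
apply: Ck_on_eq (IH _ _ (Df v) (Dg v)) => // x Ux.
by rewrite -deriveD//; apply: diff_derivable; [exact: df|exact: dg].
Qed.

Lemma Ck_onN V W k (U : set V) (f : V -> W) : open U ->
  Ck_on k U f -> Ck_on k U (fun x => - f x).
Proof.
move=> oU; elim: k f => [|k IH] f /=.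
  by move=> fc x Ux; apply: cvgN; exact: fc.
move=> [df Df]; split=> [x Ux|v].
  by apply: differentiableN; exact: df.
apply: Ck_on_eq (IH _ (Df v)) => // x Ux.
by rewrite -deriveN//; apply: diff_derivable; exact: df.
Qed.

Lemma Ck_onB V W k (U : set V) (f g : V -> W) : open U ->
  Ck_on k U f -> Ck_on k U g -> Ck_on k U (fun x => f x - g x).
Proof. by move=> oU fk gk; apply: Ck_onD => //; exact: Ck_onN. Qed.

Lemma Ck_on_sum V W k (U : set V) n (f : 'I_n -> V -> W) : open U ->
  (forall i, Ck_on k U (f i)) -> Ck_on k U (fun x => \sum_i f i x).
Proof.
move=> oU; elim: n f => [|n IH] f fk.
  by apply: Ck_on_eq (Ck_on_cst k U 0) => // x _; rewrite big_ord0.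
have := Ck_onD oU (IH _ (fun i => fk (widen_ord (leqnSn n) i))) (fk ord_max).
by apply: Ck_on_eq => // x _; rewrite big_ord_recr.
Qed.

Lemma Ck_funD V k (U : set V) (f g : V -> R) : open U ->
  Ck_fun k U f -> Ck_fun k U g -> Ck_fun k U (fun x => f x + g x).
Proof. exact: Ck_onD. Qed.

Lemma Ck_funN V k (U : set V) (f : V -> R) : open U ->
  Ck_fun k U f -> Ck_fun k U (fun x => - f x).
Proof. exact: Ck_onN. Qed.

Lemma Ck_funB V k (U : set V) (f g : V -> R) : open U ->
  Ck_fun k U f -> Ck_fun k U g -> Ck_fun k U (fun x => f x - g x).
Proof. exact: Ck_onB. Qed.

Lemma Ck_fun_sum V k (U : set V) n (f : 'I_n -> V -> R) : open U ->
  (forall i, Ck_fun k U (f i)) -> Ck_fun k U (fun x => \sum_i f i x).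
Proof. exact: Ck_on_sum. Qed.

Lemma Ck_fun_cst V k (U : set V) (c : R) : Ck_fun k U (fun _ => c).
Proof. exact: Ck_on_cst. Qed.

Lemma deriveM_diff V (f g : V -> R) x v :
  differentiable f x -> differentiable g x ->
  'D_v (fun x => f x * g x) x = f x * 'D_v g x + g x * 'D_v f x.
Proof. by move=> df dg; rewrite deriveM//; exact: diff_derivable. Qed.

Lemma Ck_funM V k (U : set V) (f g : V -> R) : open U ->
  Ck_fun k U f -> Ck_fun k U g -> Ck_fun k U (fun x => f x * g x).
Proof.
move=> oU; elim: k f g => [|k IH] f g.
  by move=> /= fc gc x Ux; apply: cvgM; [exact: fc|exact: gc].
move=> fk gk; have [df Df] := fk; have [dg Dg] := gk.
split=> [x Ux|v].
  by apply: differentiableM; [exact: df|exact: dg].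
have := Ck_funD oU (IH _ _ (Ck_onS fk) (Dg v)) (IH _ _ (Ck_onS gk) (Df v)).
apply: Ck_on_eq => // x Ux.
by rewrite deriveM_diff//; [exact: df|exact: dg].
Qed.

Lemma deriveV_diff V (f : V -> R) x v : f x != 0 ->
  differentiable f x ->
  'D_v (fun x => (f x)^-1) x = - ((f x)^-1 * (f x)^-1 * 'D_v f x).
Proof.
move=> fx df; rewrite deriveV//; last exact: diff_derivable.
by rewrite -exprVn expr2 scaleNr.
Qed.

Lemma Ck_funV V k (U : set V) (f : V -> R) : open U ->
  (forall x, U x -> f x != 0) ->
  Ck_fun k U f -> Ck_fun k U (fun x => (f x)^-1).
Proof.
move=> oU f0; elim: k => [|k IH].
  by move=> /= fc x Ux; apply: cvgV; [exact: f0|exact: fc].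
move=> fk; have [df Df] := fk; have IH' := IH (Ck_onS fk).
split=> [x Ux|v].
  by apply: differentiableV; [exact: df|exact: f0].
have := Ck_funN oU (Ck_funM oU (Ck_funM oU IH' IH') (Df v)).
apply: Ck_on_eq => // x Ux.
by rewrite deriveV_diff//; [exact: f0|exact: df].
Qed.

Lemma Ck_onZl V W k (U : set V) (f : V -> R) (w : W) : open U ->
  Ck_fun k U f -> Ck_on k U (fun x => f x *: w).
Proof.
move=> oU; elim: k f => [|k IH] f.
  by move=> /= fc x Ux; apply: cvgZl; exact: fc.
move=> [df Df]; split=> [x Ux|v].
  by apply: differentiableZl; exact: df.
apply: Ck_on_eq (IH _ (Df v)) => // x Ux.
have dfx : differentiable (f : V -> R) x by exact: df.
by rewrite (deriveE v (differentiableZl w dfx)) diffZl// deriveE.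
Qed.

Lemma Ck_on_lincomp V W W' k (U : set V) (L : {linear W -> W'}) (f : V -> W) :
  open U -> continuous L -> Ck_on k U f -> Ck_on k U (fun x => L (f x)).
Proof.
move=> oU Lc; have dL y : differentiable L y by exact: linear_differentiable.
elim: k f => [|k IH] f.
  by move=> /= fc x Ux; apply: continuous_comp; [exact: fc|exact: Lc].
move=> [df Df]; split=> [x Ux|v].
  by apply: differentiable_comp => //; exact: df.
apply: Ck_on_eq (IH _ (Df v)) => // x Ux; have dfx := df x Ux.
rewrite [RHS]deriveE; last exact: differentiable_comp.
by rewrite diff_comp// diff_lin//= deriveE.
Qed.

End Ck.

(** * Row vectors: coordinates and the chain rule *)

Definition rV_coord (R : realType) n (i : 'I_n) (x : 'rV[R]_n) : R^o := x 0 i.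

Lemma rV_coord_is_linear (R : realType) n (i : 'I_n) : linear (@rV_coord R n i).
Proof. by move=> a x y; rewrite /rV_coord !mxE. Qed.

HB.instance Definition _ (R : realType) n (i : 'I_n) :=
  GRing.isLinear.Build R 'rV[R]_n R^o _ (@rV_coord R n i) (@rV_coord_is_linear R n i).

Notation dir i := (delta_mx (0 : 'I_1) i).

Section Coordinates.
Context {R : realType}.
Implicit Types V W : normedModType R.

Lemma rV_coord_continuous n (i : 'I_n) : continuous (@rV_coord R n i).
Proof. exact: coord_continuous. Qed.

Lemma Ck_on_coord V n k (U : set V) (f : V -> 'rV[R]_n) i : open U ->
  Ck_on k U f -> Ck_fun k U (fun x => f x 0 i).
Proof.
by move=> oU fk; apply: (Ck_on_lincomp (L := rV_coord i)) => //;
  exact: rV_coord_continuous.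
Qed.

Lemma Ck_on_rV V n k (U : set V) (f : V -> 'rV[R]_n) : open U ->
  (forall i, Ck_fun k U (fun x => f x 0 i)) -> Ck_on k U f.
Proof.
move=> oU fk.
have := Ck_on_sum oU (fun i => Ck_onZl (dir i) oU (fk i)).
by apply: Ck_on_eq => // x _; rewrite -row_sum_delta.
Qed.

Lemma Ck_fun_proj n k (U : set 'rV[R]_n) i : Ck_fun k U (fun x => x 0 i).
Proof. by apply: (Ck_on_linear k U (f := rV_coord i)); exact: rV_coord_continuous. Qed.

Lemma derive_coord V n (f : V -> 'rV[R]_n) x v i : differentiable f x ->
  'D_v (fun y => f y 0 i : R^o) x = ('D_v f x) 0 i.
Proof.
by move=> df; rewrite [in RHS]derive_mx ?mxE//; exact: diff_derivable.
Qed.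

Lemma derive_sum_dir W n (f : 'rV[R]_n -> W) x v : differentiable f x ->
  'D_v f x = \sum_i v 0 i *: 'D_(dir i) f x.
Proof.
move=> df; rewrite deriveE// [v in LHS]row_sum_delta linear_sum.
by apply: eq_bigr => i _; rewrite linearZ deriveE.
Qed.

Lemma derive_comp V V' W (f : V' -> W) (g : V -> V') x v :
  differentiable f (g x) -> differentiable g x ->
  'D_v (f \o g) x = 'D_('D_v g x) f (g x).
Proof.
move=> df dg; rewrite deriveE; last exact: differentiable_comp.
by rewrite diff_comp//= !deriveE.
Qed.

Lemma derive_comp_rV V W n (f : 'rV[R]_n -> W) (g : V -> 'rV[R]_n) x v :
  differentiable f (g x) -> differentiable g x ->
  'D_v (f \o g) x = \sum_i ('D_v g x) 0 i *: 'D_(dir i) f (g x).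
Proof. by move=> df dg; rewrite derive_comp// derive_sum_dir. Qed.

(** By the chain rule a derivative of [f \o g] is a sum of coordinates of ['D_v g] times partial
    derivatives of [f] composed with [g]; the induction runs over all [f], so it covers these
    compositions. *)
Lemma Ck_fun_comp V n k (U : set V) (U' : set 'rV[R]_n)
    (f : 'rV[R]_n -> R) (g : V -> 'rV[R]_n) : open U ->
  (forall x, U x -> U' (g x)) -> Ck_fun k U' f -> Ck_on k U g ->
  Ck_fun k U (f \o g).
Proof.
move=> oU UU'; elim: k f g UU' => [|k IH] f g UU' fk gk.
  by move=> x Ux; apply: continuous_comp; [exact: gk|exact/fk/UU'].
have [df Df] := fk; have [dg Dg] := gk.
split=> [x Ux|v].
  by apply: differentiable_comp; [exact: dg|exact/df/UU'].
have := Ck_fun_sum oU (fun i => Ck_funM oU (Ck_on_coord i oU (Dg v))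
   (IH _ _ UU' (Df (dir i)) (Ck_onS gk))).
apply: Ck_on_eq => // x Ux.
by rewrite derive_comp_rV//; [exact/df/UU'|exact: dg].
Qed.

Lemma Ck_on_comp V n m k (U : set V) (U' : set 'rV[R]_n)
    (f : 'rV[R]_n -> 'rV[R]_m) (g : V -> 'rV[R]_n) : open U -> open U' ->
  (forall x, U x -> U' (g x)) -> Ck_on k U' f -> Ck_on k U g ->
  Ck_on k U (f \o g).
Proof.
move=> oU oU' UU' fk gk; apply: Ck_on_rV => // i.
exact: (Ck_fun_comp oU UU' (Ck_on_coord i oU' fk) gk).
Qed.

End Coordinates.

(** * Derivatives of functions of one real variable *)

Section OneVariable.
Context {R : realType}.
Implicit Types (f g w : R -> R) (c d t : R).

Lemma is_derive_continuous f t (a : R) : is_derive t 1 f a -> {for t, continuous f}.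
Proof.
move=> H; apply/differentiable_continuous/derivable1_diffP.
exact: (@ex_derive _ _ _ _ _ _ _ H).
Qed.

Lemma is_deriveD_fun f g t (a b : R) : is_derive t 1 f a -> is_derive t 1 g b ->
  is_derive t 1 (fun s => f s + g s) (a + b).
Proof. by move=> H1 H2; exact: (@is_deriveD _ _ _ _ _ _ _ _ _ H1 H2). Qed.

Lemma is_deriveB_fun f g t (a b : R) : is_derive t 1 f a -> is_derive t 1 g b ->
  is_derive t 1 (fun s => f s - g s) (a - b).
Proof. by move=> H1 H2; exact: (@is_deriveB _ _ _ _ _ _ _ _ _ H1 H2). Qed.

Lemma is_deriveM_fun f g t (a b : R) : is_derive t 1 f a -> is_derive t 1 g b ->
  is_derive t 1 (fun s => f s * g s) (f t * b + g t * a).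
Proof. by move=> H1 H2; exact: (@is_deriveM _ _ _ _ _ _ _ _ H1 H2). Qed.

Lemma is_derive_expR_comp f t (a : R) : is_derive t 1 f a ->
  is_derive t 1 (fun s => expR (f s)) (expR (f t) * a).
Proof.
by move=> H; exact: (@is_derive1_comp _ expR f t _ _ (is_derive_expR _) H).
Qed.

Lemma is_derive_affine (a b t : R) : is_derive t 1 (fun s => a + s * b) b.
Proof.
have H : is_derive t 1 (fun s : R => s * b) b.
  have H1 : is_derive t (1 : R) (fun s : R => s) 1 by exact: is_derive_id.
  have H2 : is_derive t (1 : R) (fun s : R => b) 0 by exact: is_derive_cst.
  have := is_deriveM_fun H1 H2; rewrite mulr0 add0r mulr1; exact.
have H3 : is_derive t (1 : R) (fun s : R => a) 0 by exact: is_derive_cst.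
by have := is_deriveD_fun H3 H; rewrite add0r.
Qed.

Lemma is_derive_segment w c d (t : R) (a : R) :
  is_derive (c + t * d) 1 w a ->
  is_derive t 1 (fun s => w (c + s * d)) (a * d).
Proof.
by move=> H; exact: (@is_derive1_comp _ w (fun s => c + s * d) t _ _ H
  (is_derive_affine _ _ _)).
Qed.

End OneVariable.

(** * The mean value theorem along a line *)

Section MeanValue.
Context {R : realType}.
Implicit Types V : normedModType R.

Lemma is_derive_line V (f : V -> R) x v (t : R) :
  derivable f (x + t *: v) v ->
  is_derive t 1 (fun s : R => f (x + s *: v)) ('D_v f (x + t *: v)).
Proof.
move=> df.
have E : (fun h : R => h^-1 *: (((fun s : R => f (x + s *: v)) \o shift t) (h *: 1)
            - f (x + t *: v))) =
         (fun h => h^-1 *: ((f \o shift (x + t *: v)) (h *: v) - f (x + t *: v))).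
  apply/funext => h /=; congr (_ *: (f _ - _)).
  by rewrite [h *: 1]mulr1 scalerDl addrCA.
by split; [rewrite /derivable E|rewrite /derive E].
Qed.

Lemma mean_value_segment V (f : V -> R) x v (s : R) :
  (forall t : R, 0 <= t <= 1 -> derivable f (x + (t * s) *: v) v) ->
  exists2 t : R, 0 <= t <= 1 &
    f (x + s *: v) - f x = s * 'D_v f (x + (t * s) *: v).
Proof.
move=> df; pose g (t : R) := f (x + (0 + t * s) *: v).
have dg (t : R) : 0 <= t <= 1 ->
    is_derive t 1 g ('D_v f (x + (t * s) *: v) * s).
  move=> t01; rewrite -[X in x + X *: v]add0r.
  apply: (is_derive_segment (w := fun t => f (x + t *: v))).
  by apply: is_derive_line; rewrite add0r; exact: df.
have dg' (t : R) : t \in `]0, 1[ ->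
    is_derive t 1 g ('D_v f (x + (t * s) *: v) * s).
  by rewrite in_itv /= => /andP[? ?]; apply: dg; rewrite !ltW.
have gc : {within `[0, 1], continuous g}.
  apply: derivable_within_continuous => t; rewrite in_itv /= => t01.
  exact: (@ex_derive _ _ _ _ _ _ _ (dg t t01)).
have [t t01] := MVT_segment ler01 dg' gc.
rewrite /g !add0r mul1r mul0r scale0r addr0 subr0 mulr1 mulrC => ->.
by exists t => //; move: t01; rewrite in_itv.
Qed.

Lemma mean_value V (f : V -> R) x v (s : R) :
  (forall t : R, `|t| <= `|s| -> derivable f (x + t *: v) v) ->
  exists2 t : R, `|t| <= `|s| & f (x + s *: v) - f x = s * 'D_v f (x + t *: v).
Proof.
have ts (t : R) : 0 <= t <= 1 -> `|t * s| <= `|s|.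
  by move=> /andP[t0 t1]; rewrite normrM ger0_norm// ler_piMl.
move=> df; have [t /ts ? E] := mean_value_segment (fun t t01 => df _ (ts t t01)).
by exists (t * s).
Qed.

End MeanValue.

(** * Continuous partial derivatives and symmetry of second derivatives *)

Section Partials.
Context {R : realType}.
Implicit Types V W : normedModType R.

Lemma ler_coord_norm n (x : 'rV[R]_n) i : `|x 0 i| <= `|x|.
Proof.
rewrite [leRHS]/Num.Def.normr/= mx_normrE.
exact: (le_trans _ (le_bigmax _ _ (0, i))).
Qed.

Lemma ler_coordB_norm n (x y : 'rV[R]_n) i : `|x 0 i - y 0 i| <= `|x - y|.
Proof. by have := ler_coord_norm (x - y) i; rewrite mxE [(- y) 0 i]mxE. Qed.

Lemma rV_norm_le n (x : 'rV[R]_n) r : 0 <= r ->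
  (forall i, `|x 0 i| <= r) -> `|x| <= r.
Proof.
move=> r0 xr; rewrite /Num.Def.normr/= mx_normrE (bigmax_le _ r0)//= => -[i j] _.
by rewrite ord1 xr.
Qed.

Lemma norm_dir n (i : 'I_n) : `|dir i : 'rV[R]_n| = 1.
Proof.
apply/le_anti/andP; split.
  by apply: rV_norm_le => // j; rewrite mxE/=; case: (_ == _); rewrite ?normr1 ?normr0.
by have := ler_coord_norm (dir i : 'rV[R]_n) i; rewrite mxE !eqxx normr1.
Qed.

(** The increment is split along a path that changes one coordinate at a time; the mean value
    theorem turns each piece into a partial derivative at a nearby point. *)
Lemma differentiable_partials n (U : set 'rV[R]_n) (f : 'rV[R]_n -> R) x :
  open U -> U x -> (forall i y, U y -> derivable f y (dir i)) ->
  (forall i, {for x, continuous ('D_(dir i) f)}) -> differentiable f x.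
Proof.
move=> oU Ux df cf.
pose L (v : 'rV[R]_n) : R^o := \sum_i v 0 i * 'D_(dir i) f x.
have Llin : linear L.
  move=> a u v; rewrite /L scaler_sumr -big_split; apply: eq_bigr => i _ /=.
  by rewrite !mxE mulrDl -mulrA.
pose L' : {linear 'rV[R]_n -> R^o} :=
  HB.pack L (GRing.isLinear.Build _ _ _ _ L Llin).
have Lc : continuous L'.
  have C0 i : Ck_fun 0 setT (fun v : 'rV[R]_n => v 0 i * 'D_(dir i) f x).
    by apply: Ck_funM; [exact: openT|exact: Ck_fun_proj|exact: Ck_fun_cst].
  have CT := Ck_on_sum openT C0.
  by move=> v; exact: (CT v I).
have [] // := @differentiable_approxP _ _ _ f x L' Lc.
(* There are [n] pieces, each with error [e' * |h|]; dividing by [n + 1] also covers [n = 0]. *)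
move=> e e0; pose e' := e / n.+1%:R.
have e'0 : 0 < e' by rewrite divr_gt0.
have ce (i : 'I_n) : \forall y \near x, `|'D_(dir i) f x - 'D_(dir i) f y| <= e'.
  by have /cvgrPdist_le := cf i; apply.
have : \forall y \near x, U y /\
    forall i : 'I_n, `|'D_(dir i) f x - 'D_(dir i) f y| <= e'.
  by apply: filterI; [exact: open_nbhs_nbhs|exact: filter_forall ce].
move=> /nbhs_ballP[d /= d0 dP].
apply/nbhs_ballP; exists d => //= h; rewrite -ball_normE /= sub0r normrN => hd.
(* The corners of the path from 0 to [h]: after [k] moves the first [k] coordinates have reached
   their final value. *)
pose p k : 'rV[R]_n := \row_i (if (i < k)%N then h 0 i else 0).
have pS (k : 'I_n) : p k.+1 = p k + h 0 k *: dir k.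
  apply/rowP => i; rewrite !mxE/= ltnS leq_eqVlt.
  have [->|ik] := eqVneq i k; first by rewrite eqxx ltnn/= mulr1 add0r.
  by rewrite (inj_eq val_inj) (negPf ik)/= mulr0 addr0.
have pn : p n = h by apply/rowP => i; rewrite mxE ltn_ord.
have p0 : p 0%N = 0 by apply/rowP => i; rewrite !mxE.
(* In the sup norm no point of the path is farther from its start than [h] is from 0. *)
have pU (k : 'I_n) (t : R) : `|t| <= `|h 0 k| -> ball x d (x + p k + t *: dir k).
  move=> th; rewrite -ball_normE /= -addrA opprD addNKr normrN.
  apply: le_lt_trans hd; apply: rV_norm_le => // i; rewrite !mxE/=.
  have [->|ik] := eqVneq i k.
    by rewrite ltnn add0r mulr1 (le_trans th)// ler_coord_norm.
  by rewrite mulr0 addr0; case: ifP => _; rewrite ?normr0// ler_coord_norm.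
have -> : f (h + x) - f x - L' h =
    \sum_(k < n) (f (x + p k.+1) - f (x + p k) - h 0 k * 'D_(dir k) f x).
  rewrite big_split /= sumrN; congr (_ - _).
  have := @telescope_sumr _ 0%N n (fun k => f (x + p k)) (leq0n _).
  by rewrite big_mkord pn p0 addr0 (addrC h) => <-.
apply: le_trans (ler_norm_sum _ _ _) _.
apply: (@le_trans _ _ (\sum_(k < n) e' * `|h|)); last first.
  rewrite sumr_const card_ord -mulrnAl ler_wpM2r//.
  rewrite /e' -mulrnAr -[X in _ * X]mulr_natr ler_piMr ?(ltW e0)//.
  by rewrite mulrC ler_pdivrMr// mul1r ler_nat.
apply: ler_sum => k _; rewrite pS addrA.
have [t th|t th ->] := @mean_value _ _ f (x + p k) (dir k) (h 0 k).
  by apply: df; have [] := dP _ (pU _ _ th).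
rewrite -mulrBr normrM mulrC ler_pM//; last exact: ler_coord_norm.
by rewrite distrC; have [_ ] := dP _ (pU _ _ th); apply.
Qed.

(** [Ck_on] speaks of derivatives along all vectors. This reduces the regularity of solutions and of
    inverse maps to the coordinate directions, where explicit formulas are available. *)
Lemma Ck_fun_partials n k (U : set 'rV[R]_n) (f : 'rV[R]_n -> R) : open U ->
  (forall i x, U x -> derivable f x (dir i)) ->
  (forall i, Ck_fun k U ('D_(dir i) f)) -> Ck_fun k.+1 U f.
Proof.
move=> oU df Df.
have dif x : U x -> differentiable f x.
  move=> Ux; apply: (differentiable_partials oU) => // i.
  exact: (Ck_on0 (Df i)).
split=> // v.
have := Ck_fun_sum oU (fun i => Ck_funM oU (Ck_fun_cst k U (v 0 i)) (Df i)).
by apply: Ck_on_eq => // x Ux; rewrite derive_sum_dir//; exact: dif.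
Qed.

Lemma derive_translate V W (f : V -> W) (c x v : V) :
  (derivable f (x + c) v -> derivable (fun y => f (y + c)) x v) /\
  'D_v (fun y => f (y + c)) x = 'D_v f (x + c).
Proof.
have E : (fun h : R => h^-1 *: (((fun y => f (y + c)) \o shift x) (h *: v) -
     f (x + c))) =
   (fun h => h^-1 *: ((f \o shift (x + c)) (h *: v) - f (x + c))).
  by apply/funext => h /=; rewrite addrA.
by split; rewrite /derivable /derive E.
Qed.

(** The mean value theorem is used twice: along [u] for the increment of [f] by [h *: v], then along
    [v] for ['D_u f]. *)
Lemma second_difference V (U : set V) (f : V -> R) (u v : V) x h :
  Ck_fun 2 U f ->
  (forall s t : R, `|s| <= `|h| -> `|t| <= `|h| -> U (x + s *: u + t *: v)) ->
  exists s t : R, [/\ `|s| <= `|h|, `|t| <= `|h| &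
    f (x + h *: u + h *: v) - f (x + h *: u) - (f (x + h *: v) - f x) =
      h * (h * 'D_v ('D_u f) (x + s *: u + t *: v))].
Proof.
move=> [df Df] hU; pose phi y : R := f (y + h *: v) - f y.
have h0 : `|0 : R| <= `|h| by rewrite normr0.
have dfu y : U y -> derivable f y u by move=> /df; exact: diff_derivable.
have Uu s : `|s| <= `|h| -> U (x + s *: u).
  by move=> sh; have := hU s 0 sh h0; rewrite scale0r addr0.
have dphi (s : R) : `|s| <= `|h| -> is_derive (x + s *: u) u phi
    ('D_u f (x + s *: u + h *: v) - 'D_u f (x + s *: u)).
  move=> sh; have [d1 E1] := derive_translate f (h *: v) (x + s *: u) u.
  have D1 := DeriveDef (d1 (dfu _ (hU _ _ sh (lexx _)))) E1.
  have D2 := derivableP (dfu _ (Uu _ sh)).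
  exact: (@is_deriveB _ _ _ _ _ _ _ _ _ D1 D2).
have [s sh /= Es] := @mean_value _ _ phi x u h
  (fun t th => @ex_derive _ _ _ _ _ _ _ (dphi t th)).
have [t th|t th Et] := @mean_value _ _ ('D_u f) (x + s *: u) v h.
  by apply: diff_derivable; have [+ _] := Df u; apply; exact: hU.
by exists s, t; split=> //; rewrite -Et -[LHS]/(phi _ - phi _) Es (@derive_val _ _ _ _ _ _ _ (dphi s sh)).
Qed.

(** The second difference does not depend on the order of its two increments. Hence one mixed
    derivative equals the other at a second nearby point, and continuity lets both points tend to
    [x]. *)
Lemma derive_swap V (U : set V) (f : V -> R) (u v : V) x : open U -> U x ->
  Ck_fun 2 U f -> 'D_u ('D_v f) x = 'D_v ('D_u f) x.
Proof.
move=> oU Ux fC.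
have c1 : {for x, continuous ('D_u ('D_v f))}.
  by apply: (Ck_on0 (k := 0)) Ux; have [_ /(_ v) [_ /(_ u)]] := fC.
have c2 : {for x, continuous ('D_v ('D_u f))}.
  by apply: (Ck_on0 (k := 0)) Ux; have [_ /(_ u) [_ /(_ v)]] := fC.
apply/eqP; rewrite -subr_eq0 -normr_le0; apply/ler_addgt0Pl => e e0.
rewrite addr0.
have e2 : 0 < e / 2 by rewrite divr_gt0.
have n1 : \forall y \near x, `|'D_u ('D_v f) x - 'D_u ('D_v f) y| <= e / 2.
  by have /cvgrPdist_le := c1; apply.
have n2 : \forall y \near x, `|'D_v ('D_u f) x - 'D_v ('D_u f) y| <= e / 2.
  by have /cvgrPdist_le := c2; apply.
have n3 : \forall y \near x, U y by exact: open_nbhs_nbhs.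
have [d d0 dP] := (near_normP _ _).1 (filterI n3 (filterI n1 n2)).
(* With [h = d / M / 2] the whole parallelogram spanned by [h *: u] and [h *: v] stays within
   distance [d] of [x]. *)
pose M := `|u| + `|v| + 1.
have M0 : 0 < M by rewrite ltr_wpDl// addr_ge0.
pose h := d / M / 2.
have h0 : 0 < h by rewrite !divr_gt0.
have hb (s t : R) : `|s| <= `|h| -> `|t| <= `|h| ->
    `|x + s *: u + t *: v - x| < d.
  move=> sh th; rewrite -(addrA x) [x + _]addrC addrK.
  apply: le_lt_trans (ler_normD _ _) _; rewrite !normrZ.
  apply: (@le_lt_trans _ _ (`|h| * `|u| + `|h| * `|v|)).
    by rewrite lerD// ler_wpM2r.
  rewrite -mulrDr gtr0_norm//; apply: (@le_lt_trans _ _ (h * M)).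
    by rewrite ler_wpM2l ?(ltW h0)// lerDl.
  by rewrite /h mulrAC divfK ?gt_eqF//; rewrite ltr_pdivrMr// ltr_pMr// ltr1n.
have [|s [t [sh th E1]]] := @second_difference _ U f u v x h fC.
  by move=> s t sh th; have [] := dP _ (hb s t sh th).
have [|s' [t' [sh' th' E2]]] := @second_difference _ U f v u x h fC.
  by move=> s' t' sh' th'; have [] := dP _ (hb _ _ th' sh'); rewrite addrAC.
have [_ [_ l1]] := dP _ (hb _ _ sh th).
have := hb _ _ th' sh'; rewrite [x + t' *: u + s' *: v]addrAC => /dP[_ [l2 _]].
rewrite [x + h *: v + h *: u]addrAC in E2.
move: E1 E2 l1 l2.
move: ('D_v ('D_u f) (x + s *: u + t *: v)) => B1.
move: ('D_u ('D_v f) (x + s' *: v + t' *: u)) => A1.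
move: (f (x + h *: u + h *: v)) (f (x + h *: u)) (f (x + h *: v)) (f x) => F1 F2 F3 F4.
move: ('D_u ('D_v f) x) ('D_v ('D_u f) x) => a b E1 E2.
have -> : B1 = A1.
  by apply: (mulfI (lt0r_neq0 h0)); apply: (mulfI (lt0r_neq0 h0)); lra.
rewrite !ler_norml => /andP[? ?] /andP[? ?]; apply/andP; split; lra.
Qed.

End Partials.

(** * Scalar ordinary differential equations *)

Section ScalarODE.
Context {R : realType}.
Implicit Types (f g w : R -> R) (c t s d K e : R).

(* Estimating [w^2 + (e + e')^2] instead of [`|w|] avoids a case analysis on the sign of [w]. *)
Lemma gronwall w (dw : R -> R) K e e' : 0 <= K -> 0 <= e -> 0 <= e' ->
  (forall s, 0 <= s <= 1 -> is_derive s 1 w (dw s)) ->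
  (forall s, 0 <= s <= 1 -> `|dw s| <= K * `|w s| + e) ->
  `|w 0| <= e' -> `|w 1| <= 2 * (e + e') * expR (2 * K + 1).
Proof.
(* The rate [M] comes from [2 w w' <= 2 K w^2 + 2 E |w| <= (2 K + 1) (w^2 + E^2)], which makes [y]
   below satisfy [y 1 <= y 0]. *)
move=> K0 e0 e'0 wd wb w0; pose M := 2 * K + 1; pose E := e + e'.
have M1 : 1 <= M by rewrite /M lerDr mulr_ge0.
pose y s := (w s * w s + E * E) * expR (0 + s * - M).
have dy (s : R) : 0 <= s <= 1 -> is_derive s 1 y
    ((w s * w s + E * E) * (expR (0 + s * - M) * - M) +
      expR (0 + s * - M) * (w s * dw s + w s * dw s + 0)).
  move=> s01; have H := wd _ s01.
  have HE : is_derive s (1 : R) (fun s : R => E * E) 0 by exact: is_derive_cst.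
  exact: (is_deriveM_fun (is_deriveD_fun (is_deriveM_fun H H) HE)
    (is_derive_expR_comp (is_derive_affine 0 (- M) s))).
have y1 : y 1 <= y 0.
  have dy' (s : R) : s \in `]0, 1[ -> is_derive s 1 y
    ((w s * w s + E * E) * (expR (0 + s * - M) * - M) +
      expR (0 + s * - M) * (w s * dw s + w s * dw s + 0)).
    by rewrite in_itv /= => /andP[? ?]; apply: dy; rewrite !ltW.
  have yc : {within `[0, 1], continuous y}.
    apply: derivable_within_continuous => t; rewrite in_itv /= => t01.
    exact: (@ex_derive _ _ _ _ _ _ _ (dy t t01)).
  have [s s01 ] := MVT_segment ler01 dy' yc.
  rewrite subr0 mulr1 => E1; rewrite -subr_le0 E1.
  move: s01; rewrite in_itv /= => /wb.
  have := expR_ge0 (0 + s * - M); move: (expR _) => X X0 bd.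
  rewrite [X in X <= _](_ : _ = X * (2 * (w s * dw s) - M * (w s * w s + E * E)));
    last by ring.
  rewrite mulr_ge0_le0// subr_le0.
  have wdw : w s * dw s <= `|w s| * (K * `|w s| + E).
    apply: le_trans (ler_norm _) _; rewrite normrM ler_wpM2l//.
    by apply: le_trans bd _; rewrite lerD2l lerDl.
  have ww : w s * w s = `|w s| * `|w s| by rewrite -!expr2 real_normK ?num_real.
  rewrite ww; move: wdw; rewrite /M; move: (`|w s|) (w s * dw s) => N P NP.
  have : 0 <= (N - E) * (N - E) by rewrite -expr2 sqr_ge0.
  have : 0 <= K * (E * E) by rewrite mulr_ge0// -expr2 sqr_ge0.
  nra.
move: y1; rewrite /y mul1r mul0r !addr0 add0r expR0 mulr1 expRN.
rewrite ler_pdivrMr ?expR_gt0// => y1.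
have X1 : 1 <= expR M by rewrite -expR0 ler_expR; lra.
move: w0 y1; have -> : w 1 * w 1 = `|w 1| ^+ 2 by rewrite real_normK ?num_real// expr2.
have -> : w 0 * w 0 = `|w 0| ^+ 2 by rewrite real_normK ?num_real// expr2.
have := normr_ge0 (w 0); move: (`|w 0|) (expR M) X1 => n X X1 n0 ne y1.
have E0 : 0 <= E by rewrite addr_ge0.
(* Squares are compared: [w(1)^2 <= 2 E^2 X], and this is at most [(2 E X)^2] because [X >= 1]. *)
rewrite -(@ler_pXn2r _ 2) ?nnegrE// ?mulr_ge0//; last lra.
have nE : n ^+ 2 <= E ^+ 2 by rewrite ler_pXn2r ?nnegrE// /E; lra.
apply: (@le_trans _ _ ((E ^+ 2 + E ^+ 2) * X)).
  apply: le_trans (_ : (n ^+ 2 + E * E) * X <= _).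
    by apply: le_trans y1; rewrite lerDl -expr2 sqr_ge0.
  by rewrite ler_wpM2r//; [lra|rewrite -expr2 lerD2r].
rewrite [leRHS](_ : _ = 4 * E ^+ 2 * X * X); last by rewrite /E; ring.
have : 0 <= E ^+ 2 * X * (X - 1) by rewrite !mulr_ge0 ?sqr_ge0//; lra.
have : 0 <= E ^+ 2 * X * X by rewrite !mulr_ge0 ?sqr_ge0//; lra.
move: (E ^+ 2) => F; lra.
Qed.

(** The intervals with centre [u n] and radius [2 A / 2^n] are nested, so the supremum of their
    lower ends lies in all of them. The explicit rate is what the Picard iteration uses. *)
Lemma geometric_limit (u : nat -> R) A : 
  (forall n, `|u n.+1 - u n| <= A / 2 ^+ n) ->
  exists l, forall n, `|l - u n| <= 2 * A / 2 ^+ n.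
Proof.
move=> uA.
have half n : A / 2 ^+ n = A / 2 ^+ n.+1 + A / 2 ^+ n.+1.
  have P : 2 ^+ n != 0 :> R by rewrite expf_neq0.
  by rewrite exprS; field.
pose lo n := u n - 2 * A / 2 ^+ n; pose hi n := u n + 2 * A / 2 ^+ n.
have hS n : 2 * A / 2 ^+ n = 2 * A / 2 ^+ n.+1 + A / 2 ^+ n.
  by rewrite [in RHS](half n) -[2 * A / 2 ^+ n]mulrA (half n); ring.
have lS n : lo n <= lo n.+1.
  by move: (uA n); rewrite /lo (hS n) ler_norml => /andP[? ?]; lra.
have hiS n : hi n.+1 <= hi n.
  by move: (uA n); rewrite /hi (hS n) ler_norml => /andP[? ?]; lra.
have lm m n : (m <= n)%N -> lo m <= lo n.
  by move=> mn; rewrite -(subnK mn); elim: (n - m)%N => // k IH; exact: le_trans (lS _).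
have hm m n : (m <= n)%N -> hi n <= hi m.
  by move=> mn; rewrite -(subnK mn); elim: (n - m)%N => // k IH; exact: le_trans (hiS _) _.
have A0 : 0 <= A by have := le_trans (normr_ge0 _) (uA 0%N); rewrite expr0 divr1.
have lh m n : lo m <= hi n.
  apply: le_trans (lm m _ (leq_maxl m n)) _; apply: le_trans (hm n _ (leq_maxr m n)).
  have : 0 <= 2 * A / 2 ^+ (maxn m n) by rewrite divr_ge0 ?mulr_ge0 ?exprn_ge0.
  by rewrite /lo /hi; lra.
exists (sup (range lo)) => n.
have l1 : lo n <= sup (range lo).
  apply: ub_le_sup; last by exists n.
  by exists (hi 0%N) => _ [m _ <-]; exact: lh.
have l2 : sup (range lo) <= hi n.
  by apply: ge_sup; [exists (lo 0%N); exists 0%N|move=> _ [m _ <-]; exact: lh].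
by move: l1 l2; rewrite /lo /hi ler_norml => ? ?; apply/andP; split; lra.
Qed.

End ScalarODE.

(** * Primitives, linear equations and Picard iteration on an open interval *)

Section Interval.
Context {R : realType}.
Implicit Types (f g w : R -> R) (c t s d K M e : R).

(** The segment from [c] to [t] is rescaled to the unit interval, in either direction; the factor
    [t - c] of the derivative accounts for each [d] in the bound. *)
Lemma gronwall_itv w (dw : R -> R) c d K e e' : 0 <= K -> 0 <= e -> 0 <= e' ->
  (forall t, `|t - c| < d -> is_derive t 1 w (dw t)) ->
  (forall t, `|t - c| < d -> `|dw t| <= K * `|w t| + e) ->
  `|w c| <= e' ->
  forall t, `|t - c| < d -> `|w t| <= 2 * (d * e + e') * expR (2 * (d * K) + 1).
Proof.
move=> K0 e0 e'0 dwd dwb wc t tc.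
have d0 : 0 < d by exact: le_lt_trans tc.
have inI s : 0 <= s <= 1 -> `|c + s * (t - c) - c| < d.
  move=> /andP[s0 s1]; rewrite addrAC subrr add0r normrM ger0_norm//.
  by apply: le_lt_trans tc; rewrite ler_piMl.
have := @gronwall R (fun s => w (c + s * (t - c)))
  (fun s => dw (c + s * (t - c)) * (t - c)) (d * K) (d * e) e'.
rewrite mul0r addr0 mul1r [c + (t - c)]addrC subrK; apply => //.
- by rewrite mulr_ge0// ltW.
- by rewrite mulr_ge0// ltW.
- by move=> s /inI ?; apply: is_derive_segment; exact: dwd.
- move=> s /inI /dwb H; rewrite normrM -mulrA -mulrDr mulrC ler_pM//.
  exact: ltW.
Qed.

(** Gronwall for the difference, with all three constants equal to 0. *)
Lemma is_derive_eq_itv f1 f2 g c d :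
  (forall t, `|t - c| < d -> is_derive t 1 f1 (g t)) ->
  (forall t, `|t - c| < d -> is_derive t 1 f2 (g t)) -> f1 c = f2 c ->
  forall t, `|t - c| < d -> f1 t = f2 t.
Proof.
move=> d1 d2 E t tc; apply/eqP; rewrite -subr_eq0 -normr_le0.
have := @gronwall_itv (fun s => f1 s - f2 s) (fun s => g s - g s) c d 0 0 0.
rewrite !mulr0 !addr0 mulr0 mul0r; apply => //.
- by move=> s sc; apply: is_deriveB_fun; [exact: d1|exact: d2].
- by move=> s sc; rewrite subrr normr0 mul0r.
- by rewrite E subrr normr0.
Qed.

Lemma primitive_segment g (a b : R) :
  (forall t, a <= t <= b -> {for t, continuous g}) ->
  exists f, forall t, a < t < b -> is_derive t 1 f (g t).
Proof.
move=> gc; exists (fun x => \int[lebesgue_measure]_(t in `[a, x]) g t)%R.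
move=> t /andP[ta tb].
have gi : lebesgue_measure.-integrable `[a, b] (EFin \o g).
  apply: continuous_compact_integrable; first exact: segment_compact.
  apply: continuous_in_subspaceT => x; rewrite inE /= in_itv /=; exact: gc.
have gt : {for t, continuous g} by apply: gc; rewrite !ltW.
have [D1 D2] := continuous_FTC1_closed tb gi ta gt.
by split; [exact: D1|rewrite -derive1E D2].
Qed.

(** [g] may fail to be integrable up to the ends of the open interval. Primitives on smaller
    intervals, all vanishing at [c], agree where they overlap and are glued. *)
Lemma primitive_itv g c d : (forall t, `|t - c| < d -> {for t, continuous g}) ->
  exists2 f, f c = 0 & forall t, `|t - c| < d -> is_derive t 1 f (g t).
Proof.
move=> gc.
have /choice[F FP] : forall r : R, exists f, r < d -> f c = 0 /\
    forall t, `|t - c| < r -> is_derive t 1 f (g t).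
  move=> r; case: (ltP r d) => [rd|]; last by exists (fun=> 0).
  have [|f fP] := @primitive_segment g (c - r) (c + r).
    by move=> t tr; apply: gc; apply: le_lt_trans rd; rewrite ler_distl.
  exists (fun t => f t - f c) => _; rewrite subrr; split=> // t.
  rewrite ltr_distl => /fP H.
  have H0 : is_derive t (1 : R) (fun _ : R => f c) 0 by exact: is_derive_cst.
  by have := is_deriveB_fun H H0; rewrite subr0.
(* A radius strictly between that of [t] and [d], so that a neighbourhood of [t] lies inside the
   smaller interval. *)
pose r t := (`|t - c| + d) / 2.
have tr t : `|t - c| < d -> `|t - c| < r t /\ r t < d.
  by move=> td; rewrite /r; split; lra.
have Feq r1 r2 t : r1 < d -> r2 < d -> `|t - c| < r1 -> `|t - c| < r2 ->
    F r1 t = F r2 t.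
  move=> r1d r2d t1 t2; have [F1c F1] := FP _ r1d; have [F2c F2] := FP _ r2d.
  apply: (@is_derive_eq_itv (F r1) (F r2) g c (Num.min r1 r2)).
  - by move=> s; rewrite lt_min => /andP[? ?]; exact: F1.
  - by move=> s; rewrite lt_min => /andP[? ?]; exact: F2.
  - by rewrite F1c F2c.
  - by rewrite lt_min t1 t2.
case: (ltP 0 d) => d0; last first.
  exists (fun=> 0) => // t td; exfalso.
  by have := le_lt_trans (normr_ge0 _) td; rewrite ltNge d0.
exists (fun t => F (r t) t) => [|t td].
  by have [|_ /FP[]] := tr c => //; rewrite subrr normr0.
have [t1 t2] := tr t td; have [_ /(_ _ t1) H] := FP _ t2.
apply: near_eq_is_derive H; apply/near_normP.
exists (r t - `|t - c|); first by rewrite subr_gt0.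
move=> y; rewrite ltrBrDr => yt.
have yr : `|y - c| < r t.
  by apply: le_lt_trans yt; rewrite -(subrKA t) ler_normD.
by have [] := tr y (lt_trans yr t2) => y1 y2; apply: Feq.
Qed.

(** Variation of constants. No smallness of the interval is required, so linear equations are solved
    on the full interval. *)
Lemma linear_ode (a b : R -> R) c d (w0 : R) :
  (forall t, `|t - c| < d -> {for t, continuous a}) ->
  (forall t, `|t - c| < d -> {for t, continuous b}) ->
  exists2 w, w c = w0 & forall t, `|t - c| < d -> is_derive t 1 w (a t * w t + b t).
Proof.
move=> ac bc; have [A Ac Ad] := primitive_itv ac.
have [|B Bc Bd] := @primitive_itv (fun t => b t * expR (- A t)) c d.
  move=> t td; apply: cvgM; first exact: bc.
  apply: continuous_comp; last exact: continuous_expR.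
  by apply: cvgN; exact: (is_derive_continuous (Ad t td)).
exists (fun t => expR (A t) * (w0 + B t)).
  by rewrite Ac Bc expR0 addr0 mul1r.
move=> t td; have H0 : is_derive t (1 : R) (fun _ : R => w0) 0 by exact: is_derive_cst.
have := is_deriveM_fun (is_derive_expR_comp (Ad t td)) (is_deriveD_fun H0 (Bd t td)).
set X := (X in is_derive _ _ _ X -> _); suff -> : X = a t * (expR (A t) * (w0 + B t)) + b t by [].
rewrite /X add0r mulrCA expRN divff ?mulr1; last by rewrite gt_eqF// expR_gt0.
by ring.
Qed.

(* Picard iteration; the limit is compared with the primitive it defines. *)
Lemma scalar_ode (phi : R -> R -> R) c d K M (w0 : R) : 0 <= K -> 0 < d ->
  d * K <= 1 / 4 ->
  (forall t x, `|t - c| < d -> `|phi t x| <= M) ->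
  (forall t x y, `|t - c| < d -> `|phi t x - phi t y| <= K * `|x - y|) ->
  (forall v : R -> R, (forall t, `|t - c| < d -> {for t, continuous v}) ->
     forall t, `|t - c| < d -> {for t, continuous (fun s => phi s (v s))}) ->
  exists2 w, w c = w0 & forall t, `|t - c| < d -> is_derive t 1 w (phi t (w t)).
Proof.
move=> K0 d0 dK phiM phiK phic.
have bound f1 f2 (g1 g2 : R -> R) e : 0 <= e -> f1 c = f2 c ->
    (forall t, `|t - c| < d -> is_derive t 1 f1 (g1 t)) ->
    (forall t, `|t - c| < d -> is_derive t 1 f2 (g2 t)) ->
    (forall t, `|t - c| < d -> `|g1 t - g2 t| <= e) ->
    forall t, `|t - c| < d -> `|f1 t - f2 t| <= d * e.
  move=> e0 fc H1 H2 He t tc.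
  have D s : `|s - c| < d -> is_derive s 1 (fun s => f1 s - f2 s) (g1 s - g2 s).
    by move=> sc; apply: is_deriveB_fun; [exact: H1|exact: H2].
  have inI s : `|s| <= `|t - c| -> `|c + s *: (1 : R) - c| < d.
    by move=> st; rewrite addrAC subrr add0r [_ *: _]mulr1; exact: le_lt_trans tc.
  have [|s st] := @mean_value R _ (fun s => f1 s - f2 s) c 1 (t - c).
    by move=> s /inI sd; exact: (@ex_derive _ _ _ _ _ _ _ (D _ sd)).
  rewrite [_ *: _]mulr1 [c + (t - c)]addrC subrK fc subrr subr0 => ->.
  rewrite (@derive_val _ _ _ _ _ _ _ (D _ (inI _ st))) normrM ler_pM//.
    exact: ltW.
  exact/He/inI.
(* The Picard operator, made total: on functions that are not continuous on the interval its value
   is arbitrary. *)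
have /choice[T TP] : forall v : R -> R, exists f,
    (forall t, `|t - c| < d -> {for t, continuous v}) ->
    f c = w0 /\ forall t, `|t - c| < d -> is_derive t 1 f (phi t (v t)).
  move=> v; have [vc|nvc] := pselect (forall t, `|t - c| < d -> {for t, continuous v});
    last by exists v.
  have [f fc fd] := primitive_itv (phic v vc).
  exists (fun t => w0 + f t) => _; rewrite fc addr0; split=> // t td.
  have H0 : is_derive t (1 : R) (fun _ : R => w0) 0 by exact: is_derive_cst.
  by have := is_deriveD_fun H0 (fd t td); rewrite add0r.
have Tc v : (forall t, `|t - c| < d -> {for t, continuous v}) ->
    forall t, `|t - c| < d -> {for t, continuous (T v)}.
  by move=> vc t td; have [_ /(_ _ td) H] := TP v vc; exact: is_derive_continuous H.
pose w n := iter n T (fun=> w0).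
have wc n : forall t, `|t - c| < d -> {for t, continuous (w n)}.
  by elim: n => [|n IH]; [move=> t _; exact: cvg_cst|exact: Tc].
have M0 : 0 <= M.
  by apply: le_trans (normr_ge0 _) (phiM c 0 _); rewrite subrr normr0.
(* An iteration contracts by [d * K <= 1 / 4]; only the ratio [1 / 2] is kept, as [geometric_limit]
   expects. *)
have wcauchy n t : `|t - c| < d -> `|w n.+1 t - w n t| <= (d * M) / 2 ^+ n.
  elim: n t => [|n IH] t td.
    rewrite expr0 divr1 /w /=; have [T0 Td] := TP _ (wc 0%N).
    apply: (bound _ (fun=> w0) _ (fun=> 0) _ M0 T0 Td) => // s sd.
    by rewrite subr0 phiM.
  have [Tn Tnd] := TP _ (wc n); have [Tn1 Tn1d] := TP _ (wc n.+1).
  have e0 : 0 <= K * (d * M / 2 ^+ n).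
    by rewrite !mulr_ge0 ?invr_ge0 ?exprn_ge0// ltW.
  have Ec : w n.+2 c = w n.+1 c by rewrite /= Tn Tn1.
  apply: le_trans (bound (w n.+2) (w n.+1) _ _ _ e0 Ec Tn1d Tnd _ _ td) _.
    by move=> s sd; apply: le_trans (phiK _ _ _ sd) _; rewrite ler_wpM2l// IH.
  have -> : d * M / 2 ^+ n.+1 = 2^-1 * (d * M / 2 ^+ n).
    by rewrite exprS invfM mulrCA.
  rewrite mulrA ler_wpM2r//; last lra.
  by rewrite !mulr_ge0 ?invr_ge0 ?exprn_ge0// ltW.
have /choice[W WP] : forall t, exists l, `|t - c| < d ->
    forall n, `|l - w n t| <= 2 * (d * M) / 2 ^+ n.
  move=> t; have [td|] := pselect (`|t - c| < d); last by exists 0.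
  by have [l] := geometric_limit (fun n => wcauchy n t td); exists l.
have small e : 0 < e -> exists n, 2 * (d * M) / 2 ^+ n <= e.
  move=> e0; pose n := Num.bound (2 * (d * M) / e); exists n.
  have b0 : 0 <= 2 * (d * M) / e by rewrite !mulr_ge0 ?invr_ge0// ltW.
  rewrite ler_pdivrMr ?exprn_gt0// -ler_pdivrMl// mulrC.
  apply: le_trans (ltW (archi_boundP b0)) _.
  by rewrite -/n -natrX ler_nat ltnW// ltn_expl.
have Wc t : `|t - c| < d -> {for t, continuous W}.
  move=> td; apply/cvgrPdist_le => e e0.
  have [n nP] := small (e / 3) (divr_gt0 e0 (ltr0Sn _ _)).
  have /cvgrPdist_le/(_ (e / 3)) := wc n t td.
  rewrite divr_gt0// => /(_ isT) H1.
  have H2 : \forall s \near t, `|s - c| < d.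
    apply/near_normP; exists (d - `|t - c|); first by rewrite subr_gt0.
    move=> s; rewrite ltrBrDr; apply: le_lt_trans.
    by rewrite -(subrKA t) ler_normD.
  apply: filterS2 H1 H2 => s H1 sd.
  have := le_trans (WP s sd n) nP; have := le_trans (WP t td n) nP.
  by move: H1; rewrite !ler_norml => /andP[? ?] /andP[? ?] /andP[? ?]; apply/andP; split; lra.
have [Vc Vd] := TP W Wc; set V := T W in Vc Vd.
have VW t : `|t - c| < d -> V t = W t.
  move=> td; apply/eqP; rewrite -subr_eq0 -normr_le0; apply/ler_addgt0Pl => e e0.
  rewrite addr0; have [n nP] := small (e / 2) (divr_gt0 e0 (ltr0Sn _ _)).
  have [Tn Tnd] := TP _ (wc n).
  have a0 : 0 <= 2 * (d * M) / 2 ^+ n by rewrite !mulr_ge0 ?invr_ge0 ?exprn_ge0// ltW.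
  have e1 : 0 <= K * (2 * (d * M) / 2 ^+ n) by rewrite mulr_ge0.
  have Ec : V c = w n.+1 c by rewrite Vc /= Tn.
  have := bound V (w n.+1) _ _ _ e1 Ec Vd Tnd _ _ td.
  have H s : `|s - c| < d -> `|phi s (W s) - phi s (w n s)| <= K * (2 * (d * M) / 2 ^+ n).
    by move=> sd; apply: le_trans (phiK _ _ _ sd) _; rewrite ler_wpM2l// WP.
  move=> /(_ H); rewrite mulrA => H1.
  have H3 : d * K * (2 * (d * M) / 2 ^+ n) <= 1 / 4 * (e / 2).
    by rewrite ler_pM// mulr_ge0// ltW.
  have := WP t td n.+1; rewrite (_ : _ / _ = 2 * (d * M) / 2 ^+ n / 2) => [H2|]; last first.
    by rewrite exprSr invfM !mulrA.
  move: H1 H2 H3 nP; move: (2 * (d * M) / 2 ^+ n) (d * K) (V t) (w n.+1 t) (W t) => a b v x y.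
  rewrite !ler_norml => /andP[? ?] /andP[? ?] ? ?; apply/andP; split; lra.
exists V => // t td; have := Vd t td; rewrite -VW//.
Qed.

End Interval.

(** * Changing a single coordinate of a point *)

Definition upd (R : realType) n (x : 'rV[R]_n) (j : 'I_n) (t : R) : 'rV[R]_n :=
  x + (t - x 0 j) *: dir j.

(** In the sup norm this is an open cube, so one coordinate can be moved within its own interval
    independently of the others. *)
Definition box (R : realType) n (p : 'rV[R]_n) (d : R) : set 'rV[R]_n :=
  [set x | `|x - p| < d].

Lemma continuous_at_epsP (R : realType) (V : normedModType R) (f : V -> R) (x : V) :
  {for x, continuous f} <->
  forall e : R, 0 < e -> \forall y \near x, `|f x - f y| <= e.
Proof.
split=> [/cvgrPdist_le//|H]; by apply/cvgrPdist_le => e /H.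
Qed.

Lemma continuous_comp2 (T T1 T2 T3 : topologicalType) (f : T1 -> T2 -> T3)
    (a : T -> T1) (b : T -> T2) (z : T) :
  {for z, continuous a} -> {for z, continuous b} ->
  {for (a z, b z), continuous (fun q => f q.1 q.2)} ->
  {for z, continuous (fun z => f (a z) (b z))}.
Proof.
move=> ac bc fc; apply: (@continuous_comp _ _ _ (fun z => (a z, b z)) (fun q => f q.1 q.2)) => //.
exact: cvg_pair.
Qed.

(** * Dependence on parameters *)

Section Update.
Context {R : realType} {n : nat}.
Implicit Types (x y p : 'rV[R]_n) (i j m : 'I_n) (s t d : R).

Lemma updE x j t i : upd x j t 0 i = if i == j then t else x 0 i.
Proof.
rewrite /upd !mxE eqxx /=; case: eqVneq => [->|ij]; last by rewrite mulr0 addr0.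
by rewrite mulr1 addrC subrK.
Qed.

Lemma upd_self x j : upd x j (x 0 j) = x.
Proof. by rewrite /upd subrr scale0r addr0. Qed.

Lemma upd_upd x j s t : upd (upd x j s) j t = upd x j t.
Proof. by apply/rowP => i; rewrite !updE; case: eqP. Qed.

Lemma updD x j m t s : m != j -> upd (x + s *: dir m) j t = upd x j t + s *: dir m.
Proof.
by move=> mj; rewrite /upd !mxE eqxx /= eq_sym (negPf mj) mulr0 addr0 addrAC.
Qed.

Lemma upd_dir x j t s : upd x j t + s *: dir j = upd x j (t + s).
Proof. by rewrite /upd -addrA -scalerDl addrAC. Qed.

Lemma updD_eq x j t s : upd (x + s *: dir j) j t = upd x j t.
Proof. by apply/rowP => i; rewrite !updE !mxE eqxx /=; case: eqP; rewrite //= mulr0 addr0. Qed.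

Lemma near_box p d x : box p d x -> \forall y \near x, box p d y.
Proof.
move=> xd; apply/near_normP; exists (d - `|x - p|); first by rewrite subr_gt0.
move=> y; rewrite ltrBrDr; apply: le_lt_trans.
by rewrite -(subrKA x) ler_normD.
Qed.

Lemma near_coord x j (a r : R) : `|x 0 j - a| < r ->
  \forall y \near x, `|(y : 'rV[R]_n) 0 j - a| < r.
Proof.
move=> xr; apply/near_normP; exists (r - `|x 0 j - a|); first by rewrite subr_gt0.
move=> y; rewrite ltrBrDr; apply: le_lt_trans.
rewrite -(subrKA (x 0 j)) (le_trans (ler_normD _ _))// lerD2r.
by have := ler_coord_norm (y - x) j; rewrite !mxE.
Qed.

Lemma open_box p d : open (box p d).
Proof. by rewrite openE => x; exact: near_box. Qed.

Lemma box_coord p d x : box p d x <-> 0 < d /\ forall i, `|x 0 i - p 0 i| < d.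
Proof.
split=> [xd|[d0 xd]].
  split=> [|i]; first exact: le_lt_trans xd.
  by apply: le_lt_trans xd; have := ler_coord_norm (x - p) i; rewrite !mxE.
rewrite /box /= /Num.Def.normr/= mx_normrE; apply/bigmax_ltP; split=> // -[k i] _.
by rewrite ord1 !mxE /=.
Qed.

Lemma box_upd p d x j t : box p d x -> `|t - p 0 j| < d -> box p d (upd x j t).
Proof.
move=> /box_coord[d0 xd] td; apply/box_coord; split=> // i.
by rewrite updE; case: eqP => [->|].
Qed.

Lemma box_time p d x j : box p d x -> `|x 0 j - p 0 j| < d.
Proof. by move=> /box_coord[]. Qed.

Lemma box_center p d : 0 < d -> box p d p.
Proof. by move=> d0; rewrite /box /= subrr normr0. Qed.

Lemma box_sub p d d' : d' <= d -> box p d' `<=` box p d.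
Proof. by move=> dd x; rewrite /box /= => /lt_le_trans; apply. Qed.

Lemma continuous_upd j : continuous (fun z : 'rV[R]_n * R => upd z.1 j z.2).
Proof.
move=> z; apply: cvgD; first exact: cvg_fst.
apply: cvgZl; apply: cvgB; first exact: cvg_snd.
apply: (@continuous_comp _ _ _ fst (fun x : 'rV[R]_n => x 0 j)); first exact: cvg_fst.
exact: coord_continuous.
Qed.

Lemma Ck_on_upd k (U : set 'rV[R]_n) j (u : 'rV[R]_n -> R) : open U ->
  Ck_fun k U u -> Ck_on k U (fun x => upd x j (u x)).
Proof.
move=> oU uk; apply: Ck_on_rV => // i.
have [->|ij] := eqVneq i j.
  by apply: Ck_on_eq uk => // x _; rewrite updE eqxx.
by apply: Ck_on_eq (Ck_fun_proj k U i) => // x _; rewrite updE (negPf ij).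
Qed.

Lemma continuous_updl j t x : {for x, continuous (fun y : 'rV[R]_n => upd y j t)}.
Proof.
by apply: (Ck_on0 (U := setT) (k := 0)) => //; apply: Ck_on_upd;
  [exact: openT|exact: Ck_fun_cst].
Qed.

Lemma is_derive_upd (f : 'rV[R]_n -> R) x j t (l : R) :
  is_derive (upd x j t) (dir j) f l -> is_derive t 1 (fun s => f (upd x j s)) l.
Proof.
move=> [df <-].
have E s : upd x j s = (x - x 0 j *: dir j) + s *: dir j.
  by rewrite /upd scalerBl addrCA addrC.
have -> : (fun s => f (upd x j s)) = (fun s => f ((x - x 0 j *: dir j) + s *: dir j)).
  by apply/funext => s; rewrite E.
by rewrite E; apply: is_derive_line; rewrite -E.
Qed.

Lemma is_derive_of_upd (f : 'rV[R]_n -> R) x j (l : R) :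
  is_derive (x 0 j) 1 (fun s => f (upd x j s)) l -> is_derive x (dir j) f l.
Proof.
have E : (fun h : R => h^-1 *: (((fun s : R => f (upd x j s)) \o shift (x 0 j)) (h *: 1)
            - f (upd x j (x 0 j)))) =
         (fun h => h^-1 *: ((f \o shift x) (h *: dir j) - f x)).
  apply/funext => h /=; rewrite upd_self; congr (_ *: (f _ - _)).
  by rewrite [h *: 1]mulr1 addrC -upd_dir upd_self addrC.
by move=> [H1 H2]; split; [move: H1; rewrite /derivable E|move: H2; rewrite /derive E].
Qed.

End Update.

(** * Uniformity over a compact segment, and the epsilon form of directional derivatives *)

Section UniformSegment.
Context {R : realType}.

(** A tube lemma: compactness of the segment turns continuity at each [(z0, t)] into an estimate
    near [z0] that is uniform in [t]. *)
Lemma uniform_segment (T : topologicalType) (G : T -> R -> R) (z0 : T) (a b : R) :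
  (forall t, a <= t <= b -> {for (z0, t), continuous (fun z => G z.1 z.2)}) ->
  forall e, 0 < e ->
    \forall z \near z0, forall t, a <= t <= b -> `|G z t - G z0 t| <= e.
Proof.
move=> Gc e e0.
have cov := (compact_near_coveringP _).1 (@segment_compact R a b).
have := cov T (nbhs z0) (fun z t => `|G z t - G z0 t| <= e) _.
have H : forall t, `[a, b]%classic t ->
    \forall t' \near t & z \near z0, `|G z t' - G z0 t'| <= e.
  move=> t; rewrite /= in_itv /= => /Gc /cvgrPdist_le /(_ (e / 2)).
  rewrite divr_gt0// => /(_ isT) [[A B]] /= [Az Bt] AB.
  exists (B, A) => //= -[t' z] [/= Bt' Az'].
  have h1 : `|G z0 t - G z t'| <= e / 2 by apply: (AB (z, t')).
  have h2 : `|G z0 t - G z0 t'| <= e / 2.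
    by apply: (AB (z0, t')); split=> //=; exact: nbhs_singleton.
  by move: h1 h2; rewrite !ler_norml => /andP[? ?] /andP[? ?]; apply/andP; split; lra.
move=> /(_ _ H); apply: filterS => z Hz t tab; apply: Hz.
by rewrite /= in_itv.
Qed.

Lemma is_derive_epsP (V : normedModType R) (f : V -> R) x v (l : R) :
  is_derive x v f l <-> forall e : R, 0 < e -> exists2 d : R, 0 < d &
    forall h : R, h != 0 -> `|h| < d -> `|(f (x + h *: v) - f x) / h - l| <= e.
Proof.
have E (h : R) : (f (x + h *: v) - f x) / h = h^-1 *: ((f \o shift x) (h *: v) - f x).
  by rewrite [LHS]mulrC [x + _]addrC.
split=> [[df <-] e e0|H].
  have /cvgrPdist_le /(_ e e0) := df.
  rewrite near_withinE => /(near_normP (V := R^o) _ 0)[d d0 dP]; exists d => // h h0 hd.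
  by have := dP h; rewrite subr0 => /(_ hd h0); rewrite distrC -E.
have C : (fun h => h^-1 *: ((f \o shift x) (h *: v) - f x)) @ 0^' --> l.
  apply/cvgrPdist_le => e /H[d d0 dP]; rewrite near_withinE.
  apply: (near_normP (V := R^o) _ 0).2; exists d => // h; rewrite subr0 => hd h0.
  by rewrite -E distrC; exact: dP.
by split; [apply/cvg_ex; exists l|exact: cvg_lim].
Qed.

End UniformSegment.

(** * Continuity and differentiability of solutions with respect to parameters *)

Section Dependence.
Context {R : realType} {n : nat}.
Variables (p : 'rV[R]_n) (d : R) (j : 'I_n).
Implicit Types (x y : 'rV[R]_n) (F : 'rV[R]_n -> R -> R) (u g w : 'rV[R]_n -> R).

Local Notation c := (p 0 j).

(** Coordinate [j] is the time and the other coordinates are parameters, so a family of solutions is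
    one function on the box. Initial values are prescribed on the plane [x 0 j = c]. *)
Definition solves F u := forall x, box p d x -> is_derive x (dir j) u (F x (u x)).

Lemma solves_line F u x : solves F u -> box p d x -> forall t, `|t - c| < d ->
  is_derive t 1 (fun s => u (upd x j s)) (F (upd x j t) (u (upd x j t))).
Proof. by move=> us xb t td; apply/is_derive_upd/us/box_upd. Qed.

Lemma line_continuous F u x t : solves F u -> box p d x -> `|t - c| < d ->
  {for t, continuous (fun s => u (upd x j s))}.
Proof. by move=> us xb td; exact: is_derive_continuous (solves_line us xb td). Qed.

Lemma solves_exists F g :
  (forall x, box p d x -> exists2 w : R -> R, w c = g x &
     forall t, `|t - c| < d -> is_derive t 1 w (F (upd x j t) (w t))) ->
  exists u, solves F u /\ (forall x, box p d x -> x 0 j = c -> u x = g x).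
Proof.
move=> H; have /choice[W WP] : forall x, exists w : R -> R, box p d x -> w c = g x /\
    forall t, `|t - c| < d -> is_derive t 1 w (F (upd x j t) (w t)).
  move=> x; have [/H[w wc wd]|] := pselect (box p d x); first by exists w.
  by exists (fun=> 0).
have cd x : box p d x -> box p d (upd x j c).
  by move=> xb; apply: box_upd => //; rewrite subrr normr0; move/box_coord: xb => [].
(* Choosing at the projection [upd x j c] makes all points of a line use the same solution. *)
exists (fun x => W (upd x j c) (x 0 j)); split=> [x xb|x xb xc]; last first.
  by rewrite xc -xc upd_self xc; have [] := WP x xb.
apply: is_derive_of_upd.
have [_ /(_ _ (box_time j xb))] := WP _ (cd x xb); rewrite upd_upd upd_self.
congr is_derive; apply/funext => s; rewrite upd_upd updE eqxx//.
Qed.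

Section Continuity.
Variables (F : 'rV[R]_n -> R -> R) (J : set R) (K : R) (u g : 'rV[R]_n -> R).
Hypotheses (K0 : 0 <= K) (uJ : forall x, box p d x -> J (u x)).
Hypothesis FK : forall x a b, box p d x -> J a -> J b ->
  `|F x a - F x b| <= K * `|a - b|.
Hypothesis Fc : forall x a, box p d x -> J a ->
  {for (x, a), continuous (fun z => F z.1 z.2)}.
Hypothesis gc : forall x, box p d x -> {for x, continuous g}.
Hypotheses (us : solves F u) (ug : forall x, box p d x -> x 0 j = c -> u x = g x).

Lemma near_time x (r : R) : box p d x -> `|x 0 j - c| < r ->
  \forall y \near x, box p d y /\ `|y 0 j - c| < r.
Proof.
by move=> xb xr; exact: (filterI (near_box xb) (near_coord xr)).
Qed.

(** Gronwall compares [u] on two parallel lines. The forcing term is the variation of [F] with the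
    state frozen on the line through [x], the initial gap is that of [g]; [C] is the Gronwall
    constant for unit errors, hence [e1 = e / C]. *)
Lemma solution_uniform x (r e : R) : box p d x -> 0 < r -> r < d -> 0 < e ->
  \forall y \near x, forall t, `|t - c| < r ->
    `|u (upd y j t) - u (upd x j t)| <= e.
Proof.
move=> xb r0 rd e0; have d0 : 0 < d by exact: lt_trans rd.
pose C := 2 * (r + 1) * expR (2 * (r * K) + 1).
have C0 : 0 < C by rewrite !mulr_gt0 ?expR_gt0//; lra.
pose e1 := e / C; have e10 : 0 < e1 by rewrite divr_gt0.
have cc : `|c - c| < d by rewrite subrr normr0.
have td t : c - r <= t <= c + r -> `|t - c| < d.
  by rewrite -ler_distl; move=> tr; exact: le_lt_trans rd.
have n1 := @uniform_segment R _ (fun y t => F (upd y j t) (u (upd x j t))) x (c - r) (c + r) _ e1 e10.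
have n2 : \forall y \near x, `|g (upd x j c) - g (upd y j c)| <= e1.
  have : {for x, continuous (fun y => g (upd y j c))}.
    apply: (@continuous_comp _ _ _ (fun y => upd y j c) g); last first.
      exact/gc/box_upd.
    exact: continuous_updl.
  by move=> /cvgrPdist_le; apply.
have n3 : \forall y \near x, box p d y by exact: near_box.
have Gc t : c - r <= t <= c + r ->
    {for (x, t), continuous (fun z : 'rV[R]_n * R => F (upd z.1 j z.2) (u (upd x j z.2)))}.
  move=> /td tc.
  apply: (@continuous_comp2 _ _ _ _ F (fun z => upd z.1 j z.2) (fun z => u (upd x j z.2))).
  - exact: continuous_upd.
  - apply: (@continuous_comp _ _ _ snd (fun s => u (upd x j s))); first exact: cvg_snd.
    exact: (line_continuous us).
  - by apply: Fc => /=; [exact: box_upd|exact/uJ/box_upd].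
apply: filterS (filterI n3 (filterI (n1 Gc) n2)) => y [yb [H1 H2]] t tr.
have td' s : `|s - c| < r -> `|s - c| < d by move=> ?; exact: lt_trans rd.
have := @gronwall_itv R (fun s => u (upd y j s) - u (upd x j s))
  (fun s => F (upd y j s) (u (upd y j s)) - F (upd x j s) (u (upd x j s)))
  c r K e1 e1 K0 (ltW e10) (ltW e10) _ _ _ t tr.
have -> : 2 * (r * e1 + e1) * expR (2 * (r * K) + 1) = e.
  rewrite (_ : _ * _ = e1 * C); first by rewrite divfK// gt_eqF.
  by rewrite /C; ring.
apply.
- move=> s /td' sd; apply: is_deriveB_fun; exact: solves_line.
- move=> s sr; have sd := td' s sr.
  rewrite -(subrKA (F (upd y j s) (u (upd x j s)))).
  rewrite (le_trans (ler_normD _ _))// lerD//.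
    by apply: FK; [exact: box_upd|exact/uJ/box_upd|exact/uJ/box_upd].
  by apply: H1; rewrite -ler_distl ltW.
- rewrite distrC !ug//; rewrite ?updE ?eqxx//; exact: box_upd.
Qed.

Lemma solution_continuous x : box p d x -> {for x, continuous u}.
Proof.
move=> xb; apply/continuous_at_epsP => e e0.
have xt := box_time j xb.
(* With [r] strictly between, the closed segment of radius [r] around [c] is compact in the domain
   and has [x 0 j] in its interior. *)
pose r := (`|x 0 j - c| + d) / 2.
have r1 : `|x 0 j - c| < r by rewrite /r; lra.
have r2 : r < d by rewrite /r; lra.
have r0 : 0 < r by exact: le_lt_trans r1.
have e2 : 0 < e / 2 by rewrite divr_gt0.
have n1 := solution_uniform xb r0 r2 e2.
have n2 := near_time xb r1.
have n3 : \forall y \near x, `|u (upd x j (x 0 j)) - u (upd x j ((y : 'rV[R]_n) 0 j))| <= e / 2.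
  have : {for x, continuous (fun y => u (upd x j (y 0 j)))}.
    apply: (@continuous_comp _ _ _ (fun y : 'rV[R]_n => y 0 j) (fun s => u (upd x j s))).
      exact: coord_continuous.
    exact: (line_continuous us).
  by move=> /continuous_at_epsP; apply.
apply: filterS (filterI n1 (filterI n2 n3)) => y [H1 [[yb yr] H3]].
have := H1 _ yr; rewrite upd_self; move: H3; rewrite upd_self.
by rewrite !ler_norml => /andP[? ?] /andP[? ?]; apply/andP; split; lra.
Qed.

End Continuity.

Section Derivative.
Variables (F Fw Fm : 'rV[R]_n -> R -> R) (J : set R) (K : R) (m : 'I_n).
Variables (u g gm w : 'rV[R]_n -> R).
Hypotheses (K0 : 0 <= K) (mj : m != j) (uJ : forall x, box p d x -> J (u x)).
Hypothesis Jconvex : forall a b t, J a -> J b -> 0 <= t <= 1 -> J (a + t * (b - a)).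
Hypothesis Fwd : forall x a, box p d x -> J a -> is_derive a (1 : R) (F x) (Fw x a).
Hypothesis Fmd : forall x a, box p d x -> J a ->
  is_derive x (dir m) (fun y => F y a) (Fm x a).
Hypothesis FwK : forall x a, box p d x -> J a -> `|Fw x a| <= K.
Hypothesis Fc : forall x a, box p d x -> J a ->
  {for (x, a), continuous (fun z => F z.1 z.2)}.
Hypothesis Fwc : forall x a, box p d x -> J a ->
  {for (x, a), continuous (fun z => Fw z.1 z.2)}.
Hypothesis Fmc : forall x a, box p d x -> J a ->
  {for (x, a), continuous (fun z => Fm z.1 z.2)}.
Hypothesis gc : forall x, box p d x -> {for x, continuous g}.
Hypothesis gd : forall x, box p d x -> is_derive x (dir m) g (gm x).
Hypotheses (us : solves F u) (ug : forall x, box p d x -> x 0 j = c -> u x = g x).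
Hypothesis ws : solves (fun x a => Fw x (u x) * a + Fm x (u x)) w.
Hypothesis wg : forall x, box p d x -> x 0 j = c -> w x = gm x.

Lemma F_increment x a b : box p d x -> J a -> J b ->
  exists2 t, 0 <= t <= 1 & F x b - F x a = Fw x (a + t * (b - a)) * (b - a).
Proof.
move=> xb Ja Jb.
have Jt (t : R) : 0 <= t <= 1 -> J (a + (t * (b - a)) *: (1 : R)).
  by move=> t01; rewrite [_ *: _]mulr1; exact: Jconvex.
have [|t t01] := @mean_value_segment R _ (F x) a 1 (b - a).
  by move=> t /Jt /(Fwd xb) H; exact: (@ex_derive _ _ _ _ _ _ _ H).
rewrite (@derive_val _ _ _ _ _ _ _ (Fwd xb (Jt _ t01))) => E.
by exists t => //; move: E; rewrite ![_ *: _]mulr1 [a + (b - a)]addrC subrK mulrC.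
Qed.

Lemma F_lipschitz x a b : box p d x -> J a -> J b ->
  `|F x a - F x b| <= K * `|a - b|.
Proof.
move=> xb Ja Jb; have [t t01 ->] := F_increment xb Jb Ja.
by rewrite normrM ler_wpM2r//; apply: FwK => //; exact: Jconvex.
Qed.

(* The difference quotient [q] of [u] in direction [m] and the solution [w] of the
   variational equation satisfy nearly the same linear equation along the line. *)
Lemma solution_derivative x : box p d x -> is_derive x (dir m) u (w x).
Proof.
move=> xb; apply/is_derive_epsP => e e0.
have xt := box_time j xb; have d0 : 0 < d by exact: le_lt_trans xt.
pose r := (`|x 0 j - c| + d) / 2.
have r1 : `|x 0 j - c| < r by rewrite /r; lra.
have r2 : r < d by rewrite /r; lra.
have r0 : 0 < r by exact: le_lt_trans r1.
have cr : `|c - c| < r by rewrite subrr normr0.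
have td t : c - r <= t <= c + r -> `|t - c| < d.
  by rewrite -ler_distl; move=> tr; exact: le_lt_trans r2.
have td' t : `|t - c| < r -> `|t - c| < d by move=> ?; exact: lt_trans r2.
have tI t : `|t - c| < r -> c - r <= t <= c + r by rewrite -ler_distl => /ltW.
(* [w] multiplies the error of [Fw] in the equation for [q], so it must be bounded on the compact
   segment. *)
have [Wm Wm0 WmP] : exists2 Wm, 0 <= Wm & forall t, `|t - c| < r -> `|w (upd x j t)| <= Wm.
  have ccc : c - r <= c + r by lra.
  have [|t0 _ H] := @EVT_max R (fun t => `|w (upd x j t)|) _ _ ccc.
    apply: continuous_in_subspaceT => t; rewrite inE /= in_itv /= => /td tc.
    apply: (@continuous_comp _ _ _ (fun t => w (upd x j t)) Num.norm); last exact: norm_continuous.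
    exact: (line_continuous ws).
  exists `|w (upd x j t0)| => // t /tI tr; apply: H; by rewrite in_itv.
(* The Gronwall bound for a forcing error [e1 * (Wm + 1)] and an initial error [e1] is [e1 * C],
   which is [e]. *)
pose C := 2 * (r * (Wm + 1) + 1) * expR (2 * (r * K) + 1).
have C0 : 0 < C by rewrite !mulr_gt0 ?expR_gt0// ltr_wpDl// mulr_ge0 ?ltW//; lra.
pose e1 := e / C; have e10 : 0 < e1 by rewrite divr_gt0.
have ux t : `|t - c| < d -> {for t, continuous (fun s => u (upd x j s))}.
  exact: (line_continuous us).
(* The base point of the line and the state are perturbed together, as the mean value point [xi]
   below requires. *)
have unif (G : 'rV[R]_n -> R -> R) : (forall x a, box p d x -> J a ->
    {for (x, a), continuous (fun z => G z.1 z.2)}) ->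
    \forall z \near (x, 0 : R), forall t, c - r <= t <= c + r ->
    `|G (upd z.1 j t) (u (upd x j t) + z.2) - G (upd x j t) (u (upd x j t))| <= e1.
  move=> Gc.
  have H t : c - r <= t <= c + r -> {for ((x, 0 : R), t), continuous
      (fun z => G (upd z.1.1 j z.2) (u (upd x j z.2) + z.1.2))}.
    move=> /td tc.
    apply: (@continuous_comp2 _ _ _ _ G (fun z : 'rV[R]_n * R * R => upd z.1.1 j z.2)
      (fun z : 'rV[R]_n * R * R => u (upd x j z.2) + z.1.2)).
    - apply: (@continuous_comp2 _ _ _ _ (fun y s => upd y j s)
        (fun z : 'rV[R]_n * R * R => z.1.1) (fun z => z.2)).
      + by apply: (@continuous_comp _ _ _ fst fst); exact: cvg_fst.
      + exact: cvg_snd.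
      + exact: continuous_upd.
    - apply: cvgD.
        apply: (@continuous_comp _ _ _ snd (fun s => u (upd x j s))); first exact: cvg_snd.
        exact: ux.
      by apply: (@continuous_comp _ _ _ fst snd); [exact: cvg_fst|exact: cvg_snd].
    - by rewrite /= addr0; apply: Gc; [exact: box_upd|exact/uJ/box_upd].
  have := @uniform_segment R _ (fun (z : 'rV[R]_n * R) t =>
    G (upd z.1 j t) (u (upd x j t) + z.2)) (x, 0) _ _ H _ e10.
  apply: filterS => -[y s] /= Hz t /Hz.
  by rewrite addr0.
have near_pair (P : 'rV[R]_n * R -> Prop) : (\forall z \near (x, 0 : R), P z) ->
    exists2 r : R, 0 < r & forall y s, `|y - x| < r -> `|s| <= r -> P (y, s).
  move=> [[A B] /= [/near_normP[rA rA0 rAP] /(near_normP (V := R^o) _ 0)[rB rB0 rBP]] AB].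
  exists (Num.min rA (rB / 2)); first by rewrite lt_min rA0 divr_gt0.
  move=> y s; rewrite lt_min le_min => /andP[yA _] /andP[_ sB].
  apply: (AB (y, s)); split; first exact: rAP.
  by apply: rBP; rewrite subr0; apply: le_lt_trans sB _; lra.
have [rw rw0 rwP] := near_pair _ (unif _ Fwc).
have [rm rm0 rmP] := near_pair _ (unif _ Fmc).
have /near_normP[ru ru0 ruP] := solution_uniform K0 uJ F_lipschitz Fc gc us ug xb r0 r2 rw0.
have /near_normP[rb rb0 rbP] := near_box xb.
have cd : `|c - c| < d by exact: td'.
have [rg rg0 rgP] := (is_derive_epsP _ _ _ _).1 (gd (box_upd xb cd)) _ e10.
exists (Num.min (Num.min rw rm) (Num.min (Num.min ru rb) rg)).
  by rewrite !lt_min rw0 rm0 ru0 rb0 rg0.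
move=> h h0; rewrite !lt_min => /andP[/andP[hw hm] /andP[/andP[hu hb] hg]].
have yn s : `|s| <= `|h| -> `|x + s *: dir m - x| <= `|h|.
  by move=> sh; rewrite addrAC subrr add0r normrZ norm_dir mulr1.
have yb s : `|s| <= `|h| -> box p d (x + s *: dir m).
  by move=> sh; apply: rbP; apply: le_lt_trans hb; exact: yn.
pose y := x + h *: dir m.
have yb' : box p d y by exact: yb.
have yu s : upd y j s = upd x j s + h *: dir m by rewrite /y updD.
pose q t := (u (upd y j t) - u (upd x j t)) / h - w (upd x j t).
pose dq t := (F (upd y j t) (u (upd y j t)) - F (upd x j t) (u (upd x j t))) / h
   - (Fw (upd x j t) (u (upd x j t)) * w (upd x j t) + Fm (upd x j t) (u (upd x j t))).
have qd t : `|t - c| < r -> is_derive t 1 q (dq t).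
  move=> /td' tc; apply: is_deriveB_fun; last exact: (solves_line ws).
  have H0 : is_derive t (1 : R) (fun _ : R => h^-1) 0 by exact: is_derive_cst.
  have := is_deriveM_fun (is_deriveB_fun (solves_line us yb' tc) (solves_line us xb tc)) H0.
  by rewrite mulr0 add0r mulrC.
have qb t : `|t - c| < r -> `|dq t| <= K * `|q t| + e1 * (Wm + 1).
  move=> tr; have tc := td' _ tr.
  have xtb := box_upd xb tc; have ytb := box_upd yb' tc.
  have [s s01 Es] := F_increment ytb (uJ xtb) (uJ ytb).
  set xi := _ + s * _ in Es.
  have Jxi : J xi := Jconvex (uJ xtb) (uJ ytb) s01.
  have A1 : `|Fw (upd y j t) xi - Fw (upd x j t) (u (upd x j t))| <= e1.
    apply: (rwP y (s * (u (upd y j t) - u (upd x j t)))) => //; last exact: tI.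
      by apply: le_lt_trans hw; exact: yn.
    have us1 : `|u (upd y j t) - u (upd x j t)| <= rw.
      by apply: ruP => //; apply: le_lt_trans hu; exact: yn.
    have /andP[s0 s1] := s01.
    by apply: le_trans us1; rewrite normrM ger0_norm// ler_piMl.
  have sh (s' : R) : 0 <= s' <= 1 -> `|s' * h| <= `|h|.
    by move=> /andP[s'0 s'1]; rewrite normrM ger0_norm// ler_piMl.
  have zb (s' : R) : 0 <= s' <= 1 -> box p d (upd x j t + (s' * h) *: dir m).
    by move=> /sh s'h; rewrite -updD//; apply: box_upd => //; exact: yb.
  have [|s' s'01] := @mean_value_segment R _ (fun z => F z (u (upd x j t)))
      (upd x j t) (dir m) h.
    by move=> s' /zb zb'; exact: (@ex_derive _ _ _ _ _ _ _ (Fmd zb' (uJ xtb))).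
  rewrite (@derive_val _ _ _ _ _ _ _ (Fmd (zb _ s'01) (uJ xtb))) -yu => Es'.
  have A2 : `|Fm (upd x j t + (s' * h) *: dir m) (u (upd x j t)) -
      Fm (upd x j t) (u (upd x j t))| <= e1.
    have := rmP (x + (s' * h) *: dir m) 0.
    rewrite normr0 => /(_ _ (ltW rm0) t (tI _ tr)); rewrite /= addr0 updD//; apply.
    by apply: le_lt_trans hm; exact/yn/sh.
  have A3 := FwK ytb Jxi; have A4 := WmP t tr.
  (* The first term is linear in [q] with factor at most [K]; the other two are bounded by [e1 * Wm]
     and [e1]. *)
  have -> : dq t = Fw (upd y j t) xi * q t
      + (Fw (upd y j t) xi - Fw (upd x j t) (u (upd x j t))) * w (upd x j t)
      + (Fm (upd x j t + (s' * h) *: dir m) (u (upd x j t)) -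
         Fm (upd x j t) (u (upd x j t))).
    have E1 : F (upd y j t) (u (upd y j t)) - F (upd x j t) (u (upd x j t)) =
        Fw (upd y j t) xi * (u (upd y j t) - u (upd x j t)) +
        h * Fm (upd x j t + (s' * h) *: dir m) (u (upd x j t)).
      by rewrite -Es -Es' subrKA.
    by rewrite /dq /q E1; field.
  rewrite -addrA [e1 * _]mulrDr mulr1 (le_trans (ler_normD _ _))// lerD//.
    by rewrite normrM ler_wpM2r.
  by rewrite (le_trans (ler_normD _ _))// lerD// normrM ler_pM.
have q0 : `|q c| <= e1.
  have xcb := box_upd xb cd; have ycb := box_upd yb' cd.
  have E0 z : upd z j c 0 j = c by rewrite updE eqxx.
  by rewrite /q !ug// wg// yu; exact: rgP.
have e20 : 0 <= e1 * (Wm + 1) by rewrite mulr_ge0 ?ltW//; lra.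
have := gronwall_itv K0 e20 (ltW e10) qd qb q0 r1.
rewrite /q yu upd_self (_ : _ * expR _ = e)//.
rewrite (_ : _ * _ = e1 * C); first by rewrite divfK// gt_eqF.
by rewrite /C; ring.
Qed.

End Derivative.

End Dependence.

(** * Smoothness of solutions of linear and nonlinear equations *)

Section Regularity.
Context {R : realType} {n : nat}.
Variables (p : 'rV[R]_n) (j : 'I_n).
Implicit Types (x y : 'rV[R]_n) (f g u w A B : 'rV[R]_n -> R).

Lemma continuous_fst_comp A x (a : R) : {for x, continuous A} ->
  {for (x, a), continuous (fun z : 'rV[R]_n * R => A z.1)}.
Proof. by move=> Ac; apply: (@continuous_comp _ _ _ fst A); [exact: cvg_fst|]. Qed.

Lemma continuous_affine A B x (a : R) : {for x, continuous A} ->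
  {for x, continuous B} ->
  {for (x, a), continuous (fun z : 'rV[R]_n * R => A z.1 * z.2 + B z.1)}.
Proof.
move=> Ac Bc; apply: cvgD; last exact: continuous_fst_comp.
by apply: cvgM; [exact: continuous_fst_comp|exact: cvg_snd].
Qed.

(** Being linear, the variational equation is solvable on the same box as the equation it comes
    from. *)
Lemma linear_solution_exists d A B g : Ck_fun 0 (box p d) A -> Ck_fun 0 (box p d) B ->
  exists w, solves p d j (fun x a => A x * a + B x) w /\
    forall x, box p d x -> x 0 j = p 0 j -> w x = g x.
Proof.
move=> Ac Bc; apply: solves_exists => x xb.
have lc (C : 'rV[R]_n -> R) : Ck_fun 0 (box p d) C -> forall t, `|t - p 0 j| < d ->
    {for t, continuous (fun s => C (upd x j s))}.
  move=> Cc t td; apply: (@continuous_comp _ _ _ (fun s => upd x j s) C).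
    apply: (@continuous_comp2 _ _ _ _ (fun y s => upd y j s) (fun=> x) id).
    - exact: cvg_cst.
    - exact: cvg_id.
    - exact: continuous_upd.
  by apply: Cc; exact: box_upd.
exact: (linear_ode (g x) (lc _ Ac) (lc _ Bc)).
Qed.

(** A derivative of [w] in a direction other than [j] solves an equation with the same coefficient
    [A], hence the same bound [K], and new source ['D_m A * w + 'D_m B]. The induction is used
    twice: it makes [w], and so this source, of class C^k, and then the derivative. *)
Lemma linear_solution_Ck k d A B g w K : 0 <= K ->
  (forall x, box p d x -> `|A x| <= K) ->
  Ck_fun k (box p d) A -> Ck_fun k (box p d) B -> Ck_fun k (box p d) g ->
  solves p d j (fun x a => A x * a + B x) w ->
  (forall x, box p d x -> x 0 j = p 0 j -> w x = g x) -> Ck_fun k (box p d) w.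
Proof.
move=> K0 AK; have oQ := @open_box R n p d.
elim: k B g w => [|k IH] B g w Ak Bk gk ws wg.
  move=> x xb; have Ac := Ck_on0 Ak; have Bc := Ck_on0 Bk.
  apply: (@solution_continuous _ _ p d j (fun x a => A x * a + B x) setT K w g K0) => //.
  - by move=> y a b yb _ _; rewrite opprD addrACA subrr addr0 -mulrBr normrM ler_wpM2r// AK.
  - by move=> y a yb _; apply: continuous_affine; [exact: Ac|exact: Bc].
have wk : Ck_fun k (box p d) w.
  by apply: IH ws wg; exact: Ck_onS.
have dA x : box p d x -> differentiable A x := Ck_on_differentiable Ak.
have dB x : box p d x -> differentiable B x := Ck_on_differentiable Bk.
have DA m : Ck_fun k (box p d) ('D_(dir m) A) := Ck_fun_derive _ Ak.
have DB m : Ck_fun k (box p d) ('D_(dir m) B) := Ck_fun_derive _ Bk.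
have H m : exists2 wm, Ck_fun k (box p d) wm &
    forall x, box p d x -> is_derive x (dir m) w (wm x).
  have [->|mj] := eqVneq m j.
    exists (fun x => A x * w x + B x); last exact: ws.
    by apply: Ck_funD => //; [apply: Ck_funM => //; exact: Ck_onS|exact: Ck_onS].
  pose B' x : R := ('D_(dir m) A x : R) * w x + ('D_(dir m) B x : R).
  have B'k : Ck_fun k (box p d) B'.
    exact: (Ck_funD oQ (Ck_funM oQ (DA m) wk) (DB m)).
  have [wm [wms wmg]] := linear_solution_exists ('D_(dir m) g)
    (Ck_on_le (leq0n _) Ak) (Ck_on_le (leq0n _) B'k).
  exists wm.
    exact: (IH _ _ _ (Ck_onS Ak) B'k (Ck_fun_derive _ gk) wms wmg).
  have cA := Ck_on0 Ak; have cB := Ck_on0 Bk.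
  apply: (@solution_derivative _ _ p d j (fun x a => A x * a + B x) (fun x _ => A x)
    (fun x a => ('D_(dir m) A x : R) * a + ('D_(dir m) B x : R)) setT K m w g ('D_(dir m) g) wm) => //.
  - move=> x a xb _.
    have H1 : is_derive a (1 : R) (fun s : R => s) 1 by exact: is_derive_id.
    have H2 (b : R) : is_derive a (1 : R) (fun s : R => b) 0 by exact: is_derive_cst.
    have := is_deriveD_fun (is_deriveM_fun (H2 (A x)) H1) (H2 (B x)).
    by rewrite mulr0 !addr0 mulr1.
  - move=> x a xb _.
    have HA : is_derive x (dir m) A ('D_(dir m) A x).
      by apply: derivableP; apply: diff_derivable; exact: dA.
    have HB : is_derive x (dir m) B ('D_(dir m) B x).
      by apply: derivableP; apply: diff_derivable; exact: dB.
    have Ha : is_derive x (dir m) (fun=> a) 0 by exact: is_derive_cst.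
    have := @is_deriveD _ _ _ _ _ _ _ _ _ (@is_deriveM _ _ _ _ _ _ _ _ HA Ha) HB.
    by rewrite scaler0 add0r [a *: _]mulrC.
  - by move=> x a xb _; exact: AK.
  - by move=> x a xb _; apply: continuous_affine; [exact: cA|exact: cB].
  - by move=> x a xb _; apply: continuous_fst_comp; exact: cA.
  - by move=> x a xb _; exact: (@continuous_affine ('D_(dir m) A) ('D_(dir m) B) x a
      (Ck_on0 (DA m) xb) (Ck_on0 (DB m) xb)).
  - exact: (Ck_on0 gk).
  - by move=> x xb; apply: derivableP; apply: diff_derivable; exact: (Ck_on_differentiable gk).
apply: Ck_fun_partials => // [m x xb|m]; have [wm wmk wmd] := H m.
  exact: (@ex_derive _ _ _ _ _ _ _ (wmd x xb)).
by apply: Ck_on_eq wmk => // x xb; rewrite (@derive_val _ _ _ _ _ _ _ (wmd x xb)).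
Qed.

Section Nonlinear.
Variables (i : 'I_n) (d r K : R) (f u g : 'rV[R]_n -> R).
Hypotheses (dr : d <= r) (K0 : 0 <= K).
Hypothesis fC : forall k, Ck_fun k (box p r) f.
Hypothesis fK : forall x, box p r x -> `|'D_(dir i) f x| <= K.

Local Notation J := ([set a | `|a - p 0 i| < r] : set R).

(** The state takes the place of coordinate [i]. Points stay in the box of radius [d] while states
    range over an interval of radius [r >= d], which leaves room for the solution to move. *)
Lemma box_upd_J x a : box p d x -> J a -> box p r (upd x i a).
Proof. by move=> xb Ja; apply: box_upd => //; exact: box_sub xb. Qed.

Lemma J_convex a b (t : R) : J a -> J b -> 0 <= t <= 1 -> J (a + t * (b - a)).
Proof.
rewrite /= => ar br /andP[t0 t1].
have -> : a + t * (b - a) - p 0 i = (1 - t) * (a - p 0 i) + t * (b - p 0 i) by ring.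
apply: le_lt_trans (ler_normD _ _) _; rewrite !normrM.
rewrite (ger0_norm t0) ger0_norm ?subr_ge0//.
apply: (@le_lt_trans _ _ (Num.max `|a - p 0 i| `|b - p 0 i|)); last by rewrite gt_max ar br.
move: `|a - p 0 i| `|b - p 0 i| => X Y.
have X1 : X <= Num.max X Y by rewrite le_max lexx.
have Y1 : Y <= Num.max X Y by rewrite le_max lexx orbT.
have : (1 - t) * X <= (1 - t) * Num.max X Y by rewrite ler_wpM2l// subr_ge0.
have : t * Y <= t * Num.max X Y by rewrite ler_wpM2l.
lra.
Qed.

Lemma f_derivable x v : box p r x -> derivable f x v.
Proof. by move=> xb; apply: diff_derivable; have [+ _] := fC 1; apply. Qed.

Lemma f_continuous x a : box p d x -> J a ->
  {for (x, a), continuous (fun z : 'rV[R]_n * R => f (upd z.1 i z.2))}.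
Proof.
move=> xb Ja; apply: (@continuous_comp _ _ _ (fun z : 'rV[R]_n * R => upd z.1 i z.2) f).
  exact: continuous_upd.
by apply: (Ck_on0 (fC 0)); exact: box_upd_J.
Qed.

Lemma f_state_derive x a : box p d x -> J a ->
  is_derive a (1 : R) (fun s => f (upd x i s)) ('D_(dir i) f (upd x i a)).
Proof.
by move=> xb Ja; apply/is_derive_upd/derivableP/f_derivable/box_upd_J.
Qed.

Lemma f_lipschitz x a b : box p d x -> J a -> J b ->
  `|f (upd x i a) - f (upd x i b)| <= K * `|a - b|.
Proof.
move=> xb Ja Jb.
apply: (@F_lipschitz _ _ p d (fun x a => f (upd x i a))
  (fun x a => 'D_(dir i) f (upd x i a)) J K) => //.
- exact: J_convex.
- exact: f_state_derive.
- by move=> y s yb Js; apply/fK/box_upd_J.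
Qed.

Hypothesis gC : forall k, Ck_fun k (box p d) g.
Hypothesis uJ : forall x, box p d x -> J (u x).
Hypothesis us : solves p d j (fun x a => f (upd x i a)) u.
Hypothesis ug : forall x, box p d x -> x 0 j = p 0 j -> u x = g x.

(** The bootstrap: for [u] of class C^k the coefficients of the variational equation are of class
    C^k, hence so are the partial derivatives of [u] by [linear_solution_Ck]; along [j] the equation
    itself gives the derivative. *)
Lemma solution_Ck k : Ck_fun k (box p d) u.
Proof.
have oQ := @open_box R n p d.
elim: k => [|k IH].
  move=> x xb; apply: (@solution_continuous _ _ p d j (fun x a => f (upd x i a)) J K u g K0) => //.
  - exact: f_lipschitz.
  - exact: f_continuous.
  - exact: (Ck_on0 (gC 0)).
have comp_k (h : 'rV[R]_n -> R) : (forall k, Ck_fun k (box p r) h) ->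
    Ck_fun k (box p d) (fun x => h (upd x i (u x))).
  move=> hC; apply: (Ck_fun_comp (U' := box p r)) => //; last exact: Ck_on_upd.
  by move=> x xb; apply: box_upd_J => //; exact: uJ.
have Df m l : Ck_fun l (box p r) ('D_(dir m) f) by have [_] := fC l.+1; exact.
have H m : exists2 wm, Ck_fun k (box p d) wm &
    forall x, box p d x -> is_derive x (dir m) u (wm x).
  have [->|mj] := eqVneq m j.
    by exists (fun x => f (upd x i (u x))); [exact: comp_k|exact: us].
  pose A x : R := 'D_(dir i) f (upd x i (u x)).
  (* Coordinate [i] of [x] is overwritten by the state, so [f (upd x i a)] does not vary in that
     direction. *)
  pose Fm x a : R := if m == i then 0 else 'D_(dir m) f (upd x i a).
  have Ak : Ck_fun k (box p d) A := comp_k _ (Df i).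
  have Bk : Ck_fun k (box p d) (fun x => Fm x (u x)).
    by rewrite /Fm; case: eqP => _; [exact: Ck_fun_cst|exact: comp_k _ (Df m)].
  have Dg l : Ck_fun l (box p d) ('D_(dir m) g) by have [_] := gC l.+1; exact.
  have [wm [wms wmg]] := linear_solution_exists ('D_(dir m) g)
    (Ck_on_le (leq0n _) Ak) (Ck_on_le (leq0n _) Bk).
  exists wm.
    apply: (linear_solution_Ck K0 _ Ak Bk (Dg k) wms wmg) => x xb.
    by apply: fK; apply: box_upd_J => //; exact: uJ.
  apply: (@solution_derivative _ _ p d j (fun x a => f (upd x i a))
    (fun x a => 'D_(dir i) f (upd x i a)) Fm J K m u g ('D_(dir m) g) wm) => //.
  - exact: J_convex.
  - exact: f_state_derive.
  - move=> x a xb Ja; apply/is_derive_epsP => e e0; rewrite /Fm.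
    have [->|mi] := eqVneq m i.
      by exists 1 => // h h0 _; rewrite updD_eq subrr mul0r subrr normr0 ltW.
    have Hd := derivableP (@f_derivable _ (dir m) (box_upd_J xb Ja)).
    have [e1 e10 H1] := (is_derive_epsP _ _ _ _).1 Hd e e0.
    by exists e1 => // h h0 he; rewrite updD//; exact: H1.
  - by move=> x a xb Ja; apply/fK/box_upd_J.
  - exact: f_continuous.
  - move=> x a xb Ja.
    apply: (@continuous_comp _ _ _ (fun z : 'rV[R]_n * R => upd z.1 i z.2) ('D_(dir i) f)).
      exact: continuous_upd.
    by apply: (Ck_on0 (Df i 0)); exact: box_upd_J.
  - move=> x a xb Ja; rewrite /Fm; case: eqP => _; first exact: cvg_cst.
    apply: (@continuous_comp _ _ _ (fun z : 'rV[R]_n * R => upd z.1 i z.2) ('D_(dir m) f)).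
      exact: continuous_upd.
    by apply: (Ck_on0 (Df m 0)); exact: box_upd_J.
  - exact: (Ck_on0 (gC 0)).
  - move=> x xb; apply: derivableP; apply: diff_derivable.
    by have [+ _] := gC 1; apply.
apply: Ck_fun_partials => // [m x xb|m]; have [wm wmk wmd] := H m.
  exact: (@ex_derive _ _ _ _ _ _ _ (wmd x xb)).
by apply: Ck_on_eq wmk => // x xb; rewrite (@derive_val _ _ _ _ _ _ _ (wmd x xb)).
Qed.

End Nonlinear.

End Regularity.

(** * Local existence of smooth solutions *)

Section Flow.
Context {R : realType} {n : nat}.
Implicit Types (p x y : 'rV[R]_n) (f g u : 'rV[R]_n -> R).

Lemma near_box_sub p (P : 'rV[R]_n -> Prop) : (\forall x \near p, P x) ->
  exists2 d : R, 0 < d & forall x, box p d x -> P x.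
Proof. by move=> /near_normP[d d0 dP]; exists d. Qed.

Lemma continuous_bounded f p : {for p, continuous f} ->
  \forall x \near p, `|f x| <= `|f p| + 1.
Proof.
move=> /continuous_at_epsP/(_ 1 ltr01); apply: filterS => x H.
rewrite -[f x](subrK (f p)) (le_trans (ler_normD _ _))// addrC lerD2l.
by rewrite distrC.
Qed.

(** Truncating the state makes the right-hand side bounded and Lipschitz for all states, as
    [scalar_ode] demands. *)
Definition clamp (a b t : R) : R := Num.max a (Num.min t b).

Lemma clamp_itv a b t : a <= b -> a <= clamp a b t <= b.
Proof. by move=> ab; rewrite /clamp le_max lexx /= ge_max ab ge_min lexx orbT. Qed.

Lemma clamp_id a b t : a <= t <= b -> clamp a b t = t.
Proof. by move=> /andP[at_ tb]; rewrite /clamp (min_idPl tb) (max_idPr at_). Qed.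

Lemma clamp_lipschitz a b s t : `|clamp a b s - clamp a b t| <= `|s - t|.
Proof.
have ab_le (A B : R) : A <= `|B| -> - A <= `|B| -> `|A| <= `|B|.
  by move=> *; rewrite ler_norml; apply/andP; split; lra.
have n1 (B : R) : B <= `|B| /\ - B <= `|B| by rewrite ler_norm -normrN ler_norm.
have maxl (x y : R) : `|Num.max a x - Num.max a y| <= `|x - y|.
  have [? ?] := n1 (x - y).
  by case: (leP a x) => ax; case: (leP a y) => ay; apply: ab_le; lra.
apply: le_trans (maxl _ _) _; have [? ?] := n1 (s - t).
by case: (leP s b) => sb; case: (leP t b) => tb; apply: ab_le; lra.
Qed.

Lemma clamp_continuous a b t : {for t, continuous (clamp a b)}.
Proof.
apply: (continuous_at_epsP (V := R^o) (clamp a b) t).2 => e e0.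
apply: (near_normP (V := R^o) _ t).2; exists e => // s st.
by rewrite distrC; apply: le_trans (clamp_lipschitz _ _ _ _) _; exact: ltW.
Qed.

(** The truncated equation is solved first; its solution stays too close to [p 0 i] for the
    truncation to act. The case [i = j] is allowed: time is then overwritten by the state, and the
    equation is autonomous. *)
Theorem flow_exists p (i j : 'I_n) (U : set 'rV[R]_n) f g : open U -> U p ->
  smooth_on (W := R^o) U f -> smooth_on (W := R^o) U g -> g p = p 0 i ->
  exists d u, [/\ 0 < d, smooth_on (W := R^o) (box p d) u,
    forall x, box p d x -> U x /\ U (upd x i (u x)),
    solves p d j (fun x a => f (upd x i a)) u &
    forall x, box p d x -> x 0 j = p 0 j -> u x = g x].
Proof.
move=> oU Up fC gC gp.
have Df k : Ck_fun k U ('D_(dir i) f) := Ck_fun_derive _ (fC k.+1).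
have n1 : \forall x \near p, U x := near_open oU Up (fun _ Ux => Ux).
have n2 := continuous_bounded (Ck_on0 (fC 0) Up).
have n3 := continuous_bounded (Ck_on0 (Df 0) Up).
have [r r0 rP] := near_box_sub (filterI n1 (filterI n2 n3)).
set M := `|f p| + 1 in rP; set K := _ + 1 in rP.
have K0 : 0 < K by rewrite ltr_wpDl.
have M0 : 0 < M by rewrite ltr_wpDl.
have r8 : 0 < r / 8 by rewrite divr_gt0.
have /continuous_at_epsP/(_ _ r8)/near_box_sub[rg rg0 rgP] := Ck_on0 (gC 0) Up.
(* The four bounds keep the box inside the one of radius [r], limit the motion along a line to
   [r / 8], make Picard contract, and keep [g] within [r / 8] of [g p]. *)
pose d := Num.min (Num.min (r / 2) (r / 8 / M)) (Num.min (1 / 4 / K) rg).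
have d0 : 0 < d.
  by rewrite !lt_min rg0 !divr_gt0.
have /andP[dr2 dM] : (d <= r / 2) && (d <= r / 8 / M).
  by rewrite -le_min /d ge_min lexx.
have /andP[dK dg] : (d <= 1 / 4 / K) && (d <= rg).
  by rewrite -le_min /d ge_min lexx orbT.
have dr : d <= r by apply: le_trans dr2 _; lra.
have fK x : box p r x -> `|'D_(dir i) f x| <= K by move=> /rP[_ []].
have fC' k : Ck_fun k (box p r) f.
  by apply: Ck_on_sub (fC k) => x /rP[].
have gC' k : Ck_fun k (box p d) g.
  by apply: Ck_on_sub (gC k) => x /(box_sub dr)/rP[].
pose cl := clamp (p 0 i - r / 2) (p 0 i + r / 2).
have clr a : `|cl a - p 0 i| < r.
  have : p 0 i - r / 2 <= cl a <= p 0 i + r / 2 by apply: clamp_itv; lra.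
  by move=> /andP[? ?]; rewrite ltr_norml; apply/andP; split; lra.
have FB x a : box p d x -> `|f (upd x i (cl a))| <= M.
  by move=> xb; have [_ []] := rP _ (box_upd (box_sub dr xb) (clr a)).
have [u [us ug]] : exists u, solves p d j (fun x a => f (upd x i (cl a))) u /\
    forall x, box p d x -> x 0 j = p 0 j -> u x = g x.
  apply: solves_exists => x xb.
  apply: (@scalar_ode R (fun t a => f (upd (upd x j t) i (cl a))) _ _ K M (g x)) => //.
  - exact: ltW.
  - by rewrite -ler_pdivlMr.
  - by move=> t a td; apply: FB; exact: box_upd.
  - move=> t a b td; apply: le_trans (_ : K * `|cl a - cl b| <= _).
      exact: (f_lipschitz dr fC' fK (box_upd xb td) (clr a) (clr b)).
    by rewrite ler_wpM2l ?(ltW K0)//; exact: clamp_lipschitz.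
  - move=> v vc t td.
    apply: (@continuous_comp2 _ _ _ _ (fun y a => f (upd y i a)) (fun s => upd x j s)
      (fun s => cl (v s))).
    + apply: (@continuous_comp2 _ _ _ _ (fun y s => upd y j s) (fun=> x) id).
      * exact: cvg_cst.
      * exact: cvg_id.
      * exact: continuous_upd.
    + apply: (@continuous_comp _ _ _ v cl); [exact: vc|exact: clamp_continuous].
    + exact: (f_continuous dr fC' (box_upd xb td) (clr _)).
(* Motion and initial deviation add up to at most [r / 4], inside the truncation radius [r / 2]. *)
have ubd x : box p d x -> `|u x - p 0 i| <= r / 4.
  move=> xb; have xt := box_time j xb.
  have pd : `|p 0 j - p 0 j| < d by rewrite subrr normr0.
  have seg s : `|s| <= `|x 0 j - p 0 j| -> `|p 0 j + s *: (1 : R) - p 0 j| < d.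
    by move=> sx; rewrite addrAC subrr add0r [_ *: _]mulr1; exact: le_lt_trans xt.
  have [|s sx] := @mean_value R _ (fun s => u (upd x j s)) (p 0 j) 1 (x 0 j - p 0 j).
    by move=> s /seg sd; exact: (@ex_derive _ _ _ _ _ _ _ (solves_line us xb sd)).
  rewrite (@derive_val _ _ _ _ _ _ _ (solves_line us xb (seg s sx))).
  rewrite [(x 0 j - _) *: _]mulr1 [p 0 j + (x 0 j - _)]addrC subrK upd_self => E.
  have x0b := box_upd xb pd.
  have H1 : `|u x - u (upd x j (p 0 j))| <= r / 8.
    rewrite E normrM; apply: (@le_trans _ _ (d * M)).
      by rewrite ler_pM// ?FB ?ltW//; exact/box_upd/seg.
    by rewrite -ler_pdivlMr.
  have H2 : `|u (upd x j (p 0 j)) - p 0 i| <= r / 8.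
    by rewrite ug ?updE ?eqxx// -gp distrC rgP//; exact: box_sub x0b.
  move: H1 H2; rewrite !ler_norml => /andP[? ?] /andP[? ?]; apply/andP; split; lra.
have uJ x : box p d x -> `|u x - p 0 i| < r.
  by move=> /ubd /le_lt_trans; apply; lra.
have us' : solves p d j (fun x a => f (upd x i a)) u.
  move=> x xb; have := us x xb; rewrite /cl clamp_id//.
  by have := ubd x xb; rewrite ler_norml => /andP[? ?]; apply/andP; split; lra.
exists d, u; split=> //.
  by move=> k; exact: (solution_Ck dr (ltW K0) fC' fK gC' uJ us' ug).
move=> x xb; have [xU _] := rP x (box_sub dr xb).
by have [] := rP _ (box_upd (box_sub dr xb) (uJ x xb)).
Qed.

End Flow.

(** * Local diffeomorphisms *)

Definition local_diffeo (R : realType) n (U : set 'rV[R]_n)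
    (f g : 'rV[R]_n -> 'rV[R]_n) : Prop :=
  [/\ open U, smooth_on U f, forall x, U x -> g (f x) = x,
      open (f @` U) & smooth_on (f @` U) g].

Section LocalDiffeo.
Context {R : realType} {n : nat}.
Implicit Types (p x y : 'rV[R]_n) (f g : 'rV[R]_n -> 'rV[R]_n) (U : set 'rV[R]_n).

Lemma open_preimage_on (V W : normedModType R) (U : set V) (h : V -> W) (A : set W) :
  open U -> open A -> (forall x : V, U x -> {for x, continuous h}) ->
  open [set x : V | U x /\ A (h x)].
Proof.
move=> oU oA hc; rewrite openE => x [Ux Ahx]; rewrite /interior.
apply: filterI; first exact: open_nbhs_nbhs.
by apply: hc => //; exact: open_nbhs_nbhs.
Qed.

(** The image of [U'] is the part of the old image that the continuous [g] sends into [U'], hence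
    open. *)
Lemma local_diffeo_sub U U' f g : local_diffeo U f g -> open U' -> U' `<=` U ->
  local_diffeo U' f g.
Proof.
move=> [oU fC gf ofU gC] oU' UU'; split=> //.
- by move=> k; exact: Ck_on_sub (fC k).
- by move=> x /UU'; exact: gf.
- rewrite (_ : f @` U' = [set y | (f @` U) y /\ U' (g y)]).
    by apply: open_preimage_on => //; exact: (Ck_on0 (gC 0)).
  apply/seteqP; split=> y.
    by move=> [x U'x <-]; split; [exists x => //; exact: UU'|rewrite gf//; exact: UU'].
  by move=> [[x Ux <-]]; rewrite gf// => U'x; exists x.
- by move=> k; apply: Ck_on_sub (gC k) => y [x /UU' Ux <-]; exists x.
Qed.

Lemma local_diffeo_comp U1 U2 f1 g1 f2 g2 :
  local_diffeo U1 f1 g1 -> local_diffeo U2 f2 g2 ->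
  local_diffeo [set x | U1 x /\ U2 (f1 x)] (f2 \o f1) (g1 \o g2).
Proof.
move=> d1 d2; have [oU1 f1C _ _ _] := d1; have [oU2 _ _ _ _] := d2.
have oU : open [set x | U1 x /\ U2 (f1 x)].
  by apply: open_preimage_on => //; exact: (Ck_on0 (f1C 0)).
have [_ f1C' g1f1 of1 g1C] := local_diffeo_sub d1 oU (fun x H => H.1).
set U := [set x | _] in oU f1C' g1f1 of1 g1C *.
have f1U2 : f1 @` U `<=` U2 by move=> y [x [_ U2x] <-].
have [_ f2C g2f2 of2 g2C] := local_diffeo_sub d2 of1 f1U2.
have E : (f2 \o f1) @` U = f2 @` (f1 @` U) by rewrite image_comp.
split=> //.
- by move=> k; apply: (Ck_on_comp (U' := f1 @` U)).
- by move=> x Ux /=; rewrite g2f2 ?g1f1//; exists x.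
- by rewrite E.
- rewrite E => k; apply: (Ck_on_comp (U' := f1 @` U)) => //.
  by move=> _ [y Uy <-]; rewrite g2f2.
Qed.

Lemma linear_local_diffeo (f g : {linear 'rV[R]_n -> 'rV[R]_n}) :
  cancel f g -> cancel g f -> local_diffeo setT f g.
Proof.
have lC (h : {linear 'rV[R]_n -> 'rV[R]_n}) : smooth_on setT h.
  move=> k; have H i : Ck_fun k setT (fun x => h x 0 i).
    have := Ck_fun_sum openT (fun l => Ck_funM openT (Ck_fun_proj k setT l)
      (Ck_fun_cst k setT (h (dir l) 0 i))).
    apply: Ck_on_eq; first exact: openT.
    move=> x _; rewrite [x in RHS]row_sum_delta linear_sum summxE.
    by apply: eq_bigr => l _; rewrite linearZ !mxE.
  by apply: Ck_on_rV => //; exact: openT.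
move=> fg gf; have E : f @` setT = setT.
  by apply/seteqP; split=> // y _; exists (g y).
by split; rewrite ?E//; exact: openT.
Qed.

Lemma derive_lincomb (W : normedModType R) (V : normedModType R) (h : V -> W) (x v w : V)
    (a b : R) : differentiable h x ->
  'D_(a *: v + b *: w) h x = a *: 'D_v h x + b *: 'D_w h x.
Proof. by move=> dh; rewrite !deriveE// linearD !linearZ. Qed.

End LocalDiffeo.

(** * The inverse function theorem for maps that change one coordinate *)

Section Shear.
Context {R : realType} {n : nat}.
Variables (p : 'rV[R]_n) (r : R) (i : 'I_n) (u : 'rV[R]_n -> R) (sg : R).
Implicit Types (x y : 'rV[R]_n).
Hypothesis uC : smooth_on (W := R^o) (box p r) u.
(** [sg] carries the constant sign of the derivative, so that both signs are handled at once;
    [shear_diffeo] takes for it the derivative at the centre. *)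
Hypothesis usg : forall x, box p r x -> 0 < 'D_(dir i) u x * sg.

Local Notation S := (fun x => upd x i (u x)).
Local Notation Q := (box p r).

Lemma shear_differentiable x : Q x -> differentiable u x.
Proof. exact: (Ck_on_differentiable (uC 1)). Qed.

Lemma shear_derive_neq0 x : Q x -> 'D_(dir i) u x != 0.
Proof. by move=> /usg; apply: contraTneq => ->; rewrite mul0r ltxx. Qed.

Lemma shear_increment x t : Q x -> `|t - p 0 i| < r ->
  exists2 y, Q y & u (upd x i t) - u x = (t - x 0 i) * 'D_(dir i) u y.
Proof.
move=> xQ tr; have xr := box_time i xQ.
have seg (s : R) : 0 <= s <= 1 -> Q (x + (s * (t - x 0 i)) *: dir i).
  move=> s01; rewrite -[x in x + _](upd_self x i) upd_dir.
  by apply: box_upd => //; apply: J_convex.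
have [|s s01] := @mean_value_segment R _ u x (dir i) (t - x 0 i).
  by move=> s /seg sQ; apply: diff_derivable; exact: shear_differentiable.
rewrite -[x in x + (t - _) *: _](upd_self x i) upd_dir [x 0 i + (t - _)]addrC subrK => ->.
by exists (x + (s * (t - x 0 i)) *: dir i) => //; exact: seg.
Qed.

(** Points with the same image differ at most in coordinate [i], and the mean value theorem excludes
    a difference there. *)
Lemma shear_inj x y : Q x -> Q y -> S x = S y -> x = y.
Proof.
move=> xQ yQ E.
have Ey : y = upd x i (y 0 i).
  apply/rowP => k; rewrite updE; case: eqP => [->//|/eqP ki].
  by have := congr1 (fun z : 'rV[R]_n => z 0 k) E; rewrite !updE (negPf ki).
have Eu : u x = u y.
  by have := congr1 (fun z : 'rV[R]_n => z 0 i) E; rewrite !updE eqxx.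
have [z zQ] := shear_increment xQ (box_time i yQ).
rewrite -Ey -Eu subrr => /esym/eqP; rewrite mulf_eq0 (negPf (shear_derive_neq0 zQ)) orbF.
by rewrite subr_eq0 => /eqP yx; rewrite Ey yx upd_self.
Qed.

(** For [y] near [S x0], the values of [u] at the two ends of the segment through [y] along axis [i]
    lie on opposite sides of [y 0 i]; the intermediate value theorem gives a preimage on it. *)
Lemma shear_open W : open W -> W `<=` Q -> open (S @` W).
Proof.
move=> oW WQ; rewrite openE => _ [x0 Wx0 <-]; rewrite /interior.
have /near_normP[e' e'0 eW] : \forall x \near x0, W x := near_open oW Wx0 (fun _ H => H).
pose e := e' / 2; have e0 : 0 < e by rewrite divr_gt0.
have ee' : e < e' by rewrite /e; lra.
have inW x : (forall k, `|x 0 k - x0 0 k| <= e) -> W x.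
  move=> H; apply: eW; apply: le_lt_trans ee'; apply: rV_norm_le; first exact: ltW.
  by move=> k; rewrite !mxE.
have W1 t : `|t| <= e -> W (upd x0 i (x0 0 i + t)).
  move=> te; apply: inW => k; rewrite updE; case: eqP => [->|_].
    by rewrite addrAC subrr add0r.
  by rewrite subrr normr0 ltW.
have xr := box_time i (WQ _ Wx0).
have en : `|e| <= e by rewrite gtr0_norm.
have eNn : `|- e| <= e by rewrite normrN gtr0_norm.
have tr t : `|t| <= e -> `|x0 0 i + t - p 0 i| < r.
  by move=> /W1/WQ/(box_time i); rewrite updE eqxx.
have [z1 z1Q] := shear_increment (WQ _ Wx0) (tr _ en).
have [z2 z2Q] := shear_increment (WQ _ Wx0) (tr _ eNn).
set a1 := u (upd x0 i (x0 0 i + e)); set a2 := u (upd x0 i (x0 0 i - e)).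
rewrite [x0 0 i + e - _]addrAC subrr add0r [x0 0 i - e - _]addrAC subrr add0r => E2 E1.
have p1 : 0 < (a1 - u x0) * sg by rewrite E1 -mulrA mulr_gt0// usg.
have p2 : (a2 - u x0) * sg < 0 by rewrite E2 !mulNr oppr_lt0 -mulrA mulr_gt0// usg.
(* Two errors of size [eta] use up at most half of either margin; the [+ 1] keeps the denominator
   positive. *)
pose eta := Num.min ((a1 - u x0) * sg) (- ((a2 - u x0) * sg)) / (4 * (`|sg| + 1)).
have sg1 : 0 < `|sg| + 1 by rewrite ltr_wpDl.
have eta0 : 0 < eta.
  by rewrite /eta divr_gt0 ?mulr_gt0// lt_min p1 oppr_gt0 p2.
have etaE : eta * `|sg| * 4 <= Num.min ((a1 - u x0) * sg) (- ((a2 - u x0) * sg)).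
  rewrite -[leRHS](@divfK _ (4 * (`|sg| + 1))); last by rewrite gt_eqF ?mulr_gt0.
  rewrite -/eta -mulrA ler_wpM2l ?(ltW eta0)//; lra.
have uc t : `|t| <= e -> exists2 d, 0 < d & forall y, `|y - upd x0 i (x0 0 i + t)| < d ->
    `|u (upd x0 i (x0 0 i + t)) - u y| <= eta.
  move=> te; have /continuous_at_epsP/(_ _ eta0)/near_normP[d d0 dP] :=
    Ck_on0 (uC 0) (WQ _ (W1 t te)).
  by exists d.
have [d1 d10 d1P] := uc _ en; have [d2 d20 d2P] := uc _ eNn.
apply: (near_normP (S @` W) (S x0)).2.
exists (Num.min (Num.min d1 d2) (Num.min e eta)).
  by rewrite !lt_min d10 d20 e0 eta0.
move=> y; rewrite !lt_min => /andP[/andP[yd1 yd2] /andP[ye yeta]].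
have yk k : k != i -> `|y 0 k - x0 0 k| <= `|y - S x0|.
  by move=> ki; have := ler_coordB_norm y (S x0) k; rewrite updE (negPf ki).
have yi : `|y 0 i - u x0| <= eta.
  apply: le_trans (ltW yeta); have := ler_coordB_norm y (S x0) i.
  by rewrite updE eqxx.
have ynear t : `|upd y i t - upd x0 i t| <= `|y - S x0|.
  apply: rV_norm_le => // k; rewrite mxE [(- upd _ _ _) 0 k]mxE !updE.
  by case: eqVneq => [_|/yk//]; rewrite subrr normr0.
have b1 := d1P _ (le_lt_trans (ynear _) yd1).
have b2 := d2P _ (le_lt_trans (ynear _) yd2).
rewrite -/a1 in b1; rewrite -/a2 in b2.
have yW t : `|t - x0 0 i| <= e -> W (upd y i t).
  move=> te; apply: inW => k; rewrite updE; case: eqVneq => [->//|/yk H].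
  exact: le_trans H (ltW ye).
have sgb (s : R) : `|s| <= eta -> `|s * sg| <= eta * `|sg|.
  by move=> H; rewrite normrM ler_wpM2r.
have le2 : x0 0 i - e <= x0 0 i + e by lra.
have cont : {within `[x0 0 i - e, x0 0 i + e], continuous (fun t => u (upd y i t))}.
  apply: continuous_in_subspaceT => t; rewrite inE /= in_itv /= -ler_distl => /yW/WQ yQ.
  have D : is_derive (upd y i t) (dir i) u ('D_(dir i) u (upd y i t)).
    by apply: derivableP; apply: diff_derivable; exact: shear_differentiable.
  exact: is_derive_continuous (is_derive_upd D).
have [|t] := IVT le2 cont (v := y 0 i).
  set B1 := u (upd y i (x0 0 i + e)) in b1 *; set B2 := u (upd y i (x0 0 i - e)) in b2 *.
  have := sgb _ b1; have := sgb _ b2; have := sgb _ yi.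
  move: etaE; rewrite le_min !ler_norml => /andP[m1 m2] /andP[c1 c2] /andP[c3 c4] /andP[c5 c6].
  have q1 : 0 < (B1 - y 0 i) * sg.
    have -> : (B1 - y 0 i) * sg = (a1 - u x0) * sg - (a1 - B1) * sg - (y 0 i - u x0) * sg by ring.
    by move: (eta * `|sg|) m1 m2 c1 c2 c3 c4 c5 c6 => X *; lra.
  have q2 : (B2 - y 0 i) * sg < 0.
    have -> : (B2 - y 0 i) * sg = (a2 - u x0) * sg - (a2 - B2) * sg - (y 0 i - u x0) * sg by ring.
    by move: (eta * `|sg|) m1 m2 c1 c2 c3 c4 c5 c6 => X *; lra.
  rewrite ge_min le_max; case: (ltgtP sg 0) q1 q2 => [s0|s0|->].
  - rewrite nmulr_lgt0// nmulr_llt0// subr_lt0 subr_gt0 => /ltW -> /ltW ->.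
    by rewrite orbT.
  - by rewrite pmulr_lgt0// pmulr_llt0// subr_lt0 subr_gt0 => /ltW -> /ltW ->; rewrite orbT.
  - by rewrite mulr0 ltxx.
rewrite in_itv /= -ler_distl => te ut.
by exists (upd y i t); [exact: yW|rewrite ut upd_upd upd_self].
Qed.

Section Inverse.
Variable g : 'rV[R]_n -> 'rV[R]_n.
Hypothesis gS : forall x, Q x -> g (S x) = x.

Local Notation V := (S @` Q).

Lemma shear_inverse y : V y -> Q (g y) /\ S (g y) = y.
Proof. by move=> [x xQ <-]; rewrite gS. Qed.

Lemma shear_inverse_coord y k : V y -> k != i -> g y 0 k = y 0 k.
Proof. by move=> /shear_inverse[_ E] ki; rewrite -[in RHS]E updE (negPf ki). Qed.

Lemma shear_inverse_value y : V y -> u (g y) = y 0 i.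
Proof. by move=> /shear_inverse[_ E]; rewrite -[in RHS]E updE eqxx. Qed.

Lemma shear_image_open : open V.
Proof. by apply: shear_open => //; exact: open_box. Qed.

(** Openness of the shear is continuity of its inverse. *)
Lemma shear_inverse_continuous y : V y -> {for y, continuous g}.
Proof.
move=> [x0 x0Q <-] B; rewrite gS// => Bx0.
pose A := [set x | Q x /\ B^° x].
have oA : open A.
  rewrite (_ : A = Q `&` B^°)//; apply: openI; [exact: open_box|exact: open_interior].
have oSA : open (S @` A) by apply: shear_open => // x [].
have SAy : (S @` A) (S x0) by exists x0.
apply: filterS (open_nbhs_nbhs (conj oSA SAy)) => _ [x [xQ Bx] <-].
by rewrite /= gS//; exact: interior_subset.
Qed.

(** Implicit differentiation of [u (g y) = y 0 i], where [g y] shares its other coordinates with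
    [y]. *)
Lemma shear_inverse_derive y m : V y -> is_derive y (dir m) (fun z => g z 0 i)
  (((m == i)%:R - (m != i)%:R * 'D_(dir m) u (g y)) / 'D_(dir i) u (g y)).
Proof.
move=> yV; have [xQ SxE] := shear_inverse yV.
set x := g y in xQ SxE *; set D : R := 'D_(dir i) u x; set Dm : R := 'D_(dir m) u x.
set N := (_ - _); apply/is_derive_epsP => e e0.
have D0 : 0 < `|D| by rewrite normr_gt0; exact: shear_derive_neq0.
(* The error of the linear approximation involves the unknown increment [k]. The bounds
   [ep <= |D| / 2] and [ep <= 1] absorb it and give [|k| <= C * |h|]; the third bound on [ep] then
   makes the quotient error at most [e]. *)
pose C := 2 * (`|N| + 1) / `|D|.
have C0 : 0 <= C by rewrite !mulr_ge0 ?invr_ge0 ?addr_ge0.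
pose ep := Num.min (Num.min (`|D| / 2) 1) (e * `|D| / (1 + C)).
have ep0 : 0 < ep by rewrite !lt_min !divr_gt0 ?mulr_gt0 ?ltr01//=; lra.
have /andP[/andP[ep1 ep2] ep3] : (ep <= `|D| / 2) && (ep <= 1) && (ep <= e * `|D| / (1 + C)).
  by rewrite -!le_min.
have du := shear_differentiable xQ.
have /near_normP[d d0 dP] := differentiable_approx du ep0.
have n1 : \forall z \near y, `|g y - g z| < d.
  by have /cvgrPdist_lt := shear_inverse_continuous yV; apply.
have n2 : \forall z \near y, V z := near_open shear_image_open yV (fun _ H => H).
have [r' r'0 rP] := (near_normP _ _).1 (filterI n1 n2).
exists r' => // h h0 hr; pose yh := y + h *: dir m.
have [yhd yhV] : `|g y - g yh| < d /\ V yh.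
  by apply: rP; rewrite addrAC subrr add0r normrZ norm_dir mulr1.
rewrite -/yh; pose k := g yh 0 i - x 0 i; rewrite -/k.
pose mu : R := (m != i)%:R.
have yhE l : yh 0 l = y 0 l + h * (l == m)%:R by rewrite /yh !mxE eqxx.
have Eeta : g yh - x = (mu * h) *: dir m + k *: dir i.
  apply/rowP => l; rewrite mxE [(- x) 0 l]mxE mxE 4!mxE !eqxx/=.
  have [->|li] := eqVneq l i.
    rewrite -/k mulr1 /mu eq_sym; case: eqVneq => _; first by rewrite !mul0r add0r.
    by rewrite mulr0 add0r.
  rewrite shear_inverse_coord// /x shear_inverse_coord// mulr0 addr0.
  rewrite yhE addrAC subrr add0r /mu.
  by have [<-|lm] := eqVneq l m; rewrite ?li ?mul1r// !mulr0.
have yhd' : `|g yh - x| < d by rewrite distrC.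
have := dP (g yh - x); rewrite subr0 => /(_ yhd').
rewrite subrK shear_inverse_value// /x shear_inverse_value// -/x.
rewrite Eeta derive_lincomb// -/D -/Dm.
have -> : yh 0 i = y 0 i + h * (m == i)%:R.
  by rewrite yhE eq_sym.
have eta_le : `|(mu * h) *: dir m + k *: dir i : 'rV[R]_n| <= `|h| + `|k|.
  rewrite (le_trans (ler_normD _ _))// !normrZ !norm_dir !mulr1 lerD2r.
  by rewrite /mu; case: (_ != _); rewrite ?normr1 ?normr0 ?mul1r// mul0r.
move=> /le_trans /(_ (ler_wpM2l (ltW ep0) eta_le)).
rewrite (_ : _ - _ - _ = h * N - k * D); last first.
  have E (Y a b : R) : Y + h * a - Y - (b * h * Dm + k * D) = h * (a - b * Dm) - k * D.
    by ring.
  rewrite /N -/mu; move: (mu) ((m == i)%:R : R) => b a.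
  exact: E.
move=> H.
have kC : `|k| <= C * `|h|.
  have H1 : `|k| * `|D| <= `|h| * `|N| + ep * (`|h| + `|k|).
    rewrite -!normrM -[k * D](subrK (h * N)) (le_trans (ler_normD _ _))// addrC.
    by rewrite lerD2l distrC.
  rewrite /C mulrAC ler_pdivlMr//.
  have : ep * `|h| <= `|h| by rewrite ler_piMl.
  have : ep * `|k| <= `|D| / 2 * `|k| by rewrite ler_wpM2r.
  move: H1; rewrite !mulrDr; move: (`|D|) (`|k|) (`|h|) (`|N|) => *; nra.
rewrite (_ : k / h - N / D = - (h * N - k * D) / (h * D)); last first.
  by field; rewrite h0 -normr_gt0 D0.
rewrite normrM normrN normfV normrM ler_pdivrMr ?mulr_gt0 ?normr_gt0//; last first.
  by rewrite -normr_gt0.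
apply: le_trans H _.
apply: (@le_trans _ _ (e * `|D| / (1 + C) * ((1 + C) * `|h|))).
  by rewrite ler_pM// ?addr_ge0// ?(ltW ep0)// mulrDl mul1r lerD2l.
have C1 : 1 + C != 0 by rewrite gt_eqF// ltr_wpDr.
by rewrite mulrA divfK// -mulrA [`|D| * _]mulrC.
Qed.

(** Only coordinate [i] of [g] is in question, and its partial derivatives are rational in the
    derivatives of [u] at [g y]: class C^k of [g] improves by one. *)
Lemma shear_local_diffeo : local_diffeo Q S g.
Proof.
have oQ := @open_box R n p r; have oV := shear_image_open.
split=> //; first by move=> k; apply: Ck_on_upd => //; exact: uC.
have cC k : Ck_on k V g -> forall l, Ck_fun k V (fun y => 'D_(dir l) u (g y)).
  move=> gk l; have VQ y : V y -> Q (g y) by move=> /shear_inverse[].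
  exact: (Ck_fun_comp oV VQ (Ck_fun_derive (dir l) (uC k.+1)) gk).
have vC k : Ck_fun k V (fun y => g y 0 i) -> Ck_on k V g.
  move=> vk; apply: Ck_on_rV => // l; have [->//|li] := eqVneq l i.
  apply: Ck_on_eq (Ck_fun_proj k V l) => // y yV.
  by rewrite shear_inverse_coord.
elim=> [|k IH]; first exact: shear_inverse_continuous.
apply: vC; apply: Ck_fun_partials => // [m y yV|m].
  exact: (@ex_derive _ _ _ _ _ _ _ (shear_inverse_derive m yV)).
have D0 y : V y -> 'D_(dir i) u (g y) != 0 by move=> /shear_inverse[/shear_derive_neq0].
have := Ck_funM oV (Ck_funB oV (Ck_fun_cst k V (m == i)%:R)
  (Ck_funM oV (Ck_fun_cst k V (m != i)%:R) (cC k IH m))) (Ck_funV oV D0 (cC k IH i)).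
apply: Ck_on_eq => // y yV.
by rewrite (@derive_val _ _ _ _ _ _ _ (shear_inverse_derive m yV)).
Qed.

End Inverse.

End Shear.

(** By continuity the derivative stays within half its modulus at [p] and keeps its sign; the
    inverse is picked by choice. *)
Theorem shear_diffeo (R : realType) n (U : set 'rV[R]_n) p (i : 'I_n) (u : 'rV[R]_n -> R) :
  open U -> U p -> smooth_on (W := R^o) U u -> 'D_(dir i) u p != 0 ->
  exists r g, [/\ 0 < r, box p r `<=` U,
    forall x, box p r x -> 'D_(dir i) u x != 0 &
    local_diffeo (box p r) (fun x => upd x i (u x)) g].
Proof.
move=> oU Up uC D0.
have D2 : 0 < `|'D_(dir i) u p| / 2 by rewrite divr_gt0 ?normr_gt0.
have /continuous_at_epsP/(_ _ D2) n1 := Ck_on0 (Ck_fun_derive (dir i) (uC 1)) Up.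
have n2 : \forall x \near p, U x := near_open oU Up (fun _ H => H).
have [r r0 rP] := near_box_sub (filterI n1 n2).
have usg x : box p r x -> 0 < 'D_(dir i) u x * 'D_(dir i) u p.
  move=> /rP[]; move: ('D_(dir i) u x) ('D_(dir i) u p) D0 => a b b0 H _.
  have b2 : 0 < `|b| by rewrite normr_gt0.
  have : 0 < b * b by rewrite -expr2 exprn_even_gt0.
  have : `|(b - a) * b| <= `|b| / 2 * `|b| by rewrite normrM ler_wpM2r.
  rewrite mulrAC -normrM ler_norml => /andP[_ +] bb; rewrite (ger0_norm (ltW bb)); lra.
have uC' : smooth_on (W := R^o) (box p r) u.
  by move=> k; apply: Ck_on_sub (uC k) => x /rP[].
have /choice[g gP] : forall y, exists x, (exists2 z, box p r z & upd z i (u z) = y) ->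
    box p r x /\ upd x i (u x) = y.
  move=> y; have [[x xQ E]|nE] := pselect (exists2 z, box p r z & upd z i (u z) = y).
    by exists x.
  by exists p.
exists r, g; split=> //; [by move=> x /rP[]| |].
  by move=> x /usg; apply: contraTneq => ->; rewrite mul0r ltxx.
apply: (shear_local_diffeo uC' usg) => x xQ.
have [gQ gE] : box p r (g (upd x i (u x))) /\ upd (g (upd x i (u x))) i (u (g (upd x i (u x)))) = upd x i (u x).
  by apply: gP; exists x.
exact: (shear_inj uC' usg gQ xQ gE).
Qed.

Notation smooth_fun U f := (smooth_on (W := _^o) U f).

(** The integrating factor makes [w * expR (- A)] constant. Gronwall would need a bound on [a],
    which is only continuous on the open interval. *)
Lemma linear_ode_zero (R : realType) (a w : R -> R) (c d : R) :
  (forall t, `|t - c| < d -> {for t, continuous a}) ->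
  (forall t, `|t - c| < d -> is_derive t 1 w (a t * w t)) -> w c = 0 ->
  forall t, `|t - c| < d -> w t = 0.
Proof.
move=> ac wd wc t td; have [A Ac Ad] := primitive_itv ac.
have zd s : `|s - c| < d -> is_derive s 1 (fun s => w s * expR (- A s)) 0.
  move=> sd; have H0 : is_derive s (1 : R) (fun _ : R => 0 : R) 0 by exact: is_derive_cst.
  have AN := is_deriveB_fun H0 (Ad s sd).
  have H : is_derive s 1 (fun s => expR (- A s)) (expR (- A s) * - a s).
    have -> : (fun s => expR (- A s)) = (fun s => expR (0 - A s)).
      by apply/funext => x; rewrite sub0r.
    by have := is_derive_expR_comp AN; rewrite !sub0r.
  have := is_deriveM_fun (wd s sd) H.
  by rewrite (_ : _ + _ = 0)//; ring.
have z0 s : `|s - c| < d -> is_derive s (1 : R) (fun _ : R => 0 : R) 0.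
  by move=> _; exact: is_derive_cst.
have : w t * expR (- A t) = 0.
  by apply: (is_derive_eq_itv zd z0) td; rewrite wc mul0r.
by move=> /eqP; rewrite mulf_eq0 [X in _ || X]gt_eqF ?expR_gt0// orbF => /eqP.
Qed.

(** * Straightening a flag of distributions *)

Section ShearDerivative.
Context {R : realType} {n : nat}.
Implicit Types (x : 'rV[R]_n) (u : 'rV[R]_n -> R).

Lemma smooth_shear (U : set 'rV[R]_n) i u : open U -> smooth_fun U u ->
  smooth_on U (fun x => upd x i (u x)).
Proof. by move=> oU uC k; exact: Ck_on_upd. Qed.

Lemma derive_dir_coord x (i k : 'I_n) :
  'D_(dir k) (fun y : 'rV[R]_n => y 0 i : R^o) x = (i == k)%:R.
Proof.
rewrite deriveE; last exact: differentiable_coord.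
rewrite (_ : (fun y : 'rV[R]_n => y 0 i : R^o) = rV_coord i)// diff_lin.
  by rewrite -[LHS]/((dir k : 'rV[R]_n) 0 i) mxE eqxx.
exact: rV_coord_continuous.
Qed.

Lemma differentiable_shear x i u : differentiable (u : _ -> R^o) x ->
  differentiable (fun y => upd y i (u y)) x.
Proof.
move=> du; have -> : (fun y => upd y i (u y)) = (fun y => y + (u y - y 0 i) *: dir i) by [].
apply: differentiableD => //; apply: differentiableZl.
by apply: differentiableB => //; exact: differentiable_coord.
Qed.

Lemma derive_shear x i k u : differentiable (u : _ -> R^o) x ->
  'D_(dir k) (fun y => upd y i (u y)) x =
    (if k == i then 0 else dir k) + ('D_(dir k) u x : R) *: dir i.
Proof.
move=> du; have dS := differentiable_shear i du.
apply/rowP => l; rewrite -derive_coord// mxE [(_ *: dir i) 0 l]mxE [dir i 0 l]mxE eqxx /=.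
have [->|li] := eqVneq l i.
  have -> : (fun y : 'rV[R]_n => upd y i (u y) 0 i) = u.
    by apply/funext => y; rewrite updE eqxx.
  rewrite mulr1; case: eqVneq => [_|ki]; first by rewrite mxE add0r.
  by rewrite mxE eqxx eq_sym (negPf ki) add0r.
have -> : (fun y : 'rV[R]_n => upd y i (u y) 0 l) = (fun y => y 0 l).
  by apply/funext => y; rewrite updE (negPf li).
rewrite derive_dir_coord mulr0 addr0; have [<-|lk] := eqVneq l k.
  by rewrite (negPf li) mxE !eqxx.
by case: ifP => _; rewrite mxE// (negPf lk) andbF.
Qed.

Lemma diff_linear_ex (V W : normedModType R) (f : V -> W) (x : V) :
  exists L : {linear V -> W}, forall v, 'd f x v = L v.
Proof. by exists ('d f x). Qed.

Lemma derive_comp3 (V : normedModType R) (f1 f2 f3 : V -> V) (x y z v : V)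
    (L2 L3 : {linear V -> V}) : y = f1 x -> z = f2 y ->
  differentiable f1 x -> differentiable f2 y -> differentiable f3 z ->
  (forall w, 'd f2 y w = L2 w) -> (forall w, 'd f3 z w = L3 w) ->
  'D_v (f3 \o (f2 \o f1)) x = L3 (L2 ('D_v f1 x)).
Proof.
move=> -> -> d1 d2 d3 E2 E3; rewrite derive_comp//; last exact: differentiable_comp.
by rewrite derive_comp// (deriveE _ d3) (deriveE _ d2) E2 E3.
Qed.

Lemma diff_shear x i k u : differentiable (u : _ -> R^o) x ->
  'd (fun y => upd y i (u y)) x (dir k) =
    (if k == i then 0 else dir k) + ('D_(dir k) u x : R) *: dir i.
Proof.
move=> du; rewrite -derive_shear//; apply/esym/deriveE.
exact: differentiable_shear.
Qed.

Lemma derive_comp_shear (f u : 'rV[R]_n -> R) x i k : k != i ->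
  differentiable (u : _ -> R^o) x -> differentiable (f : _ -> R^o) (upd x i (u x)) ->
  'D_(dir k) (fun y => f (upd y i (u y))) x =
    'D_(dir k) f (upd x i (u x)) + 'D_(dir k) u x * 'D_(dir i) f (upd x i (u x)) :> R.
Proof.
move=> ki du df; pose S := fun y => upd y i (u y).
have dS : differentiable S x by exact: differentiable_shear.
have E : 'D_(dir k) S x = 1 *: dir k + ('D_(dir k) u x : R) *: dir i.
  by rewrite derive_shear// (negPf ki) scale1r.
have := @derive_comp R _ _ R^o f S x (dir k) df dS.
rewrite E derive_lincomb// => ->.
by rewrite scale1r.
Qed.

End ShearDerivative.

Section InitialPlane.
Context {R : realType} {n : nat}.
Variables (p : 'rV[R]_n) (d : R) (j k : 'I_n) (u g : 'rV[R]_n -> R).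
Hypothesis kj : k != j.
Hypothesis ug : forall x, box p d x -> x 0 j = p 0 j -> u x = g x.

(** Direction [k] is tangent to the initial plane, so only values on that plane enter the
    derivative. *)
Lemma derive_initial x : box p d x -> x 0 j = p 0 j -> derivable g x (dir k) ->
  'D_(dir k) u x = 'D_(dir k) g x.
Proof.
move=> xb xj gd; apply: (@derive_val _ _ _ _ _ _ _ _).
apply/is_derive_epsP => e e0.
have [d1 d10 d1P] := (is_derive_epsP _ _ _ _).1 (derivableP gd) e e0.
have /near_normP[d2 d20 d2P] := near_box xb.
exists (Num.min d1 d2); first by rewrite lt_min d10.
move=> h h0; rewrite lt_min => /andP[h1 h2].
rewrite !ug//; first exact: d1P.
  by apply: d2P; rewrite addrAC subrr add0r normrZ norm_dir mulr1.
by rewrite !mxE eqxx /= eq_sym (negPf kj) mulr0 addr0.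
Qed.

End InitialPlane.

(** * The three straightening shears *)

Section Straighten.
Context {R : realType}.
Variables (i1 i2 i3 : 'I_3) (U : set 'rV[R]_3) (p : 'rV[R]_3).
Variables (P Q b om : 'rV[R]_3 -> R).
Hypotheses (i12 : i1 != i2) (i13 : i1 != i3) (i23 : i2 != i3).
Hypotheses (oU : open U) (Up : U p).
Hypotheses (PC : smooth_fun U P) (QC : smooth_fun U Q) (bC : smooth_fun U b).
Hypotheses (omC : smooth_fun U om) (om0 : forall x, U x -> om x != 0).
(* Equivalent to [plane_field = d_2 + P d_1] and [d_3 + Q d_1] commuting. *)
Hypothesis PQ : forall x, U x ->
  'D_(dir i2) Q x + P x * 'D_(dir i1) Q x = 'D_(dir i3) P x + Q x * 'D_(dir i1) P x.

Lemma smooth_differentiable (V W : normedModType R) (A : set V) (f : V -> W) x :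
  smooth_on A f -> A x -> differentiable f x.
Proof. by move=> fC; exact: (Ck_on_differentiable (fC 1)). Qed.

(** For a fixed first coordinate the graph of [u] over the other two is a leaf of D. On the line
    where these two equal those of [p], [u] is the first coordinate, whence the normalisation at
    [p]. *)
Lemma leaf_function : exists d u, [/\ 0 < d, smooth_fun (box p d) u,
  forall x, box p d x -> U (upd x i1 (u x)),
  forall x, box p d x -> 'D_(dir i3) u x = Q (upd x i1 (u x)) /\
                         'D_(dir i2) u x = P (upd x i1 (u x)) &
  u p = p 0 i1 /\ 'D_(dir i1) u p = 1].
Proof.
have C1 : smooth_fun U (fun x => x 0 i1) by move=> k; exact: Ck_fun_proj.
have [d1 [u1 [d10 u1C u1U u1s u1g]]] := flow_exists i2 oU Up PC C1 erefl.
pose U1 := [set x | U x /\ box p d1 x].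
have oU1 : open U1 by apply: openI => //; exact: open_box.
have U1p : U1 p by split=> //; exact: box_center.
have QC1 : smooth_fun U1 Q by move=> k; apply: Ck_on_sub (QC k) => x [].
have u1C1 : smooth_fun U1 u1 by move=> k; apply: Ck_on_sub (u1C k) => x [].
have u1p : u1 p = p 0 i1 by rewrite u1g//; exact: box_center.
have [d [u [d0 uC uU us ug]]] := flow_exists i3 oU1 U1p QC1 u1C1 u1p.
have pb := box_center p d0; have p1b := box_center p d10.
exists d, u; split=> //.
- by move=> x /uU[_ []].
- move=> x xb; split; first by rewrite (@derive_val _ _ _ _ _ _ _ (us x xb)).
  move: x xb; have oB := @open_box R 3 p d.
  have duu x : box p d x -> differentiable (u : _ -> R^o) x := smooth_differentiable uC.
  pose T x := upd x i1 (u x).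
  have UT x : box p d x -> U (T x) by move=> /uU[_ []].
  have dP x : box p d x -> differentiable (P : _ -> R^o) (T x).
    by move=> /UT; exact: smooth_differentiable.
  have dQ x : box p d x -> differentiable (Q : _ -> R^o) (T x).
    by move=> /UT; exact: smooth_differentiable.
  have D3u x : box p d x -> 'D_(dir i3) u x = Q (T x).
    by move=> xb; rewrite (@derive_val _ _ _ _ _ _ _ (us x xb)).
  pose W x : R := ('D_(dir i2) u x : R) - P (T x).
  pose A x : R := 'D_(dir i1) Q (T x).
  (* By [PQ], the error [W] in the second equation satisfies a linear homogeneous
     equation along the third axis, and it vanishes initially. *)
  have WA x : box p d x -> is_derive x (dir i3) W (A x * W x).
    move=> xb.
    have h1 : is_derive x (dir i3) ('D_(dir i2) u) ('D_(dir i3) ('D_(dir i2) u) x).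
      apply: derivableP; apply: diff_derivable.
      exact: (Ck_on_differentiable (Ck_fun_derive _ (uC 2))).
    have h2 : is_derive x (dir i3) (fun x => P (T x)) ('D_(dir i3) (fun x => P (T x)) x).
      apply: derivableP; apply: diff_derivable.
      apply: (differentiable_comp (f := T)); last exact: dP.
      exact/differentiable_shear/duu.
    have := @is_deriveB _ _ _ _ _ _ _ _ _ h1 h2.
    rewrite (derive_swap _ _ oB xb (uC 2)).
    rewrite (near_eq_derive (g := fun y => Q (T y))); last first.
      by apply: filterS (near_box xb) => y; exact: D3u.
    have L (q2 p3 p1 a du2 pp qq : R) : q2 + pp * a = p3 + qq * p1 ->
      q2 + du2 * a - (p3 + qq * p1) = a * (du2 - pp) by move=> <-; ring.
    have i21 : i2 != i1 by rewrite eq_sym.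
    have i31 : i3 != i1 by rewrite eq_sym.
    rewrite (derive_comp_shear i21 (duu x xb) (dQ x xb)).
    rewrite (derive_comp_shear i31 (duu x xb) (dP x xb)) D3u//.
    have := PQ (UT x xb); rewrite -/(T x) -/(A x) => PQx.
    congr is_derive; rewrite /W; move: PQx; rewrite -/(A x).
    move: ('D_(dir i2) Q (T x)) ('D_(dir i3) P (T x)) ('D_(dir i1) P (T x)) (A x)
      ('D_(dir i2) u x) (P (T x)) (Q (T x)) => q2 p3 p1 a du2 pp qq E.
    exact: L.
  move=> x xb; apply/eqP; rewrite -subr_eq0; apply/eqP.
  have := @linear_ode_zero R (fun t => A (upd x i3 t)) (fun t => W (upd x i3 t)) (p 0 i3) d
    _ _ _ (x 0 i3) (box_time i3 xb).
  rewrite upd_self; apply.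
  + move=> t td; apply: (@continuous_comp _ _ _ (fun s => upd x i3 s) A).
      apply: (@continuous_comp2 _ _ _ _ (fun y s => upd y i3 s) (fun=> x) id).
      * exact: cvg_cst.
      * exact: cvg_id.
      * exact: continuous_upd.
    apply: (@continuous_comp _ _ _ T ('D_(dir i1) Q)).
      apply: differentiable_continuous; exact/differentiable_shear/duu/box_upd.
    by apply: (Ck_on0 (Ck_fun_derive _ (QC 1))); exact/UT/box_upd.
  + by move=> t td; apply/is_derive_upd/WA/box_upd.
  + have xb0 : box p d (upd x i3 (p 0 i3)) by apply: box_upd => //; rewrite subrr normr0.
    have x30 : upd x i3 (p 0 i3) 0 i3 = p 0 i3 by rewrite updE eqxx.
    have [[_ x1b] _] := uU _ xb0.
    rewrite /W (derive_initial i23 ug xb0 x30); last first.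
      by apply: diff_derivable; exact: smooth_differentiable u1C x1b.
    by rewrite (@derive_val _ _ _ _ _ _ _ (u1s _ x1b)) /T ug// subrr.
- split; first by rewrite ug.
  rewrite (derive_initial i13 ug pb erefl); last first.
    by apply: diff_derivable; exact: smooth_differentiable u1C p1b.
  rewrite (derive_initial i12 u1g p1b erefl) ?derive_dir_coord ?eqxx//.
  by apply: diff_derivable; exact: differentiable_coord.
Qed.

Definition plane_field (y : 'rV[R]_3) : 'rV[R]_3 := dir i2 + P y *: dir i1.

Definition line_field (y : 'rV[R]_3) : 'rV[R]_3 :=
  dir i3 + Q y *: dir i1 + b y *: plane_field y.

(** [f] is the first shear after the second after the third. The differentials of the inner shears
    are expanded along the coordinate axes, and the differential of the first one sends axes 2 and 3
    to [m] and [n]. *)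
Theorem straighten : exists V f g,
  [/\ local_diffeo V f g, V p, f p = p, forall x, V x -> U (f x) &
   forall x, V x -> exists c1 c1' c1'' c2 c2' c3 : R,
    [/\ 'D_(dir i1) f x = c1 *: dir i1 + c1' *: plane_field (f x) + c1'' *: line_field (f x),
        'D_(dir i2) f x = c2 *: plane_field (f x) + c2' *: line_field (f x),
        'D_(dir i3) f x = c3 *: line_field (f x) & c1 * c2 * c3 * om (f x) = 1]].
Proof.
have i21 : i2 != i1 by rewrite eq_sym.
have i31 : i3 != i1 by rewrite eq_sym.
have i32 : i3 != i2 by rewrite eq_sym.
have oB d : open (box p d) by exact: open_box.
have [d [u [d0 uC uU us [up u1p]]]] := leaf_function.
have u1p0 : 'D_(dir i1) u p != 0 by rewrite u1p oner_neq0.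
have [r3 [g3 [r30 r3d r3n r3D]]] := shear_diffeo (oB d) (box_center p d0) uC u1p0.
pose T x := upd x i1 (u x).
have uC3 : smooth_fun (box p r3) u by move=> k; exact: Ck_on_sub (uC k).
have TC3 : smooth_on (box p r3) T by exact: smooth_shear.
have TU x : box p r3 x -> U (T x) by move=> /r3d/uU.
have comp3 (h : 'rV[R]_3 -> R) : smooth_fun U h -> smooth_fun (box p r3) (fun x => h (T x)).
  by move=> hC k; exact: (Ck_fun_comp (oB r3) TU (hC k) (TC3 k)).
have x2C : smooth_fun (box p r3) (fun x => x 0 i2) by move=> k; exact: Ck_fun_proj.
(* The slope [b] is read through [T], in coordinates where D is already straight: the second shear
   sends axis 3 to axis 3 plus [b] times axis 2, and [T] sends this to [l]. *)
have [d4 [u3 [d40 u3C u3b u3s u3g]]] :=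
  flow_exists i3 (oB r3) (box_center p r30) (comp3 _ bC) x2C erefl.
have pb4 := box_center p d40.
have u3p : u3 p = p 0 i2 by rewrite u3g.
have u3p0 : 'D_(dir i2) u3 p != 0.
  rewrite (derive_initial i23 u3g pb4 erefl); last first.
    by apply: diff_derivable; exact: differentiable_coord.
  by rewrite derive_dir_coord eqxx oner_neq0.
have [r4 [g4 [r40 r4d r4n r4D]]] := shear_diffeo (oB d4) pb4 u3C u3p0.
pose S3 x := upd x i2 (u3 x).
have u3C4 : smooth_fun (box p r4) u3 by move=> k; exact: Ck_on_sub (u3C k).
have S3C4 : smooth_on (box p r4) S3 by exact: smooth_shear.
have S3b x : box p r4 x -> box p r3 (S3 x) by move=> /r4d/u3b[].
(* The volume of the coordinate frame after two shears, up to evaluation at [S3 x]: the two diagonal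
   entries times [om]. *)
pose rho x : R := ('D_(dir i1) u (S3 x) : R) * ('D_(dir i2) u3 x : R) * om (T (S3 x)).
have rho0 x : box p r4 x -> rho x != 0.
  move=> xb; rewrite !mulf_neq0//; [exact/r3n/S3b|exact: r4n|].
  exact/om0/TU/S3b.
have comp4 (h : 'rV[R]_3 -> R) : smooth_fun (box p r3) h -> smooth_fun (box p r4) (fun x => h (S3 x)).
  by move=> hC k; exact: (Ck_fun_comp (oB r4) S3b (hC k) (S3C4 k)).
have rhoC : smooth_fun (box p r4) rho.
  move=> k; apply: Ck_funM => //; last exact: (comp4 _ (comp3 _ omC)).
  apply: Ck_funM => //; last exact: Ck_fun_derive (u3C4 k.+1).
  by apply: (comp4 ('D_(dir i1) u)) => l; exact: Ck_fun_derive (uC3 l.+1).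
have rhoVC : smooth_fun (box p r4) (fun x => (rho x)^-1).
  by move=> k; exact: Ck_funV.
have cC : smooth_fun (box p r4) (fun=> p 0 i3) by move=> k; exact: Ck_fun_cst.
(* Here time and state are the same coordinate, so the equation is autonomous along axis 3. A
   constant initial value suffices, since its derivative [1 / rho] does not vanish. *)
have [d5 [u5 [d50 u5C u5b u5s u5g]]] :=
  flow_exists i3 (oB r4) (box_center p r40) rhoVC cC erefl.
have pb5 := box_center p d50.
have u5p : u5 p = p 0 i3 by rewrite u5g.
have u5D x : box p d5 x -> 'D_(dir i3) u5 x = (rho (upd x i3 (u5 x)))^-1.
  by move=> xb; rewrite (@derive_val _ _ _ _ _ _ _ (u5s x xb)).
have u5p0 : 'D_(dir i3) u5 p != 0.
  by rewrite u5D// invr_neq0// u5p upd_self rho0//; exact: box_center.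
have [r5 [g5 [r50 r5d r5n r5D]]] := shear_diffeo (oB d5) pb5 u5C u5p0.
pose S5 x := upd x i3 (u5 x).
have := local_diffeo_comp (local_diffeo_comp r5D r4D) r3D.
rewrite -/T -/S3 -/S5; set V := [set x | _]; set f := _ \o _; set g := (_ \o g3) => fD.
have S5p : S5 p = p by rewrite /S5 u5p upd_self.
have S3p : S3 p = p by rewrite /S3 u3p upd_self.
have Tp : T p = p by rewrite /T up upd_self.
have VE x : V x -> [/\ box p r5 x, box p r4 (S5 x) & box p r3 (S3 (S5 x))].
  by move=> [[]].
exists V, f, g; split=> //.
- split=> /=; last by rewrite S5p S3p; exact: box_center.
  by split; [|rewrite -/(S5 p) S5p]; exact: box_center.
- by rewrite /f /= S5p S3p.
- by move=> x /VE[_ _ xb]; exact: TU.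
move=> x /VE[x5 x4 x3].
have [y5 y5E] : exists y, y = S5 x by eexists.
have [y3 y3E] : exists y, y = S3 y5 by eexists.
rewrite -y5E in x4 x3; rewrite -y3E in x3.
have fx : f x = T y3 by rewrite y3E y5E.
have du5 : differentiable (u5 : _ -> R^o) x by exact: smooth_differentiable u5C (r5d _ x5).
have du3 : differentiable (u3 : _ -> R^o) y5 by exact: smooth_differentiable u3C4 x4.
have du : differentiable (u : _ -> R^o) y3 by exact: smooth_differentiable uC3 x3.
have dS5 := differentiable_shear i3 du5.
have dS3 := differentiable_shear i2 du3.
have dT := differentiable_shear i1 du.
have [L3 L3d] := diff_linear_ex T y3.
have [L5 L5d] := diff_linear_ex S3 y5.
have L3D (a : R) v w : L3 (v + a *: w) = L3 v + a *: L3 w by rewrite linearD linearZ.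
have L5D (a : R) v w : L5 (v + a *: w) = L5 v + a *: L5 w by rewrite linearD linearZ.
have Df v : 'D_v f x = L3 (L5 ('D_v S5 x)).
  exact: (derive_comp3 v y5E y3E dS5 dS3 dT L5d L3d).
have L3E k : L3 (dir k) = (if k == i1 then 0 else dir k) + ('D_(dir k) u y3 : R) *: dir i1.
  rewrite -L3d; exact: diff_shear.
have L5E k : L5 (dir k) = (if k == i2 then 0 else dir k) + ('D_(dir k) u3 y5 : R) *: dir i2.
  rewrite -L5d; exact: diff_shear.
have [u_3 u_2] := us _ (r3d _ x3).
have L3_1 : L3 (dir i1) = ('D_(dir i1) u y3 : R) *: dir i1 by rewrite L3E eqxx add0r.
have L3_2 : L3 (dir i2) = plane_field (f x) by rewrite L3E (negPf i21) u_2 fx.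
have L3_3 : L3 (dir i3) = dir i3 + Q (f x) *: dir i1 by rewrite L3E (negPf i31) u_3 fx.
have u3_3 : 'D_(dir i3) u3 y5 = b (f x).
  by rewrite (@derive_val _ _ _ _ _ _ _ (u3s _ (r4d _ x4))) fx y3E.
have L_3 : L3 (L5 (dir i3)) = line_field (f x).
  by rewrite L5E (negPf i32) u3_3 L3D L3_3 L3_2.
have L_2 : L3 (L5 (dir i2)) = ('D_(dir i2) u3 y5 : R) *: plane_field (f x).
  by rewrite L5E eqxx L3D linear0 add0r L3_2.
have L_1 : L3 (L5 (dir i1)) = ('D_(dir i1) u y3 : R) *: dir i1 +
    ('D_(dir i1) u3 y5 : R) *: plane_field (f x).
  by rewrite L5E (negPf i12) L3D L3_1 L3_2.
exists ('D_(dir i1) u y3), ('D_(dir i1) u3 y5), ('D_(dir i1) u5 x),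
  ('D_(dir i2) u3 y5), ('D_(dir i2) u5 x), ('D_(dir i3) u5 x); split.
- by rewrite Df derive_shear// (negPf i13) L5D L3D L_1 L_3.
- by rewrite Df derive_shear// (negPf i23) L5D L3D L_2 L_3.
- by rewrite Df derive_shear// eqxx L5D L3D !linear0 add0r L_3.
- rewrite u5D; last exact: r5d.
  rewrite -/(S5 x) -y5E mulrAC y3E fx y3E -/(rho y5).
  by rewrite mulfV// rho0.
Qed.

End Straighten.

(** * Integrability and involutivity *)

Section BracketKernel.
Context {R : realType} {n : nat}.
Variables (W : set 'rV[R]_n) (h : 'rV[R]_n -> R).
Hypotheses (oW : open W) (hC : smooth_fun W h).

(** Differentiating [X h = 0] in direction [v] trades the derivative of [X] for the Hessian of [h],
    which is symmetric; in a bracket the two Hessian terms cancel. *)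
Lemma derive_along_kernel (X : 'rV[R]_n -> 'rV[R]_n) c v : smooth_on W X ->
  (forall q, W q -> 'D_(X q) h q = 0 :> R) -> W c ->
  'D_('D_v X c) h c = - \sum_k \sum_l X c 0 k * v 0 l * 'D_(dir l) ('D_(dir k) h) c :> R.
Proof.
move=> XC X0 Wc.
have dh q : W q -> differentiable (h : _ -> R^o) q by exact: smooth_differentiable.
have dhk k q : W q -> differentiable ('D_(dir k) h : _ -> R^o) q.
  by apply: Ck_on_differentiable; exact: (Ck_fun_derive _ (hC 2)).
have dX := smooth_differentiable XC Wc.
have dXk k : differentiable (fun q => X q 0 k : R^o) c.
  exact: (Ck_on_differentiable (Ck_on_coord k oW (XC 1)) Wc).
pose F k q : R := X q 0 k * ('D_(dir k) h q : R).
have FE q : W q -> 'D_(X q) h q = \sum_k F k q :> R.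
  by move=> Wq; rewrite (derive_sum_dir (W := R^o))//; exact: dh.
have dF k : is_derive c v (F k)
    (X c 0 k * ('D_v ('D_(dir k) h) c : R) + ('D_(dir k) h c : R) * ('D_v X c) 0 k).
  rewrite -derive_coord//.
  have H1 : is_derive c v (fun q => X q 0 k) ('D_v (fun q => X q 0 k : R^o) c).
    by apply: derivableP; exact: diff_derivable.
  have H2 : is_derive c v ('D_(dir k) h) ('D_v ('D_(dir k) h) c).
    by apply: derivableP; apply: diff_derivable; exact: dhk.
  exact: (@is_deriveM _ _ _ _ _ _ _ _ H1 H2).
have D0 : 'D_v (fun q => \sum_k F k q) c = 0 :> R.
  rewrite (near_eq_derive (g := fun=> 0 : R)); first by rewrite derive_cst.
  by apply: (near_open oW Wc) => q Wq; rewrite -FE// X0.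
move: D0; have -> : (fun q => \sum_k F k q) = \sum_k F k by apply/funext => q; rewrite fct_sumE.
rewrite derive_sum => [|k]; last exact: (@ex_derive _ _ _ _ _ _ _ (dF k)).
under eq_bigr => k _ do rewrite (@derive_val _ _ _ _ _ _ _ (dF k)).
rewrite big_split /= => /eqP; rewrite addrC addr_eq0 => /eqP E.
rewrite (derive_sum_dir (W := R^o)); last exact: dh.
transitivity (\sum_k ('D_(dir k) h c : R) * ('D_v X c) 0 k).
  by apply: eq_bigr => k _; exact: mulrC.
rewrite E; congr (- _); apply: eq_bigr => k _.
rewrite (derive_sum_dir (W := R^o)); last exact: dhk.
rewrite mulr_sumr; apply: eq_bigr => l _.
by rewrite -mulrA.
Qed.

Lemma derive_bracket_kernel (X Y : 'rV[R]_n -> 'rV[R]_n) c : smooth_on W X ->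
  smooth_on W Y -> (forall q, W q -> 'D_(X q) h q = 0 :> R) ->
  (forall q, W q -> 'D_(Y q) h q = 0 :> R) -> W c ->
  'D_('D_(X c) Y c - 'D_(Y c) X c) h c = 0 :> R.
Proof.
move=> XC YC X0 Y0 Wc.
have dh : differentiable (h : _ -> R^o) c by exact: smooth_differentiable Wc.
rewrite (deriveE _ dh) linearB -!(deriveE _ dh).
rewrite [X in X - _](derive_along_kernel _ YC Y0 Wc).
rewrite [X in _ - X](derive_along_kernel _ XC X0 Wc).
apply/eqP; rewrite opprK addrC subr_eq0; apply/eqP; rewrite exchange_big.
apply: eq_bigr => l _; apply: eq_bigr => k _.
by rewrite (derive_swap _ _ oW Wc (hC 2)) [X c 0 _ * _]mulrC.
Qed.

End BracketKernel.

(** * Linear algebra in dimension three *)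

Section LinearAlgebra.
Context {R : realType}.

Lemma span2P (V : vectType R) (a b v : V) :
  reflect (exists s t : R, v = s *: a + t *: b) (v \in <<[:: a; b]>>%VS).
Proof.
rewrite span_cons span_seq1; apply: (iffP memv_addP).
  by move=> [_ /vlineP[s ->] [_ /vlineP[t ->] ->]]; exists s, t.
move=> [s [t ->]]; exists (s *: a); first by rewrite memvZ// memv_line.
by exists (t *: b) => //; rewrite memvZ// memv_line.
Qed.

Lemma free2_eq0 (V : vectType R) (a b : V) (s t : R) : free [:: a; b] ->
  s *: a + t *: b = 0 -> s = 0 /\ t = 0.
Proof.
rewrite free_cons span_seq1 seq1_free => /andP[ab b0] E.
have s0 : s = 0.
  apply/eqP; apply: contraNT ab => s0; apply/vlineP; exists (- (t / s)).
  move/eqP: E; rewrite addr_eq0 => /eqP E.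
  by rewrite -[a]scale1r -(mulVf s0) -scalerA E scalerN scaleNr scalerA mulrC.
move: E; rewrite s0 scale0r add0r => /eqP; rewrite scaler_eq0 (negPf b0) orbF.
by move=> /eqP.
Qed.

Lemma free3_span (a b c v : 'rV[R]_3) : free [:: a; b; c] ->
  exists r s t : R, v = r *: a + s *: b + t *: c.
Proof.
move=> fr; have : v \in <<[:: a; b; c]>>%VS.
  have -> : <<[:: a; b; c]>>%VS = fullv; last exact: memvf.
  apply/eqP; rewrite eqEdim subvf dimvf /dim /= mul1n.
  by move: fr; rewrite /free => /eqP ->.
rewrite span_cons => /memv_addP[_ /vlineP[r ->] [w /span2P[s [t ->]] ->]].
by exists r, s, t; rewrite addrA.
Qed.

Lemma kernel_span (f : {linear 'rV[R]_3 -> R^o}) (a b c v : 'rV[R]_3) :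
  free [:: a; b; c] -> f a = 1 -> f b = 0 -> f c = 0 ->
  (v \in <<[:: b; c]>>%VS) = (f v == 0).
Proof.
move=> fr fa fb fc; apply/span2P/eqP => [[s [t ->]]|].
  by rewrite linearD !linearZ_LR fb fc !scaler0 addr0.
have [r [s [t ->]]] := free3_span v fr.
rewrite !linearD !linearZ_LR fa fb fc !scaler0 !addr0 [_ *: _]mulr1 => ->.
by exists s, t; rewrite scale0r add0r.
Qed.

End LinearAlgebra.

Section Indices.
Implicit Types i j k : 'I_3.

Lemma ord3_cases (i1 i2 i3 k : 'I_3) : i1 != i2 -> i1 != i3 -> i2 != i3 ->
  [\/ k = i1, k = i2 | k = i3].
Proof.
move=> i12 i13 i23; have [->|k1] := eqVneq k i1; first by constructor 1.
have [->|k2] := eqVneq k i2; first by constructor 2.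
have [->|k3] := eqVneq k i3; first by constructor 3.
have : uniq [:: k; i1; i2; i3] by rewrite /= !inE !negb_or k1 k2 k3 i12 i13 i23.
move=> /uniq_leq_size/(_ (fun x _ => mem_enum 'I_3 x)).
by rewrite size_enum_ord.
Qed.

Lemma third_index (i2 i3 : 'I_3) : exists2 i1, i1 != i2 & i1 != i3.
Proof.
have : (0 < #|~: [set i2; i3]|)%N.
  by rewrite cardsCs finset.setCK card_ord subn_gt0 cards2; case: (_ != _).
by move=> /card_gt0P[i1]; rewrite !inE negb_or => /andP[? ?]; exists i1.
Qed.

Lemma rV3_decomp (R : realType) i1 i2 i3 (v : 'rV[R]_3) :
  i1 != i2 -> i1 != i3 -> i2 != i3 ->
  v = v 0 i1 *: dir i1 + v 0 i2 *: dir i2 + v 0 i3 *: dir i3.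
Proof.
move=> i12 i13 i23; apply/rowP => k; rewrite !mxE !eqxx /=.
have i21 : i2 == i1 = false by rewrite eq_sym (negPf i12).
have i31 : i3 == i1 = false by rewrite eq_sym (negPf i13).
have i32 : i3 == i2 = false by rewrite eq_sym (negPf i23).
by case: (ord3_cases k i12 i13 i23) => ->;
  rewrite !(eqxx, negPf i12, negPf i13, negPf i23, i21, i31, i32) !mulr0 mulr1
    ?addr0 ?add0r.
Qed.

Lemma rV3_eq (R : realType) i1 i2 i3 (v w : 'rV[R]_3) :
  i1 != i2 -> i1 != i3 -> i2 != i3 ->
  v 0 i1 = w 0 i1 -> v 0 i2 = w 0 i2 -> v 0 i3 = w 0 i3 -> v = w.
Proof.
by move=> i12 i13 i23 E1 E2 E3; apply/rowP => k; case: (ord3_cases k i12 i13 i23) => ->.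
Qed.

End Indices.

Section Fields.
Context {R : realType}.
Variables (i1 i2 i3 : 'I_3).
Hypotheses (i12 : i1 != i2) (i13 : i1 != i3) (i23 : i2 != i3).

Lemma dir_coord (i k : 'I_3) : (dir i : 'rV[R]_3) 0 k = (k == i)%:R.
Proof. by rewrite mxE eqxx. Qed.

Lemma plane_field_coord (P : 'rV[R]_3 -> R) y : let m := plane_field i1 i2 P y in
  [/\ m 0 i1 = P y, m 0 i2 = 1 & m 0 i3 = 0].
Proof.
by split; rewrite mxE dir_coord mxE dir_coord
  ?(eq_sym i3 i1) ?(eq_sym i3 i2) ?(eq_sym i2 i1) ?(negPf i12) ?(negPf i13) ?(negPf i23) ?eqxx
  ?mulr0 ?mulr1 ?addr0 ?add0r.
Qed.

Lemma line_field_coord (P Q b : 'rV[R]_3 -> R) y : let l := line_field i1 i2 i3 P Q b y in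
  [/\ l 0 i1 = Q y + b y * P y, l 0 i2 = b y & l 0 i3 = 1].
Proof.
have [m1 m2 m3] := plane_field_coord P y.
have C k : line_field i1 i2 i3 P Q b y 0 k =
    (k == i3)%:R + Q y * (k == i1)%:R + b y * plane_field i1 i2 P y 0 k.
  by rewrite /line_field; move: (plane_field _ _ _ _) => m; rewrite !mxE !eqxx.
by split; rewrite C ?m1 ?m2 ?m3
  ?(eq_sym i3 i1) ?(eq_sym i3 i2) ?(eq_sym i2 i1) ?(negPf i12) ?(negPf i13) ?(negPf i23) ?eqxx
  ?mulr0 ?mulr1 ?addr0 ?add0r.
Qed.

End Fields.

(** * From integrability to involutivity; fields adapted to L and D *)

Section Charts.
Context {R : realType} {B : body R}.
Local Notation chart := (@chart R B).
Local Notation chart_inv := (@chart_inv R B).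

Lemma chart_image_inv (V : set B) q : (chart @` V) q -> V (chart_inv q) /\ chart (chart_inv q) = q.
Proof. by move=> [x Vx <-]; rewrite chartK. Qed.

Lemma open_chart_image (V : set B) : open V -> open (chart @` V).
Proof. exact: chart_open. Qed.

Theorem integrable_involutive (L : tangent_distribution B 1)
    (D : tangent_distribution B 2) (Omega : volume_form B) :
  integrable_structure (G1A_structure L D Omega) -> involutive_distribution D.
Proof.
move=> int V X Y oV XC YC XD YD p Vp.
have [V' [y [z [[oV' oyV' zy yC zC] V'p frame]]]] := int p.
pose W := chart @` (V `&` V').
have oW : open W by apply: open_chart_image; exact: openI.
have Wp : W (chart p) by exists p.
pose h c : R := y (chart_inv c) 0 0.
have oW' : open (chart @` V') by exact: open_chart_image.
have hC' : smooth_fun (chart @` V') h.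
  by move=> k; exact: (Ck_on_coord (f := y \o chart_inv) 0 oW' (yC k)).
have hC : smooth_fun W h.
  by move=> k; apply: Ck_on_sub (hC' k) => _ [x [_ V'x] <-]; exists x.
pose phi := chart \o z.
have dphi x : V' x -> differentiable phi (y x).
  by move=> V'x; apply: (smooth_differentiable zC); exists x.
have phiE x : V' x -> phi (y x) = chart x by move=> V'x; rewrite /phi /= zy.
(* In the coordinates [y] the function [h] is the first coordinate, so the chain rule for [h \o phi]
   gives its derivative along the frame. *)
have Dh x k : V' x -> 'D_(coordinate_vector y z k x) h (chart x) = (0 == k)%:R :> R.
  move=> V'x; rewrite -(derive_dir_coord (y x) 0 k).
  have dh : differentiable (h : _ -> R^o) (phi (y x)).
    by rewrite phiE//; apply: (smooth_differentiable hC'); exists x.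
  have -> : 'D_(coordinate_vector y z k x) h (chart x) = 'D_(dir k) (h \o phi) (y x).
    by rewrite (derive_comp (W := R^o) _ dh (dphi x V'x)) phiE.
  apply: near_eq_derive; apply: (near_open oyV'); first by exists x.
  by move=> _ [x' V'x' <-]; rewrite /h /= phiE// chartK.
have Dker x v : V' x -> (v \in D x) = ('D_v h (chart x) == 0 :> R).
  move=> V'x; have [fr _ <- _] := frame x V'x.
  have dh : differentiable (h : _ -> R^o) (chart x).
    by apply: (smooth_differentiable hC'); exists x.
  have [Lh LhE] := diff_linear_ex (h : _ -> R^o) (chart x).
  have LE k : Lh (coordinate_vector y z k x) = (0 == k)%:R.
    by rewrite -LhE -deriveE// Dh.
  by rewrite (kernel_span v fr (LE 0) (LE 1) (LE 2)) -LhE -deriveE.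
have XC' : smooth_on W (X \o chart_inv).
  by move=> k; apply: Ck_on_sub (XC k) => _ [x [Vx _] <-]; exists x.
have YC' : smooth_on W (Y \o chart_inv).
  by move=> k; apply: Ck_on_sub (YC k) => _ [x [Vx _] <-]; exists x.
have ker (Z : B -> 'rV[R]_3) : (forall p, V p -> Z p \in D p) ->
    forall q, W q -> 'D_((Z \o chart_inv) q) h q = 0 :> R.
  move=> ZD _ [x [Vx V'x] <-]; rewrite /= chartK; apply/eqP.
  by rewrite -Dker//; exact: ZD.
rewrite Dker// /lie_bracket /deriv_along.
have := derive_bracket_kernel oW hC XC' YC' (ker X XD) (ker Y YD) Wp.
by rewrite /= !chartK => ->.
Qed.

Lemma open_neq0 : open [set t : R^o | t != 0].
Proof.
rewrite openE => t /= t0; apply: (near_normP (V := R^o) (fun t => t != 0) t).2.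
exists `|t|; first by rewrite normr_gt0.
by move=> s; apply: contraTneq => ->; rewrite sub0r normrN ltxx.
Qed.

Lemma distribution_span2 (D : tangent_distribution B 2) x : exists V (X0 X1 : B -> 'rV[R]_3),
  [/\ open V, V x, smooth_in V X0, smooth_in V X1 &
   forall p, V p -> D p = <<[:: X0 p; X1 p]>>%VS].
Proof.
have [V [X [oV Vx XC DX]]] := distr_smooth D x.
exists V, (X 0), (X 1); split=> // p Vp.
by rewrite DX// big_ord_recl big_ord1 span_cons span_seq1; congr (_ + <[X _ p]>)%VS; apply: val_inj.
Qed.

(** D is a graph over the axes [i2] and [i3] wherever the corresponding minor of a local frame is
    nonzero, and L can then be normalised by its component [i3]. *)
Lemma adapted_fields (L : tangent_distribution B 1) (D : tangent_distribution B 2) (x0 : B) :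
  (forall x : B, (L x <= D x)%VS) ->
  exists (i1 i2 i3 : 'I_3) U (P Q b : 'rV[R]_3 -> R),
  [/\ [/\ i1 != i2, i1 != i3 & i2 != i3],
    [/\ open U, U (chart x0) & U `<=` range chart],
    [/\ smooth_fun U P, smooth_fun U Q & smooth_fun U b],
    forall x v, U (chart x) ->
      (v \in D x) = (v 0 i1 == P (chart x) * v 0 i2 + Q (chart x) * v 0 i3) &
    forall x, U (chart x) -> L x = <[line_field i1 i2 i3 P Q b (chart x)]>%VS].
Proof.
move=> LD; have [V [X0 [X1 [oV Vx0 X0C X1C DX]]]] := distribution_span2 D x0.
have [V' [l' [oV' V'x0 lC' Ll']]] := distr_smooth L x0.
pose l := l' 0.
have Ll p : V' p -> L p = <[l p]>%VS by move=> /Ll' ->; rewrite big_ord1.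
have lC : smooth_in V' l by exact: lC'.
have l0 p : V' p -> l p != 0.
  move=> V'p; have := distr_dim L p; rewrite Ll// dim_vline.
  by case: eqP.
have lD p : V p -> V' p -> exists s t : R, l p = s *: X0 p + t *: X1 p.
  move=> Vp V'p; apply/span2P; rewrite -DX//; apply: (subvP (LD p)).
  by rewrite Ll// memv_line.
have Xfree p : V p -> free [:: X0 p; X1 p].
  by move=> Vp; rewrite /free -DX// distr_dim.
have /rV0Pn[i3 l3] := l0 _ V'x0.
(* This vector of D has component 0 along [i3]. If it were zero, D would have no [i3] component at
   [x0], contrary to the choice of [i3] by means of [l]. *)
have D0 : X1 x0 0 i3 *: X0 x0 + (- X0 x0 0 i3) *: X1 x0 != 0.
  apply/eqP => /(free2_eq0 (Xfree _ Vx0))[X13 /eqP]; rewrite oppr_eq0 => /eqP X03.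
  have [s [t El]] := lD _ Vx0 V'x0.
  by move: l3; rewrite El !mxE X03 X13 !mulr0 addr0 eqxx.
have /rV0Pn[i2 i2P] := D0.
have i23 : i2 != i3.
  by apply: contraNneq i2P => ->; rewrite !mxE mulNr [X in _ - X]mulrC subrr.
have [i1 i12 i13] := third_index i2 i3.
pose U0 := chart @` (V `&` V').
have oU0 : open U0 by apply: open_chart_image; exact: openI.
have cC (A : set B) (X : B -> 'rV[R]_3) k : V `&` V' `<=` A -> smooth_in A X ->
    smooth_fun U0 (fun q => X (chart_inv q) 0 k).
  move=> VA XC l'' ; apply: (Ck_on_coord (f := X \o chart_inv)) => //.
  by apply: Ck_on_sub (XC l'') => _ [x VV'x <-]; exists x => //; exact: VA.
have X0k k : smooth_fun U0 (fun q => X0 (chart_inv q) 0 k) by apply: cC X0C => x [].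
have X1k k : smooth_fun U0 (fun q => X1 (chart_inv q) 0 k) by apply: cC X1C => x [].
have lk k : smooth_fun U0 (fun q => l (chart_inv q) 0 k) by apply: cC lC => x [].
pose minor j k q : R := X0 (chart_inv q) 0 j * X1 (chart_inv q) 0 k -
  X0 (chart_inv q) 0 k * X1 (chart_inv q) 0 j.
have minorC j k : smooth_fun U0 (minor j k).
  move=> n; apply: (Ck_funB oU0).
    by apply: (Ck_funM oU0); [exact: X0k|exact: X1k].
  by apply: (Ck_funM oU0); [exact: X0k|exact: X1k].
(* A single function whose nonvanishing keeps both the minor and the [i3] component of [l]
   invertible. *)
pose kap q := minor i2 i3 q * l (chart_inv q) 0 i3.
have kapC : smooth_fun U0 kap.
  by move=> n; apply: (Ck_funM oU0); [exact: minorC|exact: lk].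
pose U := [set q | U0 q /\ [set t : R^o | t != 0] (kap q)].
have oU : open U.
  exact: (open_preimage_on (W := R^o) oU0 open_neq0 (Ck_on0 (kapC 0))).
have UU0 : U `<=` U0 by move=> q [].
have Uminor q : U q -> minor i2 i3 q != 0.
  by move=> [_ /=]; rewrite /kap mulf_eq0 negb_or => /andP[].
have Ul q : U q -> l (chart_inv q) 0 i3 != 0.
  by move=> [_ /=]; rewrite /kap mulf_eq0 negb_or => /andP[].
have subC h : smooth_fun U0 h -> smooth_fun U h.
  by move=> hC k; exact: Ck_on_sub (hC k).
(* [P] and [Q] come from Cramer's rule; [b] is the [i2] component of [l] once its [i3] component is
   1. *)
pose P q := minor i1 i3 q / minor i2 i3 q.
pose Q q := minor i2 i1 q / minor i2 i3 q.
pose b q := l (chart_inv q) 0 i2 / l (chart_inv q) 0 i3.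
have UV x : U (chart x) -> V x /\ V' x.
  by move=> /UU0 /chart_image_inv[]; rewrite chartK.
have Dmem x v : U (chart x) ->
    (v \in D x) = (v 0 i1 == P (chart x) * v 0 i2 + Q (chart x) * v 0 i3).
  move=> Ux; have [Vx V'x] := UV x Ux; have := Uminor _ Ux.
  rewrite /P /Q /minor chartK DX// => m0.
  apply/span2P/eqP => [[s [t ->]]|E].
    by rewrite !mxE; field.
  exists ((v 0 i2 * X1 x 0 i3 - v 0 i3 * X1 x 0 i2) /
      (X0 x 0 i2 * X1 x 0 i3 - X0 x 0 i3 * X1 x 0 i2)),
    ((X0 x 0 i2 * v 0 i3 - X0 x 0 i3 * v 0 i2) /
      (X0 x 0 i2 * X1 x 0 i3 - X0 x 0 i3 * X1 x 0 i2)).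
  apply: (rV3_eq i12 i13 i23); rewrite !mxE; last 2 first.
  - by field.
  - by field.
  by rewrite E; field.
exists i1, i2, i3, U, P, Q, b; split=> //.
- split=> //; last by move=> q /UU0[x _ <-]; exists x.
  split; first by exists x0.
  rewrite /= /kap mulf_neq0 ?chartK// /minor chartK.
  by move: i2P; rewrite !mxE mulNr [X1 x0 0 i3 * _]mulrC.
- have VC (h1 h2 : 'rV[R]_3 -> R) : smooth_fun U0 h1 -> smooth_fun U0 h2 ->
      (forall q, U q -> h2 q != 0) -> smooth_fun U (fun q => h1 q / h2 q).
    by move=> h1C h2C h20 n; apply: (Ck_funM oU); [exact: subC|
      apply: (Ck_funV oU) => //; exact: subC].
  by split; apply: VC.
- move=> x Ux; have [Vx V'x] := UV x Ux.
  have := Ul _ Ux; rewrite chartK => l30.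
  have : l x \in D x by apply: (subvP (LD x)); rewrite Ll// memv_line.
  rewrite Dmem// => /eqP l1.
  have lE : l x = l x 0 i3 *: line_field i1 i2 i3 P Q b (chart x).
    have [e1 e2 e3] := line_field_coord i12 i13 i23 P Q b (chart x).
    apply: (rV3_eq i12 i13 i23); rewrite [RHS]mxE ?e1 ?e2 ?e3 ?mulr1//.
      by rewrite l1 /b chartK; field.
    by rewrite /b chartK; field.
  rewrite Ll// lE; apply/eqP; rewrite eqEsubv -!memvE memvZ ?memv_line//=.
  by rewrite -[X in X \in _](scalerK l30) memvZ// memv_line.
Qed.

End Charts.

(** * Alternating trilinear forms *)

Section LinearForms.
Context {R : realType}.

Lemma linear_form (V : lmodType R) (f : V -> R^o) : linear f ->
  (forall u v, f (u + v) = f u + f v :> R) /\ (forall a u, f (a *: u) = a * f u :> R).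
Proof.
move=> lf; have fD u v : f (u + v) = f u + f v by rewrite -[u in LHS]scale1r lf scale1r.
have f0 : f 0 = 0 by apply: (addrI (f 0)); rewrite -fD !addr0.
by split=> // a u; rewrite -[a *: u]addr0 lf f0 addr0.
Qed.

Lemma linear_form_eq0 (f : 'rV[R]_3 -> R^o) i1 i2 i3 v : linear f ->
  i1 != i2 -> i1 != i3 -> i2 != i3 ->
  f (dir i1) = 0 -> f (dir i2) = 0 -> f (dir i3) = 0 -> f v = 0.
Proof.
move=> /linear_form[fD fZ] i12 i13 i23 f1 f2 f3.
by rewrite (rV3_decomp v i12 i13 i23) !fD !fZ f1 f2 f3 !mulr0 !addr0.
Qed.

End LinearForms.

Section Volume.
Context {R : realType} {B : body R}.
Variables (Omega : volume_form B) (x : B).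
Implicit Types (u v w e m l : 'rV[R]_3) (c : R).

Lemma vol_swap12 u v w : Omega x u v w = - Omega x v u w.
Proof.
have [D1 _] := linear_form (vol_linear1 Omega x (u + v) w).
have [D2 _] := linear_form (vol_linear2 Omega x u w).
have [D3 _] := linear_form (vol_linear2 Omega x v w).
have := vol_alt12 Omega x (u + v) w.
by rewrite D1 D2 D3 !vol_alt12 add0r addr0 => /eqP; rewrite addr_eq0 => /eqP.
Qed.

Lemma vol_swap23 u v w : Omega x u v w = - Omega x u w v.
Proof.
have [D1 _] := linear_form (vol_linear2 Omega x u (v + w)).
have [D2 _] := linear_form (vol_linear3 Omega x u v).
have [D3 _] := linear_form (vol_linear3 Omega x u w).
have := vol_alt23 Omega x u (v + w).
by rewrite D1 D2 D3 !vol_alt23 add0r addr0 => /eqP; rewrite addr_eq0 => /eqP.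
Qed.

(** An alternating form that vanishes on one ordering of a basis vanishes on all triples of basis
    vectors, hence everywhere. *)
Lemma vol_dir_neq0 i1 i2 i3 : i1 != i2 -> i1 != i3 -> i2 != i3 ->
  Omega x (dir i1) (dir i2) (dir i3) != 0.
Proof.
move=> i12 i13 i23; apply/eqP => E.
have E' i j k : Omega x (dir i) (dir j) (dir k) = 0.
  case: (ord3_cases i i12 i13 i23) => ->; case: (ord3_cases j i12 i13 i23) => ->;
  case: (ord3_cases k i12 i13 i23) => ->; rewrite ?(vol_alt12, vol_alt13, vol_alt23)//.
  - by rewrite vol_swap23 E oppr0.
  - by rewrite vol_swap12 E oppr0.
  - by rewrite vol_swap23 vol_swap12 E !oppr0.
  - by rewrite vol_swap12 vol_swap23 E !oppr0.
  - by rewrite vol_swap12 vol_swap23 vol_swap12 E !oppr0.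
have [u [v [w]]] := vol_neq0 Omega x; apply/negP; rewrite negbK; apply/eqP.
apply: (linear_form_eq0 u (vol_linear1 Omega x v w) i12 i13 i23);
  apply: (linear_form_eq0 v (vol_linear2 Omega x _ w) i12 i13 i23);
  by apply: (linear_form_eq0 w (vol_linear3 Omega x _ _) i12 i13 i23).
Qed.

Lemma vol_triangular e m l c1 c1' c1'' c2 c2' c3 :
  Omega x (c1 *: e + c1' *: m + c1'' *: l) (c2 *: m + c2' *: l) (c3 *: l) =
  c1 * c2 * c3 * Omega x e m l.
Proof.
have [_ Z3] := linear_form (vol_linear3 Omega x (c1 *: e + c1' *: m + c1'' *: l)
  (c2 *: m + c2' *: l)).
have [D2 Z2] := linear_form (vol_linear2 Omega x (c1 *: e + c1' *: m + c1'' *: l) l).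
have [D1 Z1] := linear_form (vol_linear1 Omega x m l).
rewrite Z3 D2 !Z2 vol_alt23 mulr0 addr0 !D1 !Z1 vol_alt12 vol_alt13.
by rewrite !mulr0 !addr0; ring.
Qed.

Lemma vol_shear e1 e2 e3 P Q b : let m := e2 + P *: e1 in
  Omega x e1 m (e3 + Q *: e1 + b *: m) = Omega x e1 e2 e3.
Proof.
move=> m; have [D3 Z3] := linear_form (vol_linear3 Omega x e1 m).
have [D2 Z2] := linear_form (vol_linear2 Omega x e1 e3).
by rewrite !D3 !Z3 vol_alt13 vol_alt23 D2 Z2 vol_alt12 !mulr0 !addr0.
Qed.

Lemma vol_free u v w : Omega x u v w != 0 -> free [:: u; v; w].
Proof.
have [D1 Z1] := linear_form (vol_linear1 Omega x v w).
have [_ Z2] := linear_form (vol_linear2 Omega x u w).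
have [_ Z3] := linear_form (vol_linear3 Omega x u v).
move=> O0; rewrite !free_cons nil_free andbT span_seq1 span_nil memv0.
apply/and3P; split; apply: contraNN O0.
- by move=> /span2P[s [t ->]]; rewrite D1 !Z1 vol_alt12 vol_alt13 !mulr0 addr0.
- by move=> /vlineP[s ->]; rewrite Z2 vol_alt23 mulr0.
- by move=> /eqP ->; rewrite -(scale0r (0 : 'rV[R]_3)) Z3 mul0r.
Qed.

End Volume.

(** * From involutivity to integrability *)

Section Coordinates.
Context {R : realType} {B : body R}.
Local Notation chart := (@chart R B).
Local Notation chart_inv := (@chart_inv R B).

Lemma smooth_plane_field (U : set 'rV[R]_3) (i1 i2 : 'I_3) P : open U -> smooth_fun U P ->
  smooth_on U (plane_field i1 i2 P).
Proof.
move=> oU PC k; apply: (Ck_on_rV oU) => l.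
apply: (Ck_on_eq oU _ (Ck_funD oU (Ck_fun_cst k U (l == i2)%:R)
  (Ck_funM oU (PC k) (Ck_fun_cst k U (l == i1)%:R)))).
by move=> y _; rewrite !mxE !eqxx.
Qed.

Lemma derive_plane_field (i1 i2 : 'I_3) (P : 'rV[R]_3 -> R) q v :
  differentiable (P : _ -> R^o) q ->
  'D_v (plane_field i1 i2 P) q = ('D_v P q : R) *: dir i1.
Proof.
move=> dP; have dm : differentiable (plane_field i1 i2 P) q.
  by apply: differentiableD => //; exact: differentiableZl.
apply/rowP => l; rewrite -derive_coord// mxE dir_coord.
rewrite (_ : (fun y : 'rV[R]_3 => plane_field i1 i2 P y 0 l) =
    (fun y => (l == i2)%:R + P y * (l == i1)%:R)); last first.
  by apply/funext => y; rewrite !mxE !eqxx.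
have H0 (c : R) : is_derive q v (fun _ : 'rV[R]_3 => c) (0 : R) by exact: is_derive_cst.
have H1 : is_derive q v P ('D_v P q) by apply: derivableP; exact: diff_derivable.
have H : is_derive q v (fun y => (l == i2)%:R + P y * (l == i1)%:R)
    (0 + (P q * 0 + (l == i1)%:R * ('D_v P q : R))).
  exact: (@is_deriveD _ _ _ _ _ _ _ _ _ (H0 _) (@is_deriveM _ _ _ _ _ _ _ _ H1 (H0 _))).
by rewrite (@derive_val _ _ _ _ _ _ _ H) add0r mulr0 add0r; exact: mulrC.
Qed.

Lemma open_chart_preimage (U : set 'rV[R]_3) : open U -> open (chart @^-1` U).
Proof. by move=> oU; apply: open_comp => // x _; exact: chart_continuous. Qed.

(** The two spanning fields have constant components except along [i1], so their bracket is a
    multiple of [dir i1]; membership in D forces it to be 0. *)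
Lemma involutive_equation (D : tangent_distribution B 2) (i1 i2 i3 : 'I_3) U
    (P Q : 'rV[R]_3 -> R) : involutive_distribution D ->
  i1 != i2 -> i1 != i3 -> i2 != i3 -> open U -> U `<=` range chart ->
  smooth_fun U P -> smooth_fun U Q ->
  (forall x v, U (chart x) ->
    (v \in D x) = (v 0 i1 == P (chart x) * v 0 i2 + Q (chart x) * v 0 i3)) ->
  forall q, U q -> 'D_(dir i2) Q q + P q * 'D_(dir i1) Q q =
                   'D_(dir i3) P q + Q q * 'D_(dir i1) P q :> R.
Proof.
move=> inv i12 i13 i23 oU Ur PC QC DP q Uq.
have i32 : i3 != i2 by rewrite eq_sym.
pose V := chart @^-1` U.
have oV : open V by exact: open_chart_preimage.
have chartK' y : U y -> chart (chart_inv y) = y by move=> /Ur[x _ <-]; rewrite chartK.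
have oW : open (chart @` V) by exact: open_chart_image.
have fieldC i (F : 'rV[R]_3 -> R) : smooth_fun U F -> smooth_in V (plane_field i1 i F \o chart).
  move=> FC k; apply: (Ck_on_eq oW (f := plane_field i1 i F)).
    by move=> _ [x Vx <-] /=; rewrite chartK.
  by apply: Ck_on_sub (smooth_plane_field i1 i oU FC k) => _ [x Vx <-].
have XD x : V x -> (plane_field i1 i2 P \o chart) x \in D x.
  move=> Vx; rewrite DP//=.
  by have [-> -> ->] := plane_field_coord i12 i13 i23 P (chart x); rewrite mulr0 addr0 mulr1.
have YD x : V x -> (plane_field i1 i3 Q \o chart) x \in D x.
  move=> Vx; rewrite DP//=.
  by have [-> -> ->] := plane_field_coord i13 i12 i32 Q (chart x); rewrite mulr0 add0r mulr1.
have Vq : V (chart_inv q) by rewrite /V /preimage /= chartK'.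
have := inv V _ _ oV (fieldC i2 P PC) (fieldC i3 Q QC) XD YD _ Vq.
have dE i (F : 'rV[R]_3 -> R) v : smooth_fun U F ->
    'D_v (plane_field i1 i F \o chart \o chart_inv) q = ('D_v F q : R) *: dir i1.
  move=> FC; rewrite -(derive_plane_field i1 i v (smooth_differentiable FC Uq)).
  apply: near_eq_derive; apply: (near_open oU Uq) => y Uy.
  by rewrite /= chartK'.
rewrite DP ?chartK'// /lie_bracket /deriv_along /= chartK'// !dE// -scalerBl !mxE.
rewrite !(eq_sym _ i1) (negPf i12) (negPf i13) !eqxx !mulr0 mulr1 addr0 subr_eq0 => /eqP.
have dQ := smooth_differentiable QC Uq; have dP := smooth_differentiable PC Uq.
rewrite /plane_field -[dir i2 in X in X -> _]scale1r -[dir i3 in X in X -> _]scale1r.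
by rewrite (derive_lincomb (W := R^o) _ _ _ _ dQ) (derive_lincomb (W := R^o) _ _ _ _ dP) !scale1r.
Qed.

(** [f] serves as a parametrisation, so its partial derivatives are the coordinate vectors and its
    inverse gives the coordinates; the range condition makes [chart_inv] a true inverse of the chart
    on the image of [f]. *)
Lemma local_diffeo_coordinates (V : set 'rV[R]_3) f g : local_diffeo V f g ->
  f @` V `<=` range chart ->
  local_coordinates (chart @^-1` (f @` V)) (g \o chart) (chart_inv \o f) /\
  forall x k, V x ->
    coordinate_vector (g \o chart) (chart_inv \o f) k (chart_inv (f x)) = 'D_(dir k) f x.
Proof.
move=> [oV fC gf ofV gC] fr.
have fK x : V x -> chart (chart_inv (f x)) = f x.
  by move=> Vx; have [|b _ <-] := fr (f x); [exists x|rewrite chartK].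
have imE : chart @` (chart @^-1` (f @` V)) = f @` V.
  apply/seteqP; split=> [_ [b [x Vx bx] <-]|_ [x Vx <-]]; first by exists x.
  by exists (chart_inv (f x)); rewrite ?fK//=; exists x => //; rewrite fK.
have yE : (g \o chart) @` (chart @^-1` (f @` V)) = V.
  rewrite -image_comp imE; apply/seteqP; split=> [_ [_ [x Vx <-] <-]|x Vx]; first by rewrite gf.
  by exists (f x); [exists x|exact: gf].
split; last first.
  move=> x k Vx; rewrite /coordinate_vector /= fK// gf//.
  by apply: near_eq_derive; apply: (near_open oV Vx) => x' Vx' /=; exact: fK.
split; rewrite ?yE//.
- exact: open_chart_preimage.
- by move=> b [x Vx bx] /=; rewrite -bx gf// bx chartK.
- rewrite /smooth_in imE => k; apply: (Ck_on_eq ofV _ (gC k)) => _ [x Vx <-] /=.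
  by rewrite fK.
- by move=> k; apply: (Ck_on_eq oV _ (fC k)) => x Vx /=; rewrite fK.
Qed.

(** Restores the order 0, 1, 2 required of a coordinate frame, since [straighten] works with axes
    [i1, i2, i3] dictated by D and L. *)
Lemma permute_coordinates (s : 'I_3 -> 'I_3) : injective s ->
  exists Pm Pm' : {linear 'rV[R]_3 -> 'rV[R]_3},
  [/\ cancel Pm Pm', cancel Pm' Pm & forall k, Pm (dir k) = dir (s k)].
Proof.
move=> sI; exists (colsub (invF sI)), (colsub s); split=> [v|v|k].
- by apply/rowP => j; rewrite !mxE invF_f.
- by apply/rowP => j; rewrite !mxE f_invF.
- by apply/rowP => j; rewrite !mxE eqxx /= -(inj_eq sI) f_invF.
Qed.

Lemma derive_comp_linear (V W X : normedModType R) (g : {linear V -> W}) (f : W -> X) x v :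
  'D_v (f \o g) x = 'D_(g v) f (g x).
Proof.
rewrite /derive (_ : (fun h : R => h^-1 *: (f (h *: g v + g x) - f (g x))) =
  (fun h : R => h^-1 *: ((f \o g) (h *: v + x) - (f \o g) x)))//.
by apply/funext => h; rewrite /= linearP.
Qed.

(** Unit volume makes the three vectors free, so [c3] is nonzero and the last two, which lie in D,
    span it by dimension. *)
Lemma triangular_frame (L : tangent_distribution B 1) (D : tangent_distribution B 2)
    (Omega : volume_form B) x (e m l : 'rV[R]_3) (c1 c1' c1'' c2 c2' c3 : R) :
  L x = <[l]>%VS -> m \in D x -> l \in D x -> c1 * c2 * c3 * Omega x e m l = 1 ->
  G1A_structure L D Omega x
    (c1 *: e + c1' *: m + c1'' *: l, c2 *: m + c2' *: l, c3 *: l).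
Proof.
move=> Lx mD lD O1; have c30 : c3 != 0.
  by apply: contra_eqN O1 => /eqP ->; rewrite mulr0 mul0r eq_sym oner_neq0.
have O1' := O1; rewrite -(vol_triangular Omega x e m l c1 c1' c1'' c2 c2' c3) in O1'.
have fr : free [:: c1 *: e + c1' *: m + c1'' *: l; c2 *: m + c2' *: l; c3 *: l].
  by apply: (@vol_free _ _ Omega x); rewrite O1' oner_neq0.
split=> //.
- rewrite Lx; apply/eqP; rewrite eqEsubv -!memvE memvZ ?memv_line//=.
  by rewrite -[X in X \in _](scalerK c30) memvZ// memv_line.
- apply/eqP; rewrite eqEdim distr_dim; apply/andP; split.
    apply/span_subvP => v; rewrite !inE => /orP[|] /eqP ->; last exact: memvZ.
    by rewrite memvD// memvZ.
  by move: fr; rewrite free_cons => /andP[_]; rewrite /free => /eqP ->.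
Qed.

Theorem involutive_integrable (L : tangent_distribution B 1)
    (D : tangent_distribution B 2) (Omega : volume_form B) :
  (forall x : B, (L x <= D x)%VS) ->
  involutive_distribution D -> integrable_structure (G1A_structure L D Omega).
Proof.
move=> LD inv x0.
have [i1 [i2 [i3 [U [P [Q [b [[i12 i13 i23] [oU Up Ur] [PC QC bC] DP LP]]]]]]]] :=
  adapted_fields x0 LD.
pose om q := Omega (chart_inv q) (dir i1) (dir i2) (dir i3).
have omC : smooth_fun U om.
  move=> k; apply: Ck_on_sub (vol_smooth Omega (dir i1) (dir i2) (dir i3) k).
  by move=> q /Ur.
have om0 q : U q -> om q != 0 by move=> _; exact: vol_dir_neq0.
have PQ := involutive_equation inv i12 i13 i23 oU Ur PC QC DP.
have [V [f [g [fg Vp fp VU fE]]]] := straighten i12 i13 i23 oU Up PC QC bC omC om0 PQ.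
pose s (k : 'I_3) := nth i1 [:: i1; i2; i3] k.
have sI : injective s.
  move=> j k /eqP; rewrite nth_uniq ?ltn_ord//= ?inE ?negb_or ?i12 ?i13 ?i23//.
  by move=> /eqP /val_inj.
have [Pm [Pm' [PmK Pm'K PmE]]] := permute_coordinates sI.
have [oV fC _ _ _] := fg.
have Pfg := local_diffeo_comp (linear_local_diffeo PmK Pm'K) fg.
set V' := [set x | _] in Pfg.
have fr : (f \o Pm) @` V' `<=` range chart.
  by move=> _ [x [_ Vx] <-]; apply: Ur; exact: VU.
have [yz zE] := local_diffeo_coordinates Pfg fr.
exists (chart @^-1` ((f \o Pm) @` V')), ((Pm' \o g) \o chart), (chart_inv \o (f \o Pm)).
split=> //; first by exists (Pm' (chart x0)); rewrite /V' /= Pm'K.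
move=> x [q V'q qx]; have Vq : V (Pm q) by case: V'q.
have Ux : U (chart x) by rewrite -qx; exact: VU.
have zE' k : coordinate_vector ((Pm' \o g) \o chart) (chart_inv \o (f \o Pm)) k x =
    'D_(dir (s k)) f (Pm q).
  by rewrite -PmE -derive_comp_linear -(zE q k V'q) qx chartK.
have E : f (Pm q) = chart x by [].
have [c1 [c1' [c1'' [c2 [c2' [c3 [D1 D2 D3 c1c2c3]]]]]]] := fE _ Vq.
rewrite E in D1 D2 D3 c1c2c3.
rewrite /coordinate_frame !zE' (D1 : 'D_(dir (s 0)) f (Pm q) = _)
  (D2 : 'D_(dir (s 1)) f (Pm q) = _) (D3 : 'D_(dir (s 2)) f (Pm q) = _).
apply: triangular_frame.
- exact: LP.
- rewrite DP//; have [-> -> ->] := plane_field_coord i12 i13 i23 P (chart x).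
  by rewrite mulr0 addr0 mulr1.
- by apply: (subvP (LD x)); rewrite LP// memv_line.
- by rewrite vol_shear -[RHS]c1c2c3 /om chartK.
Qed.

End Coordinates.

Theorem proposition6p1 (R : realType) (B : body R)
    (L : tangent_distribution B 1) (D : tangent_distribution B 2)
    (LD : forall x : B, (L x <= D x)%VS)
    (Omega : volume_form B) :
  integrable_structure (G1A_structure L D Omega) <-> involutive_distribution D.
Proof.
split; first exact: integrable_involutive.
exact: involutive_integrable.
Qed.
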